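(* Let $E=\bigcup_{j=1}^{\ell}E_j\subseteq\mathbb{C}$ be the union of $\ell$ pairwise disjoint, simply connected, compact sets with $\operatorname{cap}(E_j)>0$, all of which are symmetric with respect to $\mathbb{R}$ ($E_j^*=\{\overline z:z\in E_j\}=E_j$). Let $\Phi:E^{\mathrm c}\to L^{\mathrm c}$ be Walsh's conformal map onto the corresponding lemniscatic domain, with centers $a_1,\ldots,a_\ell$, exponents $m_1,\ldots,m_\ell$, and real points $b_1$ and $c_1<\cdots<c_{2\ell}$ as described in the context, and put $J_0=(-\infty,c_1)$, $J_j=(c_{2j},c_{2j+1})$ for $1\le j\le\ell-1$, $J_\ell=(c_{2\ell},\infty)$. Then the complex Green's function $G_L$ of $L^{\mathrm c}$ has the following properties. (i) Restricting $G_L$ to the simply connected domain $\mathbb{C}\setminus(L\cup[c_1,\infty))$, there exists a single-valued branch of $G_L$ with $G_L(c_1)=0$. This branch is given by $$G_L(w)=\sum_{j=1}^{\ell}m_j\log(a_j-w)-\log(\operatorname{cap}(E))=g_L(w)+\mathrm{i}\sum_{j=1}^{\ell}m_j\arg(a_j-w)$$ with the principal branch of the logarithm and argument, i.e. $\arg:\mathbb{C}\setminus(-\infty,0]\to(-\pi,\pi)$. This branch of $G_L$ has real values on $(-\infty,c_1]$ and, consequently, $G_L(w)=\overline{G_L(\overline w)}$ for $w\in\mathbb{C}\setminus(L\cup[c_1,\infty))$. (ii) The branch of $G_L$ in (i) satisfies $$G_L(\Phi(z))=G_E(z),\qquad z\in\mathbb{C}\setminus(E\cup[b_1,\infty)),$$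 where $G_E$ is the single-valued branch on $\mathbb{C}\setminus(E\cup[b_1,\infty))$ of the complex Green's function of $E^{\mathrm c}$ with $\lim_{x\to b_1,\,x<b_1}G_E(x)=0$. (iii) The branch of $G_L$ in (i) in $\mathbb{C}\setminus(L\cup[c_1,\infty))$ has the following boundary values: $$G_L(w)=\mathrm{i}\sum_{j=1}^{\ell}m_j\arg(a_j-w),\qquad w\in\partial L\setminus(c_1,\infty),$$ $$G_L^{\pm}(u):=\lim_{w\to u,\ w\in\mathbb{H}^{\pm}\setminus L}G_L(w)=g_L(u)\mp\mathrm{i}\pi\sum_{k=1}^{j}m_k,\qquad u\in\overline{J_j},\ j=0,1,\ldots,\ell.$$ In particular, $G_L(c_1)=0$, $G_L^{\pm}(c_{2j})=G_L^{\pm}(c_{2j+1})=\mp\mathrm{i}\pi\sum_{k=1}^{j}m_k$ for $j=1,\ldots,\ell-1$, and $G_L^{\pm}(c_{2\ell})=\mp\mathrm{i}\pi$.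
   Context: ''Simply connected'' for a compact set means connected with connected complement. $E^{\mathrm c}=\widehat{\mathbb{C}}\setminus E$, $L^{\mathrm c}=\widehat{\mathbb{C}}\setminus L$; $\operatorname{cap}$ is logarithmic capacity; $\mathbb{H}^{\pm}$ are the open upper/lower half-planes. For $K\in\{E,L\}$, $g_K$ is the real Green's function of $K^{\mathrm c}$ with pole at infinity, and the complex Green's function $G_K=g_K+\mathrm{i}h_K$ is the multi-valued analytic function on $\mathbb{C}\setminus K$ with real part $g_K$, where $h_K$ is a (multi-valued) harmonic conjugate of $g_K$; it is unique up to an additive imaginary constant. A single-valued branch on a domain is an analytic function there with real part $g_K$. Green's functions are extended by $0$ to $E$ and $L$. Walsh's theorem: there exist a unique lemniscatic domain $L^{\mathrm c}$ with $$L=\Bigl\{w\in\mathbb{C}:\prod_{j=1}^{\ell}|w-a_j|^{m_j}\le\operatorname{cap}(E)\Bigr\},$$ $a_1,\ldots,a_\ell\in\mathbb{C}$ pairwise distinct, $m_1,\ldots,m_\ell>0$, $\sum_j m_j=1$, and a unique conformal map $\Phi:E^{\mathrm c}\to L^{\mathrm c}$ with $\Phi(z)=z+\mathcal{O}(1/z)$ at $\infty$. One has $g_L(w)=\sum_{j=1}^{\ell}m_j\log|w-a_j|-\log(\operatorname{cap}(E))$ for $w\in\mathbb{C}\setminus L$, and $g_E(z)=g_L(\Phi(z))$. Under the symmetry assumption: each $E_j\cap\mathbb{R}$ is a compact interval or a point, $E_j\cap\mathbb{R}=[b_{2j-1},b_{2j}]$, with the components labelled so that $b_1\le b_2<b_3\le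 b_4<\cdots<b_{2\ell-1}\le b_{2\ell}$. The set $L$ has $\ell$ components $L_1,\ldots,L_\ell$, each symmetric with respect to $\mathbb{R}$, the $a_j$ are real, and the labelling is such that $a_j\in L_j$ and $L_j\cap\mathbb{R}=[c_{2j-1},c_{2j}]$ with $c_1<c_2<\cdots<c_{2\ell}$ and $c_{2j-1}<a_j<c_{2j}$. *)

(* Defs.v *)
From HB Require Import structures.
From mathcomp Require Import all_boot all_order all_algebra.
From mathcomp Require Import complex.
From mathcomp Require Import all_classical all_reals all_analysis.

Set Implicit Arguments.
Unset Strict Implicit.
Unset Printing Implicit Defensive.

Import Order.TTheory GRing.Theory Num.Theory.
Import numFieldNormedType.Exports.

Local Open Scope classical_set_scope.
Local Open Scope ring_scope.
Local Open Scope complex_scope.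

(* The regular alias [^o] is what carries the topology and the structure of
   normed module over itself; [R[i]] alone has neither. *)
Notation Cplx R := (complex R)^o.

Section ComplexPlane.
Variable R : realType.
Local Notation C := (Cplx R).

Definition cmod (z : C) : R := complex.Re `|z|.

(* Principal argument, with values in ]-pi, pi[ off ]-oo, 0]; on the negative
   half-line the value is pi, and at 0 it is meaningless. *)
Definition Arg (z : C) : R :=
  if 0 <= complex.Im z then acos (complex.Re z / cmod z)
  else - acos (complex.Re z / cmod z).

Definition Log (z : C) : C := ln (cmod z) +i* Arg z.

Definition real_ray (x0 : R) : set C := [set x%:C | x in `[x0, +oo[ ].

Definition open_real_ray (x0 : R) : set C := [set x%:C | x in `]x0, +oo[ ].

Definition slit_domain (K : set C) (x0 : R) : set C :=
  ~` (K `|` real_ray x0).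

Definition upper_half_plane : set C := [set z | 0 < complex.Im z].

Definition lower_half_plane : set C := [set z | complex.Im z < 0].

(* Complement in the Riemann sphere. *)
Definition sphere_compl (A : set C) : set (one_point_compactification C) :=
  ~` (Some @` A).

Definition simply_connected_compact (K : set C) : Prop :=
  [/\ compact K, connected K & connected (sphere_compl K)].

Definition simply_connected_domain (D : set C) : Prop :=
  [/\ D !=set0, open D, connected D & connected (sphere_compl D)].

(* Complex differentiability at every point of [D], meant for open [D]. *)
Definition holomorphic_on (D : set C) (f : C -> C) : Prop :=
  forall z, D z -> derivable f z 1.

Definition biholomorphic (U V : set C) (f : C -> C) : Prop :=
  exists g : C -> C,
    [/\ holomorphic_on U f, holomorphic_on V g,
        forall z, U z -> V (f z) /\ g (f z) = z
      & forall w, V w -> U (g w) /\ f (g w) = w].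

(* Restriction of [u] to the real line through [z] with direction [v]; the
   partial derivatives in x and y are obtained for [v = 1] and [v = 'i]. *)
Definition slice (v : C) (u : C -> R) (z : C) (t : R) : R := u (z + t%:C * v).

Definition partial (v : C) (u : C -> R) (z : C) : R := derive1 (slice v u z) 0.

Definition C1_on (D : set C) (u : C -> R) : Prop :=
  forall v : C, v = 1 \/ v = 'i -> forall z, D z ->
    derivable (slice v u z) 0 1 /\ {for z, continuous (partial v u)}.

Definition harmonic_on (D : set C) (u : C -> R) : Prop :=
  [/\ C1_on D u, C1_on D (partial 1 u), C1_on D (partial 'i u)
    & forall z, D z ->
        partial 1 (partial 1 u) z + partial 'i (partial 'i u) z = 0].

(* Green's function of the complement of the compact set [K] with pole at
   infinity, in the classical sense (zero boundary values at all points of the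
   boundary), extended by 0 to [K]. *)
Record is_green (K : set C) (g : C -> R) : Prop := IsGreen {
  green_harmonic : harmonic_on (~` K) g;
  green_pole : exists M r : R,
    forall z, r < cmod z -> `|g z - ln (cmod z)| <= M;
  green_cont : continuous g;
  green_on : forall z, K z -> g z = 0
}.

(* Single-valued branch on [D] of the complex Green's function whose real part
   is the Green's function [g]. *)
Definition green_branch (g : C -> R) (D : set C) (G : C -> C) : Prop :=
  holomorphic_on D G /\ forall z, D z -> complex.Re (G z) = g z.

Definition borelC := g_sigma_algebraType (@open C).

(* [lne] is the logarithm on [0, +oo] with [lne 0 = -oo]. *)
Definition log_energy (K : set C) (mu : probability borelC R) : \bar R :=
  (\int[mu]_(z in K) \int[mu]_(w in K) lne (cmod ((z : C) - (w : C)))%:E)%E.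

(* Logarithmic capacity of a compact set: the supremum of exp(I(mu)) over the
   Borel probability measures mu on [K], where I(mu) is the logarithmic
   energy, an element of [-oo, +oo[. *)
Definition capacity (K : set C) : R :=
  fine (ereal_sup [set expeR (log_energy K mu) |
                    mu in [set mu : probability borelC R | mu K = 1%E]]).

End ComplexPlane.

(* All families are indexed from 1, as in E_1, ..., E_l. *)
Section Walsh.
Variable R : realType.
Local Notation C := (Cplx R).

Definition union_upto (l : nat) (E : nat -> set C) : set C :=
  \bigcup_(j in [set j | (1 <= j <= l)%N]) E j.

Definition lemniscatic_set (l : nat) (a : nat -> C) (m : nat -> R) (r : R) :
    set C :=
  [set w | \prod_(1 <= j < l.+1) cmod (w - a j) `^ m j <= r].

(* [Phi] is Walsh's map of the complement of [E]. Since [Phi z - z] tends to 0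
   at infinity, [Phi] extends to the spheres by fixing infinity, so that only
   the finite parts of the two domains need to be mentioned. *)
Record walsh_map (l : nat) (E : set C) (a : nat -> C) (m : nat -> R)
    (Phi : C -> C) : Prop := WalshMap {
  walsh_centers_neq : forall j k, (1 <= j <= l)%N -> (1 <= k <= l)%N ->
    a j = a k -> j = k;
  walsh_exponents_gt0 : forall j, (1 <= j <= l)%N -> 0 < m j;
  walsh_exponents_sum : \sum_(1 <= j < l.+1) m j = 1;
  walsh_conformal :
    biholomorphic (~` E) (~` lemniscatic_set l a m (capacity E)) Phi;
  walsh_normalized : exists M r : R,
    forall z, r < cmod z -> cmod (Phi z - z) <= M / cmod z
}.

Record symmetric_family (l : nat) (E : nat -> set C) : Prop :=
  SymmetricFamily {
  family_nonempty : (1 <= l)%N;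
  family_simply_connected : forall j, (1 <= j <= l)%N ->
    simply_connected_compact (E j);
  family_disjoint : trivIset [set j | (1 <= j <= l)%N] E;
  family_capacity : forall j, (1 <= j <= l)%N -> 0 < capacity (E j);
  family_symmetric : forall j, (1 <= j <= l)%N ->
    [set (z : C)^* | z in E j] = E j
}.

(* The sets E_j meet the real line in the intervals [b_(2j-1), b_(2j)], from
   left to right. *)
Record real_labelling (l : nat) (E : nat -> set C) (b : nat -> R) : Prop :=
  RealLabelling {
  labelling_trace : forall j, (1 <= j <= l)%N ->
    [set x : R | E j x%:C] = [set` `[b (2 * j - 1)%N, b (2 * j)%N]];
  labelling_le : forall j, (1 <= j <= l)%N ->
    b (2 * j - 1)%N <= b (2 * j)%N;
  labelling_lt : forall j, (1 <= j < l)%N ->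
    b (2 * j)%N < b (2 * j + 1)%N
}.

(* The components of [L] are the L_j containing the a_j, for 1 <= j <= l, they
   meet the real line in the intervals [c_(2j-1), c_(2j)], from left to right,
   and the centers are real. *)
Record lemniscatic_labelling (l : nat) (L : set C) (a : nat -> C)
    (c : nat -> R) : Prop := LemniscaticLabelling {
  components_cover :
    L = union_upto l (fun j => connected_component L (a j));
  components_disjoint :
    trivIset [set j | (1 <= j <= l)%N] (fun j => connected_component L (a j));
  centers_in : forall j, (1 <= j <= l)%N -> L (a j);
  components_trace : forall j, (1 <= j <= l)%N ->
    [set x : R | connected_component L (a j) x%:C] =
      [set` `[c (2 * j - 1)%N, c (2 * j)%N]];
  endpoints_lt : forall i, (1 <= i < 2 * l)%N -> c i < c i.+1;
  centers_real : forall j, (1 <= j <= l)%N -> complex.Im (a j) = 0;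
  centers_between : forall j, (1 <= j <= l)%N ->
    c (2 * j - 1)%N < complex.Re (a j) < c (2 * j)%N
}.

(* J_0, ..., J_l: the components of the real line minus the intervals
   [c_(2j-1), c_(2j)]. *)
Definition gap (l : nat) (c : nat -> R) (j : nat) : set R :=
  if j == 0%N then [set` `]-oo, c 1%N[]
  else if j == l then [set` `]c (2 * l)%N, +oo[]
  else [set` `]c (2 * j)%N, c (2 * j + 1)%N[].

End Walsh.

(* Main.v *)
(** Off [L] the Green's function is [g0 = sum m_j ln |w - a_j| - ln r] with
    [r = cap E], by the maximum principle; [r > 0] because otherwise [L] would
    reduce to the centers.  The same principle gives [g0 (Phi z) = gE z].  As
    [Phi] is only assumed to be complex differentiable, the maximum principle
    is needed for [g + Re f] with [g] harmonic and [f] complex differentiable: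
    by Goursat's theorem [Re f] is locally a uniform limit of difference
    quotients of functions with vanishing Laplacian.

    Since the centers are real, [Phi] commutes with conjugation: the map
    [T w = (Phi ((Psi w)^* ))^*], with [Psi] the inverse of [Phi], satisfies
    [g0 (T w) = g0 w], so that [F (T w) - F w] is locally constant for
    [F w = sum m_j Log (w - a_j)].  It tends to 0 at infinity, and [F] is
    injective on the upper half-plane as [Im F' < 0]; hence [T] is the identity
    near infinity, then on the connected set of points of the upper half-plane
    off [L], and finally on the whole complement of [L].  Therefore [Phi] maps
    the real points left of [b_1] to those left of [c_1], and conversely.

    Boundary values come from the limits of [Arg (a_j - w)], branches being
    unique because holomorphic functions with zero real part on a connected
    open set are constant. *)
Require Import Defs.
From HB Require Import structures.
From mathcomp Require Import all_boot all_order all_algebra.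
From mathcomp Require Import complex zify ring lra.
From mathcomp Require Import all_classical all_reals all_analysis.

Set Implicit Arguments.
Unset Strict Implicit.
Unset Printing Implicit Defensive.

Import Order.TTheory GRing.Theory Num.Theory.
Import numFieldNormedType.Exports.

Local Open Scope classical_set_scope.
Local Open Scope ring_scope.
Local Open Scope complex_scope.

(** * Complex differentiability in terms of the modulus *)

Section ComplexToolkit.
Variable R : realType.
Local Notation C := (Cplx R).
Local Notation ReC := complex.Re.
Local Notation ImC := complex.Im.
Implicit Types (z w : C) (x y : R).

(** Three obstacles shape the argument. Nothing is known of a complex derivative beyond its
    existence at each point, so Re f offers no second derivatives and subharmonicity is tested by
    paraboloids touching from above. Of integration theory only rectangles are needed: Goursat's
    argument has to supply no more than the real part of a local primitive. Near infinity a Green's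
    function is known only up to a bounded error beside ln |z|, so that g - h need not have a sign
    there. Comparing g with (1 + e) h and (1 - e) h restores one. At the other end [Phi] has no
    extension to the boundary of E; that g0 (Phi z) tends to 0 there is expressed by closedness in
    the plane of the sets where it is at least eta > 0, a condition that compactness carries through
    [Phi]. [walsh_map] asserts no uniqueness of [Phi], so symmetry cannot be had by observing that
    the conjugated map satisfies the same conditions. Instead both maps pull g0 back to the same gE,
    which leaves a phase to be determined, and logarithms that are single-valued only off the real
    line. *)

Lemma normC_cmod z : `|z| = (cmod z)%:C.
Proof. by rewrite /cmod normc_def. Qed.

Lemma cmodE z : cmod z = Num.sqrt (ReC z ^+ 2 + ImC z ^+ 2).
Proof. by rewrite /cmod normc_def. Qed.

Lemma sqr_cmod z : cmod z ^+ 2 = ReC z ^+ 2 + ImC z ^+ 2.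
Proof. by rewrite cmodE sqr_sqrtr // addr_ge0 // sqr_ge0. Qed.

Lemma cmod_ge0 z : 0 <= cmod z.
Proof. by rewrite cmodE sqrtr_ge0. Qed.

Lemma cmodM z w : cmod (z * w) = cmod z * cmod w.
Proof. by apply: complexI; rewrite rmorphM /= -!normC_cmod normrM. Qed.

Lemma cmodD z w : cmod (z + w) <= cmod z + cmod w.
Proof. by rewrite -lecR rmorphD /= -!normC_cmod ler_normD. Qed.

Lemma cmodN z : cmod (- z) = cmod z.
Proof. by apply: complexI; rewrite -!normC_cmod normrN. Qed.

Lemma cmodBC z w : cmod (z - w) = cmod (w - z).
Proof. by rewrite -cmodN opprB. Qed.

Lemma cmodB_le z w : cmod (z - w) <= cmod z + cmod w.
Proof. by rewrite -(cmodN w) cmodD. Qed.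

Lemma cmodB_ge z w : cmod z - cmod w <= cmod (z - w).
Proof. by rewrite lerBlDr -[X in cmod X <= _](subrK w) cmodD. Qed.

Lemma cmod_triangle u z w : cmod (z - w) <= cmod (z - u) + cmod (u - w).
Proof. by rewrite (_ : z - w = (z - u) + (u - w)) ?cmodD //; ring. Qed.

Lemma cmod0 : cmod (0 : C) = 0.
Proof. by apply: complexI; rewrite -normC_cmod normr0. Qed.

Lemma cmod1 : cmod (1 : C) = 1.
Proof. by apply: complexI; rewrite -normC_cmod normr1. Qed.

Lemma cmod_eq0 z : (cmod z == 0) = (z == 0).
Proof.
by rewrite -(inj_eq (@complexI R)) -normC_cmod -[LHS]/(`|z| == 0) normr_eq0.
Qed.

Lemma cmod_gt0 z : (0 < cmod z) = (z != 0).
Proof. by rewrite lt_def cmod_ge0 andbT cmod_eq0. Qed.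

Lemma cmodV z : cmod (z^-1) = (cmod z)^-1.
Proof.
have [->|z0] := eqVneq z 0; first by rewrite invr0 cmod0 invr0.
have c0 : cmod z != 0 by rewrite cmod_eq0.
by apply: (mulfI c0); rewrite -cmodM !divff // cmod1.
Qed.

Lemma cmod_real x : cmod (x%:C : C) = `|x|.
Proof. by rewrite cmodE /= expr0n addr0 sqrtr_sqr. Qed.

Lemma cmod_conj z : cmod (z^*) = cmod z.
Proof. by rewrite !cmodE; case: z => a b /=; rewrite sqrrN. Qed.

Lemma abs_Re_le z : `|ReC z| <= cmod z.
Proof. by rewrite cmodE -sqrtr_sqr ler_wsqrtr // lerDl sqr_ge0. Qed.

Lemma abs_Im_le z : `|ImC z| <= cmod z.
Proof. by rewrite cmodE -sqrtr_sqr ler_wsqrtr // lerDr sqr_ge0. Qed.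

Lemma cmod_le_ReIm z : cmod z <= `|ReC z| + `|ImC z|.
Proof.
rewrite -(ler_pXn2r (n := 2)) ?nnegrE ?cmod_ge0 ?addr_ge0 //.
rewrite sqr_cmod sqrrD !real_normK ?num_real // lerD2r lerDl.
by rewrite mulrn_wge0 // mulr_ge0.
Qed.

Lemma cReD z w : ReC (z + w) = ReC z + ReC w.
Proof. by case: z; case: w. Qed.
Lemma cImD z w : ImC (z + w) = ImC z + ImC w.
Proof. by case: z; case: w. Qed.
Lemma cReN z : ReC (- z) = - ReC z.
Proof. by case: z. Qed.
Lemma cImN z : ImC (- z) = - ImC z.
Proof. by case: z. Qed.
Lemma cReM z w : ReC (z * w) = ReC z * ReC w - ImC z * ImC w.
Proof. by case: z; case: w. Qed.
Lemma cImM z w : ImC (z * w) = ReC z * ImC w + ImC z * ReC w.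
Proof. by case: z; case: w. Qed.
Lemma cRe_conj z : ReC (z^*) = ReC z.
Proof. by case: z. Qed.
Lemma cIm_conj z : ImC (z^*) = - ImC z.
Proof. by case: z. Qed.

Definition ReImE := (cReD, cImD, cReN, cImN, cReM, cImM, cRe_conj, cIm_conj).

Lemma complex_ext z w : ReC z = ReC w -> ImC z = ImC w -> z = w.
Proof. by case: z => a b; case: w => c d /= -> ->. Qed.

(** Radii of balls are elements of [R[i]]; being positive they are real, so real radii suffice. *)
Lemma nbhsC_P z (A : set C) :
  nbhs z A <-> exists2 e : R, 0 < e & forall w, cmod (w - z) < e -> A w.
Proof.
split=> [/nbhs_ballP[e /= e0 eA]|[e e0 eA]].
  have eE : e = (ReC e)%:C.
    by apply: complex_ext => //=; rewrite ger0_Im // ltW.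
  exists (ReC e); first by rewrite -ltcR -eE.
  move=> w ew; apply: eA => /=; rewrite -ball_normE /=.
  by rewrite normC_cmod eE ltcR cmodBC.
apply/nbhs_ballP; exists e%:C => /=; first by rewrite ltcR.
by move=> w /=; rewrite -ball_normE /= normC_cmod ltcR cmodBC => /eA.
Qed.

Lemma nbhsC_ball z (e : R) : 0 < e -> nbhs z [set w | cmod (w - z) < e].
Proof. by move=> e0; apply/nbhsC_P; exists e. Qed.

Lemma cvgC_P {T : Type} (F : set_system T) {FF : Filter F} (f : T -> C) (z : C) :
  f @ F --> z <-> forall e : R, 0 < e -> \forall t \near F, cmod (f t - z) < e.
Proof.
split=> [fz e e0|fz A /nbhsC_P[e e0 eA]].
  by have := fz _ (nbhsC_ball z e0).
by have := fz e e0; apply: (@filterS _ F FF) => t /eA.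
Qed.

Lemma continuousC_R_P (v : C -> R) z : {for z, continuous v} <->
  forall e : R, 0 < e -> exists2 d : R, 0 < d &
    forall w, cmod (w - z) < d -> `|v w - v z| < e.
Proof.
split=> [h e e0|h].
  have /nbhsC_P[d d0 dP] : nbhs z (v @^-1` [set y | `|v z - y| < e]).
    by apply: h; apply/nbhs_ballP; exists e => //= y; rewrite -ball_normE.
  by exists d => // w /dP /=; rewrite distrC.
move=> A /nbhs_ballP[e /= /h[d d0 dP] eA].
apply/nbhsC_P; exists d => // w /dP we; apply: eA.
by rewrite -ball_normE /= distrC.
Qed.

Lemma continuousC_C_P (f : C -> C) z : {for z, continuous f} <->
  forall e : R, 0 < e -> exists2 d : R, 0 < d &
    forall w, cmod (w - z) < d -> cmod (f w - f z) < e.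
Proof.
split=> [h e e0|h].
  by have /nbhsC_P := h _ (nbhsC_ball (f z) e0).
by move=> A /nbhsC_P[e /h[d d0 dP] eA]; apply/nbhsC_P; exists d => // w /dP /eA.
Qed.

Lemma openC_P (U : set C) : open U <->
  forall z, U z -> exists2 e : R, 0 < e & forall w, cmod (w - z) < e -> U w.
Proof.
by rewrite openE; split=> h z /h /nbhsC_P.
Qed.

(** The weak inequality without division holds at h = 0 too, so no punctured neighbourhood is needed
    and all estimates stay in [R]. *)
Definition cder (f : C -> C) z (d : C) := forall e : R, 0 < e ->
  exists2 r : R, 0 < r & forall h : C, cmod h < r ->
    cmod (f (z + h) - f z - d * h) <= e * cmod h.

Definition rder (f : R -> R) x (d : R) := forall e : R, 0 < e ->
  exists2 r : R, 0 < r & forall h : R, `|h| < r ->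
    `|f (x + h) - f x - d * h| <= e * `|h|.

(** Stated over any [numFieldType] so as to serve complex and real derivatives alike. *)
Lemma diffquo_cvgP (K : numFieldType) (f : K^o -> K^o) (z d : K^o) :
  (h^-1 *: (f (h *: (1 : K^o) + z) - f z) @[h --> 0^'] --> d) <->
  forall e : K, 0 < e -> \forall h \near (0 : K),
    `|f (z + h) - f z - d * h| <= e * `|h|.
Proof.
split=> [/cvgrPdist_le H e e0|H].
  have := H e e0; rewrite !near_withinE; apply: filterS => h /= Hh.
  have [->|h0] := eqVneq h 0.
    by rewrite addr0 subrr mulr0 subr0 normr0 mulr0.
  have := Hh h0; rewrite -(ler_pM2r (_ : 0 < `|h|)) ?normr_gt0 // -normrM.
  rewrite scaler1 mulrBl /GRing.scale /= mulrAC mulVf // mul1r.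
  by rewrite distrC [h + z]addrC.
apply/cvgrPdist_le => e e0; have := H e e0.
rewrite !near_withinE; apply: filterS => h /= Hh h0.
rewrite -(ler_pM2r (_ : 0 < `|h|)) ?normr_gt0 // -normrM.
rewrite scaler1 mulrBl /GRing.scale /= mulrAC mulVf // mul1r.
by rewrite distrC [h + z]addrC.
Qed.


Lemma cderP (f : C -> C) z (d : C) :
  (h^-1 *: (f (h *: (1 : C) + z) - f z) @[h --> (0 : C)^'] --> d) <-> cder f z d.
Proof.
apply: (iff_trans (@diffquo_cvgP R[i] f z d)); split=> H e e0.
  have e0' : (0 : R[i]) < e%:C by rewrite ltcR.
  have [r r0 rP] := (nbhsC_P (0 : C) _).1 (H _ e0').
  exists r => // h hr; have := rP h; rewrite subr0 => /(_ hr) /=.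
  by rewrite !normC_cmod -rmorphM /= lecR.
have eE : e = (ReC e)%:C by apply: complex_ext => //=; rewrite ger0_Im // ltW.
have e0' : 0 < ReC e by rewrite -ltcR -eE.
have [r r0 rP] := H _ e0'.
apply/(nbhsC_P (0 : C)); exists r => // h; rewrite subr0 => /rP /=.
by rewrite eE !normC_cmod -rmorphM /= lecR.
Qed.

Lemma derivableC_P (f : C -> C) z : derivable f z 1 <-> exists d, cder f z d.
Proof.
split=> [/cvg_ex[d /cderP fd]|[d fd]]; first by exists d.
by apply/cvg_ex; exists d; apply/cderP.
Qed.

Lemma rderP (f : R -> R) x d : is_derive x 1 f d <-> rder f x d.
Proof.
split=> [[/derivableP fx <-]|H].
  have /(diffquo_cvgP (K := R)) H := @ex_derive _ _ _ _ _ _ _ fx.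
  move=> e /H /nbhs_ballP[r /= r0 rP]; exists r => // h hr.
  by apply: rP; rewrite -ball_normE /= sub0r normrN.
have {}H : h^-1 *: (f (h *: (1 : R) + x) - f x) @[h --> 0^'] --> d.
  apply/(diffquo_cvgP (K := R)) => e /H[r r0 rP]; apply/nbhs_ballP.
  exists r => //= h; rewrite -ball_normE /= sub0r normrN; exact: rP.
split; first by apply/cvg_ex; exists d.
exact: (cvg_lim (@norm_hausdorff _ _) H).
Qed.

Lemma cder_cont f z d : cder f z d -> {for z, continuous f}.
Proof.
move=> H; apply/continuousC_C_P => e e0.
have [r r0 rP] := H 1 ltr01.
have k0 : 0 < cmod d + 2 by rewrite ltr_wpDl ?cmod_ge0.
exists (Num.min r (e / (cmod d + 2))).
  by rewrite lt_min r0 divr_gt0.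
move=> w; rewrite lt_min ltr_pdivlMr // => /andP[w1 w2].
have := rP _ w1; rewrite (_ : z + (w - z) = w); last by ring.
rewrite mul1r => H1.
have H2 : cmod (f w - f z) <= cmod (w - z) + cmod d * cmod (w - z).
  rewrite -cmodM (le_trans _ (lerD H1 (lexx _))) //.
  by have := cmodD (f w - f z - d * (w - z)) (d * (w - z)); rewrite subrK.
have := cmod_ge0 (w - z); nra.
Qed.

Lemma cder_ext_near f g z d (r : R) : 0 < r ->
  (forall w, cmod (w - z) < r -> f w = g w) -> cder f z d -> cder g z d.
Proof.
move=> r0 fg H e /H[s s0 sP]; exists (Num.min r s); first by rewrite lt_min r0.
move=> h; rewrite lt_min => /andP[hr hs].
have zE : z + h - z = h by ring.
by rewrite -!fg ?zE ?subrr ?cmod0 //; exact: sP.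
Qed.

Lemma cderD f g z d e : cder f z d -> cder g z e ->
  cder (fun w => f w + g w) z (d + e).
Proof.
move=> H1 H2 t t0; have t2 : 0 < t / 2 by lra.
have [r r0 rP] := H1 _ t2; have [s s0 sP] := H2 _ t2.
exists (Num.min r s); first by rewrite lt_min r0.
move=> h; rewrite lt_min => /andP[/rP A /sP B].
rewrite (_ : _ - _ = (f (z + h) - f z - d * h) + (g (z + h) - g z - e * h)); last by ring.
by apply: le_trans (cmodD _ _) _; lra.
Qed.

Lemma cderZ f z d k : cder f z d -> cder (fun w => k * f w) z (k * d).
Proof.
move=> H t t0; have k0 : 0 < cmod k + 1 by rewrite ltr_wpDl ?cmod_ge0.
have [r r0 rP] := H _ (divr_gt0 t0 k0); exists r => // h /rP A.
rewrite (_ : _ - _ = k * (f (z + h) - f z - d * h)); last by ring.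
rewrite cmodM; move: A; rewrite mulrAC ler_pdivlMr // => A.
by have := cmod_ge0 (f (z + h) - f z - d * h); have := cmod_ge0 k; nra.
Qed.

Lemma cderN f z d : cder f z d -> cder (fun w => - f w) z (- d).
Proof.
move=> /(cderZ (-1)); rewrite mulN1r; apply: cder_ext_near ltr01 _ => w _.
by rewrite mulN1r.
Qed.

Lemma cderB f g z d e : cder f z d -> cder g z e ->
  cder (fun w => f w - g w) z (d - e).
Proof. by move=> H1 /cderN H2; apply: cderD. Qed.

Lemma cder_cst k z : cder (fun=> k) z 0.
Proof.
move=> e e0; exists 1 => // h _.
by rewrite subrr mul0r subr0 cmod0 mulr_ge0 ?cmod_ge0 // ltW.
Qed.

Lemma cder_id z : cder id z 1.
Proof.
move=> e e0; exists 1 => // h _.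
rewrite (_ : _ - _ = 0); last by ring.
by rewrite cmod0 mulr_ge0 ?cmod_ge0 // ltW.
Qed.

Lemma cder_affine (k b : C) z : cder (fun w => k * w + b) z k.
Proof. by have := cderD (cderZ k (cder_id z)) (cder_cst b z); rewrite mulr1 addr0. Qed.

Lemma cder_sum (I : Type) (r : seq I) (P : pred I) (F : I -> C -> C) (d : I -> C) z :
  (forall i, P i -> cder (F i) z (d i)) ->
  cder (fun w => \sum_(i <- r | P i) F i w) z (\sum_(i <- r | P i) d i).
Proof.
move=> H; elim: r => [|i r IH].
  rewrite big_nil; apply: cder_ext_near ltr01 _ (cder_cst 0 z) => w _.
  by rewrite big_nil.
rewrite big_cons; case: ifP => Pi.
  apply: cder_ext_near ltr01 _ (cderD (H _ Pi) IH) => w _.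
  by rewrite big_cons Pi.
by apply: cder_ext_near ltr01 _ IH => w _; rewrite big_cons Pi.
Qed.

Lemma cder_comp f g z d e : cder f z d -> cder g (f z) e ->
  cder (fun w => g (f w)) z (e * d).
Proof.
move=> Hf Hg t t0.
have kd : 0 < cmod d + 1 by rewrite ltr_wpDl ?cmod_ge0.
have ke : 0 < cmod e + 1 by rewrite ltr_wpDl ?cmod_ge0.
(* Each half of t pays for one error: that of g over the increment k of f, where |k| <= (|d| + 1)
   |h|, and e times that of f. The bound 1 in [t2] is what gives this estimate of k. *)
have t1 : 0 < t / (2 * (cmod d + 1)) by rewrite divr_gt0 // mulr_gt0.
have t2 : 0 < Num.min 1 (t / (2 * (cmod e + 1))).
  by rewrite lt_min ltr01 divr_gt0 // mulr_gt0.
have [r r0 rP] := Hg _ t1; have [s s0 sP] := Hf _ t2.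
have := (continuousC_C_P f z).1 (cder_cont Hf) _ r0 => -[q q0 qP].
exists (Num.min s q); first by rewrite lt_min s0.
move=> h; rewrite lt_min => /andP[hs hq].
have {qP} := qP (z + h); rewrite (_ : z + h - z = h); last by ring.
move=> /(_ hq) /rP; set k := f (z + h) - f z.
rewrite (_ : f z + k = f (z + h)); last by rewrite /k; ring.
move=> A; have := sP _ hs; rewrite -/k => B.
have B1 : cmod (k - d * h) <= cmod h.
  by apply: le_trans B _; rewrite ler_piMl ?cmod_ge0 // ge_min lexx.
have B2 : cmod (k - d * h) <= t / (2 * (cmod e + 1)) * cmod h.
  by apply: le_trans B _; rewrite ler_wpM2r ?cmod_ge0 // ge_min lexx orbT.
have B3 : cmod k <= (cmod d + 1) * cmod h.
  have := cmodD (k - d * h) (d * h); rewrite subrK cmodM; lra.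
have A1 : cmod (g (f (z + h)) - g (f z) - e * k) <= t / 2 * cmod h.
  apply: le_trans A _; apply: (le_trans (ler_wpM2l (ltW t1) B3)).
  by rewrite invfM -!mulrA (mulrA _^-1 (cmod d + 1)) mulVf ?mul1r // gt_eqF.
have A2 : cmod (e * (k - d * h)) <= t / 2 * cmod h.
  rewrite cmodM; apply: (le_trans (ler_wpM2l (cmod_ge0 e) B2)).
  rewrite mulrA ler_wpM2r ?cmod_ge0 // mulrA ler_pdivrMr ?mulr_gt0 //.
  have := cmod_ge0 e; nra.
rewrite (_ : _ - _ = (g (f (z + h)) - g (f z) - e * k) + e * (k - d * h)); last by ring.
by apply: le_trans (cmodD _ _) _; lra.
Qed.

Lemma cder_conj f z d : cder f (z^* : C) d ->
  cder (fun w => (f (w^* : C))^* : C) z (d^*).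
Proof.
move=> H e /H[r r0 rP]; exists r => // h hr.
have := rP (h^*); rewrite cmod_conj => /(_ hr); rewrite -cmod_conj.
by rewrite !rmorphB rmorphM /= rmorphD /= !conjcK.
Qed.

(** Real parts suffice: imaginary parts are reached by applying this to f multiplied by 'i or -
    'i. *)
Lemma cder_line f (z v : C) (t : R) d : cder f (z + t%:C * v) d ->
  rder (fun s => ReC (f (z + s%:C * v))) t (ReC (d * v)).
Proof.
move=> H e e0; have k0 : 0 < cmod v + 1 by rewrite ltr_wpDl ?cmod_ge0.
have [r r0 rP] := H _ (divr_gt0 e0 k0).
exists (r / (cmod v + 1)); first by rewrite divr_gt0.
move=> h; rewrite ltr_pdivlMr // => hr.
have hv : cmod (h%:C * v) < r.
  by rewrite cmodM cmod_real; have := normr_ge0 h; nra.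
have {rP} := rP _ hv.
rewrite (_ : z + t%:C * v + h%:C * v = z + (t + h)%:C * v); last first.
  by rewrite rmorphD /=; ring.
move=> A; have := le_trans (abs_Re_le _) A.
rewrite cmodM cmod_real.
rewrite (_ : ReC _ = ReC (f (z + (t + h)%:C * v)) - ReC (f (z + t%:C * v))
   - ReC (d * v) * h); last by rewrite !ReImE /=; ring.
move=> B; apply: le_trans B _; rewrite -mulrA (ler_wpM2l (ltW e0)) // ler_pdivrMl //.
by have := normr_ge0 h; nra.
Qed.

End ComplexToolkit.

(** * Goursat's theorem on rectangles *)

Section Goursat.
Variable R : realType.

(** Integrals along the sides of rectangles enter below only through such antiderivatives. *)
Lemma antiderivative (f : R -> R) (a b : R) :
  (forall x, a <= x <= b -> {for x, continuous f}) ->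
  exists F : R -> R, forall x, a < x < b -> is_derive x 1 F (f x).
Proof.
move=> cf; exists (fun x => (\int[lebesgue_measure]_(t in `[a, x]) f t)%R).
move=> x /andP[ax xb].
have fi : lebesgue_measure.-integrable `[a, b] (EFin \o f).
  apply: continuous_compact_integrable; first exact: segment_compact.
  apply: continuous_in_subspaceT => t; rewrite inE /= in_itv /= => ?; exact: cf.
have [] := continuous_FTC1_closed xb fi ax _.
  by apply: cf; rewrite !ltW.
move=> dF FE; split; first exact: dF.
by rewrite -FE derive1E.
Qed.

(** The mean value theorem is applied to F - G, so that both integrands are taken at the same point.
    On opposite sides of a rectangle this makes the linear terms comparable. *)
Lemma MVT_diff (F G f g : R -> R) (a b : R) : a < b ->
  (forall t, a <= t <= b -> is_derive t 1 F (f t)) ->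
  (forall t, a <= t <= b -> is_derive t 1 G (g t)) ->
  exists2 c, a < c < b & (F b - F a) - (G b - G a) = (f c - g c) * (b - a).
Proof.
move=> ab dF dG.
have d t : a <= t <= b -> is_derive t 1 (F \- G) (f t - g t).
  by move=> tab; have := dF _ tab; have := dG _ tab => ? ?; exact: is_deriveB.
have [||c cab E] := @MVT R (F \- G) (fun t => f t - g t) a b ab.
- by move=> t /[!in_itv]/= /andP[? ?]; apply: d; rewrite !ltW.
- apply: continuous_in_subspaceT => t; rewrite inE /= in_itv /= => /d H.
  exact/differentiable_continuous/derivable1_diffP.
exists c; first by move: cab; rewrite in_itv.
by rewrite -E /=; ring.
Qed.

Variables (u v X Y : R -> R -> R) (s : R).
Hypothesis HX : forall y t : R, `|y| < s -> `|t| < s -> is_derive t 1 (X y) (u t y).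
Hypothesis HY : forall x t : R, `|x| < s -> `|t| < s -> is_derive t 1 (Y x) (v x t).
Hypothesis Huv : forall x y, `|x| < s -> `|y| < s -> exists a b : R,
  forall e, 0 < e -> exists2 r, 0 < r & forall h k, `|h| < r -> `|k| < r ->
    `|u (x + h) (y + k) - u x y - (a * h - b * k)| <= e * (`|h| + `|k|) /\
    `|v (x + h) (y + k) - v x y - (b * h + a * k)| <= e * (`|h| + `|k|).

(* The integral of [u dx - v dy] along the boundary of the rectangle with lower
   left corner [(x, y)], width [w] and height [h]. *)
Let I x y w h := (X y (x + w) - X y x) - (X (y + h) (x + w) - X (y + h) x)
  - ((Y (x + w) (y + h) - Y (x + w) y) - (Y x (y + h) - Y x y)).

Let Q x y w h := [/\ - s < x, x + w < s, - s < y & y + h < s].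

(** Here a + ib is the derivative at (p, q). The linear part contributes b h w through the
    horizontal sides and b w h through the vertical ones, and these cancel; only the remainders,
    each at most e (w + h), are left. *)
Lemma rectangle_estimate x y w h p q a b e r : 0 < w -> 0 < h -> Q x y w h ->
  x <= p <= x + w -> y <= q <= y + h -> w < r -> h < r -> 0 < e ->
  (forall h k, `|h| < r -> `|k| < r ->
    `|u (p + h) (q + k) - u p q - (a * h - b * k)| <= e * (`|h| + `|k|) /\
    `|v (p + h) (q + k) - v p q - (b * h + a * k)| <= e * (`|h| + `|k|)) ->
  `|I x y w h| <= 2 * e * (w + h) ^+ 2.
Proof.
move=> w0 h0 [q1 q2 q3 q4] /andP[xp px] /andP[yq qy] wr hr e0 H.
have [|||c /andP[xc cx] EX] := @MVT_diff (X y) (X (y + h)) (u ^~ y) (u ^~ (y + h)) x (x + w).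
- by lra.
- by move=> t /andP[? ?]; apply: HX; rewrite ltr_norml; lra.
- by move=> t /andP[? ?]; apply: HX; rewrite ltr_norml; lra.
have [|||d /andP[yd dy] EY] := @MVT_diff (Y (x + w)) (Y x) (v (x + w)) (v x) y (y + h).
- by lra.
- by move=> t /andP[? ?]; apply: HY; rewrite ltr_norml; lra.
- by move=> t /andP[? ?]; apply: HY; rewrite ltr_norml; lra.
have K x' y' : x <= x' <= x + w -> y <= y' <= y + h ->
    `|u x' y' - u p q - (a * (x' - p) - b * (y' - q))| <= e * (w + h) /\
    `|v x' y' - v p q - (b * (x' - p) + a * (y' - q))| <= e * (w + h).
  move=> /andP[x1 x2] /andP[y1 y2].
  have [||] := H (x' - p) (y' - q); rewrite ?ltr_norml; [lra|lra|].
  have -> : p + (x' - p) = x' by ring.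
  have -> : q + (y' - q) = y' by ring.
  have hx : `|x' - p| <= w by rewrite ler_norml; lra.
  have hy : `|y' - q| <= h by rewrite ler_norml; lra.
  have le : e * (`|x' - p| + `|y' - q|) <= e * (w + h).
    by rewrite ler_pM2l // lerD.
  by move=> A B; split; [exact: le_trans A le|exact: le_trans B le].
have [|| A1 _] := K c y; [lra|lra|].
have [|| A2 _] := K c (y + h); [lra|lra|].
have [|| _ A3] := K (x + w) d; [lra|lra|].
have [|| _ A4] := K x d; [lra|lra|].
have B1 : `|u c y - u c (y + h) - b * h| <= 2 * (e * (w + h)).
  move: A1 A2; rewrite !ler_norml; lra.
have B2 : `|v (x + w) d - v x d - b * w| <= 2 * (e * (w + h)).
  move: A3 A4; rewrite !ler_norml; lra.
rewrite /I EX EY.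
rewrite (_ : _ - _ = (u c y - u c (y + h) - b * h) * w -
                     (v (x + w) d - v x d - b * w) * h); last by ring.
apply: le_trans (ler_normB _ _) _; rewrite !normrM (gtr0_norm w0) (gtr0_norm h0).
by nra.
Qed.

Lemma quarter_choice x y w h : exists x' y',
  [/\ x' = x \/ x' = x + w / 2, y' = y \/ y' = y + h / 2 &
      `|I x y w h| <= 4 * `|I x' y' (w / 2) (h / 2)|].
Proof.
have E : I x y w h = I x y (w / 2) (h / 2) + I (x + w / 2) y (w / 2) (h / 2)
   + I x (y + h / 2) (w / 2) (h / 2) + I (x + w / 2) (y + h / 2) (w / 2) (h / 2).
  have hw : x + w / 2 + w / 2 = x + w by field.
  have hh : y + h / 2 + h / 2 = y + h by field.
  by rewrite /I hw hh; ring.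
have [H1|H1] := leP `|I x y w h| (4 * `|I x y (w / 2) (h / 2)|).
  by exists x, y; split=> //; left.
have [H2|H2] := leP `|I x y w h| (4 * `|I (x + w / 2) y (w / 2) (h / 2)|).
  by exists (x + w / 2), y; split=> //; [right|left].
have [H3|H3] := leP `|I x y w h| (4 * `|I x (y + h / 2) (w / 2) (h / 2)|).
  by exists x, (y + h / 2); split=> //; [left|right].
exists (x + w / 2), (y + h / 2); split; [by right|by right|].
rewrite leNgt; apply/negP => H4; move: H1 H2 H3 H4; rewrite {1 2 3 4}E.
set A := I x y _ _; set B := I (x + _) y _ _; set D := I x (y + _) _ _.
set F := I (x + _) (y + _) _ _ => *.
have := ler_normD (A + B + D) F; have := ler_normD (A + B) D.
have := ler_normD A B; lra.
Qed.

Lemma nested_interval (x w : nat -> R) : (forall n, 0 <= w n) ->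
  (forall n, x n <= x n.+1) -> (forall n, x n.+1 + w n.+1 <= x n + w n) ->
  exists p, forall n, x n <= p <= x n + w n.
Proof.
move=> w0 xS xwS.
have mx m n : (m <= n)%N -> x m <= x n.
  by move=> /subnK <-; elim: (n - m)%N => // k /le_trans; apply; rewrite addSn.
have mxw m n : (m <= n)%N -> x n + w n <= x m + w m.
  move=> /subnK <-; elim: (n - m)%N => // k; apply: le_trans; exact: xwS.
have ub n : ubound (range x) (x n + w n).
  move=> _ [m _ <-]; have [mn|/ltnW nm] := leqP m n.
    by apply: le_trans (mx _ _ mn) _; rewrite lerDl.
  by apply: le_trans (mxw _ _ nm); rewrite lerDl.
exists (sup (range x)) => n; apply/andP; split.
  apply: ub_le_sup; last by exists n.
  by exists (x 0%N + w 0%N); exact: ub.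
by apply: ge_sup; [exists (x 0%N), 0%N|exact: ub].
Qed.

Lemma rectangle_integral0 x y w h : 0 < w -> 0 < h -> Q x y w h -> I x y w h = 0.
Proof.
move=> w0 h0 q; apply: contrapT => /eqP I0.
pose stp (z : R * R * R * R) (t : R * R) :=
  let: (x, y, w, h) := z in
  [/\ t.1 = x \/ t.1 = x + w / 2, t.2 = y \/ t.2 = y + h / 2 &
      `|I x y w h| <= 4 * `|I t.1 t.2 (w / 2) (h / 2)|].
have /choice[g gP] : forall z, exists t, stp z t.
  move=> [[[x1 y1] w1] h1].
  by have [x' [y' H]] := quarter_choice x1 y1 w1 h1; exists (x', y').
pose W n := w / 2 ^+ n; pose H n := h / 2 ^+ n.
(* [c n] is the lower left corner of the n-th rectangle, of size [W n] by [H n], each being a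
   quarter that keeps at least a fourth of the integral. *)
pose c := fix c n := if n is m.+1 then g ((c m).1, (c m).2, W m, H m) else (x, y).
have WS n : W n.+1 = W n / 2 by rewrite /W exprSr invfM mulrA.
have HS n : H n.+1 = H n / 2 by rewrite /H exprSr invfM mulrA.
have W0 n : 0 < W n by rewrite divr_gt0 // exprn_gt0.
have H0 n : 0 < H n by rewrite divr_gt0 // exprn_gt0.
have cP n : stp ((c n).1, (c n).2, W n, H n) (c n.+1) by exact: gP.
have cx n : (c n).1 <= (c n.+1).1 /\ (c n.+1).1 + W n.+1 <= (c n).1 + W n.
  by case: (cP n) => -[] -> _ _; rewrite WS; have := W0 n; lra.
have cy n : (c n).2 <= (c n.+1).2 /\ (c n.+1).2 + H n.+1 <= (c n).2 + H n.
  by case: (cP n) => _ [] -> _; rewrite HS; have := H0 n; lra.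
have [p pP] : exists p, forall n, (c n).1 <= p <= (c n).1 + W n.
  by apply: nested_interval => n; [exact: ltW|case: (cx n)|case: (cx n)].
have [r rP] : exists p, forall n, (c n).2 <= p <= (c n).2 + H n.
  by apply: nested_interval => n; [exact: ltW|case: (cy n)|case: (cy n)].
have IP n : `|I x y w h| <= 4 ^+ n * `|I (c n).1 (c n).2 (W n) (H n)|.
  elim: n => [|n IH]; first by rewrite /W /H !expr0 !divr1 mul1r.
  apply: le_trans IH _; rewrite exprSr -mulrA ler_pM2l ?exprn_gt0 //.
  by rewrite WS HS; case: (cP n).
have qn n : Q (c n).1 (c n).2 (W n) (H n).
  elim: n => [|n [? ? ? ?]]; first by rewrite /W /H !expr0 !divr1.
  by have := cx n; have := cy n => -[? ?] [? ?]; split; lra.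
have := pP 0%N; have := rP 0%N; rewrite /W /H !expr0 !divr1 /= => rP0 pP0.
case: q => q1 q2 q3 q4.
have [||a [b ab]] := Huv (x := p) (y := r); rewrite ?ltr_norml; [lra|lra|].
have wh0 : 0 < (w + h) ^+ 2 by rewrite exprn_gt0 // addr_gt0.
have II0 : 0 < `|I x y w h| by rewrite normr_gt0.
(* With this tolerance the n-th rectangle bounds the whole integral by 4^n * 2 e (w + h)^2 / 4^n,
   which is half of itself. *)
have e0 : 0 < `|I x y w h| / (4 * (w + h) ^+ 2) by rewrite divr_gt0 // mulr_gt0.
have [d d0 dP] := ab _ e0.
pose n := Num.truncn ((w + h) / d).
have nP : w + h < d * 2 ^+ n.
  rewrite mulrC -ltr_pdivrMr //; apply: lt_le_trans (truncnS_gt _) _.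
  by rewrite -natrX ler_nat ltn_expl.
have n0 : (0 : R) < 2 ^+ n by rewrite exprn_gt0.
have Wd : W n < d by rewrite ltr_pdivrMr //; lra.
have Hd : H n < d by rewrite ltr_pdivrMr //; lra.
have := rectangle_estimate (W0 n) (H0 n) (qn n) (pP n) (rP n) Wd Hd e0 dP.
have -> : (W n + H n) ^+ 2 = (w + h) ^+ 2 / 4 ^+ n.
  rewrite /W /H -mulrDl expr_div_n -exprM mulnC exprM.
  by congr (_ / _ ^+ _); rewrite expr2 -natrM.
have n40 : (0 : R) < 4 ^+ n by rewrite exprn_gt0.
move=> K; have := IP n; rewrite -ler_pdivrMl // => K2.
have := le_trans K2 K; rewrite ler_pdivrMl // leNgt => /negP; apply.
rewrite (_ : 4 ^+ n * _ = `|I x y w h| / 2); first by lra.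
by field; rewrite !gt_eqF // addr_gt0.
Qed.

End Goursat.

(** * Compact subsets of the plane *)

Section CompactC.
Variable R : realType.
Local Notation C := (Cplx R).
Local Notation ReC := complex.Re.
Local Notation ImC := complex.Im.

Lemma continuous_cmodB (p : C) : continuous (fun z : C => cmod (z - p)).
Proof.
move=> z; apply/continuousC_R_P => e e0; exists e => // w we.
apply: le_lt_trans we; rewrite ler_norml.
have := cmod_triangle z w p; have := cmod_triangle w z p.
by rewrite (cmodBC z w); lra.
Qed.

Lemma compact_box (r : R) : compact [set z : C | `|ReC z| <= r /\ `|ImC z| <= r].
Proof.
pose f (t : R * R) : C := t.1 +i* t.2.
have cf : continuous f.
  move=> t; apply/cvgC_P => e e0; have e2 : 0 < e / 2 by lra.
  exists (ball t.1 (e / 2), ball t.2 (e / 2)) => /=.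
    by split; exact: nbhsx_ballx.
  move=> [x y] /=; rewrite -!ball_normE /= => -[xt yt].
  apply: le_lt_trans (cmod_le_ReIm _) _; rewrite !ReImE /=.
  by rewrite (distrC x) (distrC y); lra.
have := compact_setX (@segment_compact R (- r) r) (@segment_compact R (- r) r).
move=> /(continuous_compact (continuous_subspaceT cf)).
congr compact; apply/seteqP; split=> [_ [t [/= + +] <-]|z [z1 z2]].
  by rewrite !in_itv /= !ler_norml.
exists (ReC z, ImC z); last by case: z {z1 z2}.
by rewrite /= !in_itv /= -!ler_norml.
Qed.

Lemma bounded_closed_compactC (A : set C) (r : R) : closed A ->
  (forall z, A z -> cmod z <= r) -> compact A.
Proof.
move=> cA Ar; apply: (subclosed_compact cA (compact_box (r := r))) => z /Ar zr.
by split; apply: le_trans zr; [exact: abs_Re_le|exact: abs_Im_le].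
Qed.

Lemma EVT_maxC (v : C -> R) (A : set C) : A !=set0 -> compact A ->
  (forall z, A z -> {for z, continuous v}) ->
  exists2 c, A c & forall z, A z -> v z <= v c.
Proof.
move=> A0 cA cv; have [|c] := @compact_EVT_max _ R v A A0 cA.
  by apply: continuous_in_subspaceT => z; rewrite inE; exact: cv.
by rewrite inE => Ac H; exists c => // z Az; apply: H; rewrite inE.
Qed.

Lemma compactC_bounded (A : set C) : compact A ->
  exists2 r : R, 0 < r & forall z, A z -> cmod z <= r.
Proof.
move=> cA; have [->|A0] := eqVneq A set0; first by exists 1.
have c0 : continuous (@cmod R).
  by move=> z; have := @continuous_cmodB 0 z; under eq_fun do rewrite subr0.
move/set0P : A0 => A0; have [c Ac H] := EVT_maxC A0 cA (fun z _ => c0 z).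
exists (cmod c + 1) => [|z /H]; have := cmod_ge0 c; lra.
Qed.

Lemma closed_diskC (p : C) (r : R) : closed [set z : C | cmod (z - p) <= r].
Proof.
have := @preimage_closed C R (fun z => cmod (z - p)) _ (fun z _ => @continuous_cmodB p z).
move=> /(_ [set x | x <= r]); apply; exact: closed_le.
Qed.

Lemma compact_diskC (p : C) (r : R) : compact [set z : C | cmod (z - p) <= r].
Proof.
apply: (@bounded_closed_compactC _ (r + cmod p)); first exact: closed_diskC.
by move=> z /=; have := cmodD (z - p) p; rewrite subrK; lra.
Qed.

(** Heine-Cantor in a form where z + h may leave [A]; hence continuity in the plane at the points of
    [A], not continuity on the subspace. *)
Lemma uniform_shift (u : C -> R) (A : set C) (e : R) : compact A -> 0 < e ->
  (forall z, A z -> {for z, continuous u}) ->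
  exists2 d : R, 0 < d & forall z h, A z -> cmod h < d -> `|u (z + h) - u z| < e.
Proof.
move=> cA e0 cu; have e2 : 0 < e / 2 by lra.
have := (compact_near_coveringP A).1 cA R ((0 : R)^'+)
  (fun d z => forall h, cmod h < d -> `|u (z + h) - u z| < e) _.
case=> [z Az|].
  have [r r0 rP] := (continuousC_R_P u z).1 (cu z Az) _ e2.
  have r2 : 0 < r / 2 by lra.
  exists ([set w | cmod (w - z) < r / 2], [set d : R | d < r / 2]).
    split=> /=; last exact: nbhs_right_lt.
    by apply/(nbhsC_P (z : C)); exists (r / 2).
  move=> [w d] /= [wz dr] h hd.
  have := rP w; have := rP (w + h).
  have := cmod_triangle w (w + h) z; rewrite (_ : w + h - w = h); last by ring.
  move=> T /(_ ltac:(lra)) + /(_ ltac:(lra)).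
  by rewrite !ltr_norml; lra.
move=> r /= r0 rP; exists (r / 2); first by lra.
move=> z h Az hr; apply: (rP (r / 2)) => //=; last by lra.
by rewrite sub0r normrN gtr0_norm; lra.
Qed.

End CompactC.

(** * Local potentials of complex differentiable functions *)

Section Potential.
Variable R : realType.
Local Notation C := (Cplx R).
Local Notation ReC := complex.Re.
Local Notation ImC := complex.Im.

Lemma is_derive0_shift (f : R -> R) (x d : R) :
  is_derive (0 : R) (1 : R) (fun t => f (x + t)) d <-> is_derive x (1 : R) f d.
Proof.
rewrite !rderP; split=> H e /H[r r0 rP]; exists r => // h /rP.
  by rewrite add0r addr0.
by rewrite add0r addr0.
Qed.

Lemma rder_ext_near (f g : R -> R) (x d r : R) : 0 < r ->
  (forall t, `|t - x| < r -> f t = g t) ->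
  is_derive x (1 : R) f d -> is_derive x (1 : R) g d.
Proof.
move=> r0 fg /rderP H; apply/rderP => e /H[s s0 sP].
exists (Num.min r s); first by rewrite lt_min r0.
move=> h; rewrite lt_min => /andP[hr hs].
have xE : x + h - x = h by ring.
by rewrite -!fg ?xE ?subrr ?normr0 //; exact: sP.
Qed.

Lemma is_derive_affine (f : R -> R) (x d k c : R) : is_derive x (1 : R) f d ->
  is_derive x (1 : R) (fun t => k + c * f t) (c * d).
Proof.
move=> /rderP H; apply/rderP => e e0; have c0 : 0 < `|c| + 1 by rewrite ltr_wpDl.
have [r r0 rP] := H _ (divr_gt0 e0 c0); exists r => // h /rP.
rewrite mulrAC ler_pdivlMr // => A.
rewrite (_ : _ - _ = c * (f (x + h) - f x - d * h)); last by ring.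
by rewrite normrM; have := normr_ge0 (f (x + h) - f x - d * h); have := normr_ge0 c; nra.
Qed.

(** The two conditions on t say that t lies between a and b, whichever of them is larger. *)
Lemma MVT_bound (h h' : R -> R) (a b M : R) :
  (forall t, `|t - a| <= `|b - a| -> `|t - b| <= `|b - a| ->
    is_derive t (1 : R) h (h' t) /\ `|h' t| <= M) ->
  `|h b - h a| <= M * `|b - a|.
Proof.
have main (a' b' : R) : a' <= b' -> (forall t, a' <= t <= b' ->
    is_derive t (1 : R) h (h' t) /\ `|h' t| <= M) -> `|h b' - h a'| <= M * `|b' - a'|.
  move=> ab H; have [t|t|c ct ->] := @MVT_segment R h h' a' b' ab.
  - by rewrite in_itv /= => /andP[? ?]; apply: (H t _).1; rewrite !ltW.
  - apply: continuous_in_subspaceT => t'; rewrite inE /= in_itv /= => /H[D' _].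
    exact/differentiable_continuous/derivable1_diffP.
  by rewrite normrM ler_wpM2r // (H c _).2.
have [ab|/ltW ab] := leP a b => H.
  apply: main => // t /andP[t1 t2]; have ba : 0 <= b - a by lra.
  by apply: H; rewrite (ger0_norm ba) ler_norml; apply/andP; split; lra.
rewrite distrC (distrC b); apply: main => // t /andP[t1 t2].
have ba : 0 <= a - b by lra.
by apply: H; rewrite (distrC b) (ger0_norm ba) ler_norml; apply/andP; split; lra.
Qed.

Lemma between_norm_lt (t a b s : R) : `|a| < s -> `|b| < s ->
  `|t - a| <= `|b - a| -> `|t - b| <= `|b - a| -> `|t| < s.
Proof.
rewrite !ltr_norml => /andP[? ?] /andP[? ?].
case: (ler0P (b - a)) => ab; rewrite !ler_norml => /andP[? ?] /andP[? ?];
  by apply/andP; split; lra.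
Qed.

Lemma cder_is_derive (f : C -> C) (z v : C) (t : R) d : cder f (z + t%:C * v) d ->
  is_derive t (1 : R) (fun s => ReC (f (z + s%:C * v))) (ReC (d * v)).
Proof. by move=> /cder_line/rderP. Qed.

(** [U] is the real part of a local primitive of f. It is built on the square of half-side s, whose
    points lie at distance at most 2 s from p, well inside the disc of radius 4 s. *)
Lemma local_potential (f : C -> C) (p : C) (s : R) : 0 < s ->
  (forall z, cmod (z - p) < 4 * s -> exists d, cder f z d) ->
  exists U : C -> R, forall z, cmod (z - p) < s ->
    [/\ {for z, continuous U},
        is_derive (0 : R) (1 : R) (fun t => U (z + t%:C)) (ReC (f z)) &
        is_derive (0 : R) (1 : R) (fun t => U (z + t%:C * 'i)) (- ImC (f z))].
Proof.
move=> s0 Hf.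
pose P (x y : R) : C := p + (x +i* y).
have Pd x y : `|x| <= s -> `|y| <= s -> exists d, cder f (P x y) d.
  move=> xs ys; apply: Hf; rewrite /P (_ : p + _ - p = x +i* y); last by ring.
  apply: le_lt_trans (cmod_le_ReIm _) _ => /=; lra.
have Px (x y t : R) : P (x + t) y = P x y + t%:C * 1.
  by rewrite /P; apply: complex_ext; rewrite !ReImE /=; ring.
have Py (x y t : R) : P x (y + t) = P x y + t%:C * 'i.
  by rewrite /P; apply: complex_ext; rewrite !ReImE /=; ring.
pose u x y := ReC (f (P x y)); pose v x y := ImC (f (P x y)).
have du x y d : cder f (P x y) d ->
    is_derive x (1 : R) (fun t => u t y) (ReC d) /\
    is_derive y (1 : R) (fun t => v x t) (ReC d).
  move=> D; split; apply/is_derive0_shift; rewrite /u /v.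
    have := @cder_is_derive f (P x y) 1 0 d.
    rewrite mul0r addr0 mulr1 => /(_ D); congr is_derive.
    by apply/funext => t; rewrite Px.
  (* Im f is Re (- 'i f), so its derivative in direction 'i is Re d. *)
  have := @cder_is_derive (fun w => - 'i * f w) (P x y) 'i 0 (- 'i * d).
  rewrite mul0r addr0 => /(_ (cderZ _ D)); congr is_derive.
    by apply/funext => t; rewrite Py !ReImE /=; ring.
  by rewrite !ReImE /=; ring.
have /choice[X HX] : forall y, exists X : R -> R, `|y| < s -> forall t, `|t| < s ->
    is_derive t (1 : R) X (u t y).
  move=> y; have [ys|] := ltP `|y| s; last by exists (fun=> 0).
  have [t /andP[t1 t2]|X XP] := @antiderivative R (u ^~ y) (- s) s.
    have [||d /du[dt _]] := @Pd t y; [by rewrite ler_norml; lra|exact: ltW|].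
    exact/differentiable_continuous/derivable1_diffP.
  by exists X => _ t; rewrite ltr_norml => /XP.
have /choice[Y HY] : forall x, exists Y : R -> R, `|x| < s -> forall t, `|t| < s ->
    is_derive t (1 : R) Y (v x t).
  move=> x; have [xs|] := ltP `|x| s; last by exists (fun=> 0).
  have [t /andP[t1 t2]|X' XP] := @antiderivative R (v x) (- s) s.
    have [||d /du[_ dt]] := @Pd x t; [exact: ltW|by rewrite ler_norml; lra|].
    exact/differentiable_continuous/derivable1_diffP.
  by exists X' => _ t; rewrite ltr_norml => /XP.
have Huv x y : `|x| < s -> `|y| < s -> exists a b : R,
  forall e, 0 < e -> exists2 r, 0 < r & forall h k, `|h| < r -> `|k| < r ->
    `|u (x + h) (y + k) - u x y - (a * h - b * k)| <= e * (`|h| + `|k|) /\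
    `|v (x + h) (y + k) - v x y - (b * h + a * k)| <= e * (`|h| + `|k|).
  move=> xs ys; have [||d D] := @Pd x y; [exact: ltW|exact: ltW|].
  exists (ReC d), (ImC d) => e e0; have [r r0 rP] := D _ e0.
  exists (r / 2); first by lra.
  move=> h k hr kr; have hk : cmod (h +i* k : C) <= `|h| + `|k|.
    exact: cmod_le_ReIm.
  have hkr : cmod (h +i* k : C) < r by lra.
  have := rP _ hkr; rewrite -[P x y + _]addrA.
  rewrite (_ : (x +i* y) + (h +i* k) = (x + h) +i* (y + k)) // => E.
  have {}E := le_trans E (ler_wpM2l (ltW e0) hk).
  split; [have := le_trans (abs_Re_le _) E|have := le_trans (abs_Im_le _) E];
    rewrite !ReImE /= /u /v /P; congr (`|_| <= _); ring.
pose I x y w h := (X y (x + w) - X y x) - (X (y + h) (x + w) - X (y + h) x)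
  - ((Y (x + w) (y + h) - Y (x + w) y) - (Y x (y + h) - Y x y)).
have I0 x y w h : 0 < w -> 0 < h -> - s < x -> x + w < s -> - s < y -> y + h < s ->
    I x y w h = 0.
  move=> *; apply: (@rectangle_integral0 R u v X Y s) => // y' t h1 h2;
    [exact: HX h1 t h2|exact: HY h1 t h2].
(* In terms of corners the boundary integral changes sign with the order of the abscissae or
   ordinates, which extends its vanishing to degenerate and reversed rectangles. *)
pose J x1 x2 y1 y2 := (X y1 x2 - X y1 x1) - (X y2 x2 - X y2 x1)
  - ((Y x2 y2 - Y x2 y1) - (Y x1 y2 - Y x1 y1)).
have J0' x1 x2 y1 y2 : `|x1| < s -> `|x2| < s -> `|y1| < s -> `|y2| < s ->
    x1 <= x2 -> y1 <= y2 -> J x1 x2 y1 y2 = 0.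
  rewrite !ltr_norml !le_eqVlt => /andP[? ?] /andP[? ?] /andP[? ?] /andP[? ?].
  case: eqVneq => [-> _ _|_ /= x12]; first by rewrite /J; ring.
  case: eqVneq => [-> _|_ /= y12]; first by rewrite /J; ring.
  have := @I0 x1 y1 (x2 - x1) (y2 - y1); rewrite /I.
  have -> : x1 + (x2 - x1) = x2 by ring.
  have -> : y1 + (y2 - y1) = y2 by ring.
  by apply; lra.
have J0 x1 x2 y1 y2 : `|x1| < s -> `|x2| < s -> `|y1| < s -> `|y2| < s ->
    J x1 x2 y1 y2 = 0.
  move=> a1 a2 a3 a4.
  have E1 : J x1 x2 y1 y2 = - J x2 x1 y1 y2 by rewrite /J; ring.
  have E2 : J x1 x2 y1 y2 = - J x1 x2 y2 y1 by rewrite /J; ring.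
  have E3 : J x2 x1 y1 y2 = - J x2 x1 y2 y1 by rewrite /J; ring.
  case: (leP x1 x2) => [h1|/ltW h1]; case: (leP y1 y2) => [h2|/ltW h2].
  - exact: J0'.
  - by rewrite E2 J0' ?oppr0.
  - by rewrite E1 J0' ?oppr0.
  - by rewrite E1 E3 J0' ?oppr0.
(* Up to the constant [X 0 0] this integrates along the real axis and then vertically, so the
   derivative in y is immediate. Since [J] vanishes, the path that goes vertically first gives the
   same value ([UE]), and yields the derivative in x. *)
pose U x y := X 0 x - Y x y + Y x 0.
have n0 : `|0 : R| < s by rewrite normr0.
have UE x y : `|x| < s -> `|y| < s -> U x y = X y x - X y 0 + X 0 0 - Y 0 y + Y 0 0.
  move=> xs ys; have := J0 0 x 0 y n0 xs n0 ys; rewrite /J /U; lra.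
have dUy x y : `|x| < s -> `|y| < s -> is_derive y (1 : R) (U x) (- v x y).
  move=> xs ys; have D := HY x xs y ys.
  have -> : U x = (fun t => (X 0 x + Y x 0) + (- 1) * Y x t).
    by apply/funext => t; rewrite /U; ring.
  by have := is_derive_affine (X 0 x + Y x 0) (- 1) D; rewrite [X in is_derive _ _ _ X]mulN1r.
have dUx x y : `|x| < s -> `|y| < s -> is_derive x (1 : R) (U ^~ y) (u x y).
  move=> xs ys; have D := HX y ys x xs.
  apply: (@rder_ext_near (fun t => (- X y 0 + X 0 0 - Y 0 y + Y 0 0) + 1 * X y t) _ _ _ (s - `|x|)).
  - by rewrite subr_gt0.
  - move=> t ht; rewrite UE //; first by ring.
    have := ler_normD (t - x) x; rewrite subrK; lra.
  - by have := is_derive_affine (- X y 0 + X 0 0 - Y 0 y + Y 0 0) 1 D; rewrite mul1r.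
exists (fun z => U (ReC (z - p)) (ImC (z - p))) => z zs.
have xs := le_lt_trans (abs_Re_le _) zs; have ys := le_lt_trans (abs_Im_le _) zs.
have PE : P (ReC (z - p)) (ImC (z - p)) = z.
  by rewrite /P; apply: complex_ext; rewrite !ReImE /=; ring.
split; first last.
- have -> : (fun t : R => U (ReC (z + t%:C * 'i - p)) (ImC (z + t%:C * 'i - p))) =
     (fun t => U (ReC (z - p)) (ImC (z - p) + t)).
    by apply/funext => t; congr U; rewrite !ReImE /=; ring.
  by apply/is_derive0_shift; have := dUy _ _ xs ys; rewrite /v PE.
- have -> : (fun t : R => U (ReC (z + t%:C - p)) (ImC (z + t%:C - p))) =
     (fun t => U (ReC (z - p) + t) (ImC (z - p))).
    by apply/funext => t; congr U; rewrite !ReImE /=; ring.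
  by apply/(@is_derive0_shift (U ^~ (ImC (z - p)))); have := dUx _ _ xs ys; rewrite /u PE.
set x := ReC _ in xs PE *; set y := ImC _ in ys PE *.
have [||d D] := @Pd x y; [exact: ltW|exact: ltW|].
have [r r0 rP] := (continuousC_C_P f (P x y)).1 (cder_cont D) _ ltr01.
have s1 : 0 < s - cmod (z - p) by lra.
(* Partial derivatives alone do not give continuity, but near z they are bounded by M + 1, and the
   mean value theorem is applied along one horizontal and one vertical segment. *)
have M0 := cmod_ge0 (f (P x y)); set M := cmod _ in M0.
apply/continuousC_R_P => e e0.
exists (Num.min (Num.min r (s - cmod (z - p))) (e / (2 * (M + 2)))).
  by rewrite !lt_min r0 s1 divr_gt0 //; lra.
move=> w; rewrite !lt_min => /andP[/andP[wr ws]].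
rewrite ltr_pdivlMr; last by lra.
set x' := ReC (w - p); set y' := ImC (w - p) => we.
have ws' : cmod (w - p) < s by have := cmod_triangle z w p; lra.
have xs' : `|x'| < s := le_lt_trans (abs_Re_le _) ws'.
have ys' : `|y'| < s := le_lt_trans (abs_Im_le _) ws'.
have xx : x' - x = ReC (w - z) by rewrite /x /x' !ReImE; ring.
have yy : y' - y = ImC (w - z) by rewrite /y /y' !ReImE; ring.
have ax := abs_Re_le (w - z); have ay := abs_Im_le (w - z).
have bd (a b : R) : cmod (P a b - z) <= cmod (w - z) -> cmod (f (P a b)) <= M + 1.
  move=> ab; have := rP (P a b); rewrite PE => /(_ (le_lt_trans ab wr)).
  by have := cmodB_ge (f (P a b)) (f z); rewrite /M PE; lra.
have K1 : `|U x' y' - U x y'| <= (M + 1) * `|x' - x|.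
  apply: (@MVT_bound (U ^~ y') (u ^~ y')) => t ht ht'.
  split; first exact: (dUx _ _ (between_norm_lt xs xs' ht ht')).
  apply: le_trans (abs_Re_le _) _; apply: bd; rewrite !cmodE.
  apply: ler_wsqrtr; apply: lerD.
    rewrite -ler_sqrt ?sqr_ge0 // !sqrtr_sqr -xx; apply: le_trans ht.
    by rewrite /P !ReImE /= /x !ReImE; rewrite le_eqVlt; apply/orP; left; apply/eqP; congr `|_|; ring.
  by rewrite -yy /P !ReImE /= /y !ReImE; rewrite le_eqVlt; apply/orP; left; apply/eqP; congr (_ ^+ 2); ring.
have K2 : `|U x y' - U x y| <= (M + 1) * `|y' - y|.
  apply: (@MVT_bound (U x) (fun t => - v x t)) => t ht ht'.
  split; first exact: (dUy _ _ xs (between_norm_lt ys ys' ht ht')).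
  rewrite normrN; apply: le_trans (abs_Im_le _) _; apply: bd; rewrite !cmodE.
  apply: ler_wsqrtr; apply: lerD.
    rewrite (_ : ReC (P x t - z) = 0) ?expr0n ?sqr_ge0 //.
    by rewrite /P /x !ReImE /=; ring.
  rewrite -ler_sqrt ?sqr_ge0 // !sqrtr_sqr -yy; apply: le_trans ht.
  by rewrite /P !ReImE /= /y !ReImE; rewrite le_eqVlt; apply/orP; left; apply/eqP; congr `|_|; ring.
have := ler_normD (U x' y' - U x y') (U x y' - U x y); rewrite subrKA.
move: K1 K2 ax ay; rewrite xx yy => K1 K2 ax ay.
have : (M + 1) * `|ReC (w - z)| <= (M + 1) * cmod (w - z) by rewrite ler_wpM2l //; lra.
have : (M + 1) * `|ImC (w - z)| <= (M + 1) * cmod (w - z) by rewrite ler_wpM2l //; lra.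
have := cmod_ge0 (w - z); nra.
Qed.

End Potential.

(** * Maximum principle *)

Section MaxPrinciple.
Variable R : realType.
Local Notation C := (Cplx R).
Local Notation ReC := complex.Re.
Local Notation ImC := complex.Im.

(** [f1] is differentiable at 0 only, so no Taylor formula is used: if M > 0, then [f1] is positive
    just right of its zero at 0 and f increases there. *)
Lemma second_derivative_max (f f1 : R -> R) (s M : R) : 0 < s ->
  (forall t, `|t| < s -> is_derive t (1 : R) f (f1 t)) ->
  is_derive (0 : R) (1 : R) f1 M -> (forall t, `|t| < s -> f t <= f 0) -> M <= 0.
Proof.
move=> s0 df df1 fmax; rewrite leNgt; apply/negP => M0.
have f10 : f1 0 = 0.
  have := df 0; rewrite normr0 => /(_ s0) d0.
  have [||||d0'] := @derive1_at_max R f (- s) s 0.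
  - by lra.
  - by move=> t; rewrite in_itv /= -ltr_norml => /df.
  - by rewrite in_itv /= oppr_lt0 s0.
  - by move=> t; rewrite in_itv /= -ltr_norml; exact: fmax.
  by case: d0 => _ <-.
move/rderP : df1 => /(_ (M / 2) ltac:(lra))[r r0 rP].
pose t := Num.min r s / 2.
have m0 : 0 < Num.min r s by rewrite lt_min r0.
have mr : Num.min r s <= r by rewrite ge_min lexx.
have ms : Num.min r s <= s by rewrite ge_min lexx orbT.
have t0 : 0 < t by rewrite /t; lra.
have ts' : t < s by rewrite /t; lra.
have tr : t < r by rewrite /t; lra.
have ts : `|t| < s by rewrite gtr0_norm.
have [x| |c] := @MVT R f f1 0 t t0.
- by rewrite in_itv /= => /andP[? ?]; apply: df; rewrite gtr0_norm //; lra.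
- apply: continuous_in_subspaceT => y; rewrite inE /= in_itv /= => /andP[? ?].
  have [|D _] := df y; first by rewrite ger0_norm //; lra.
  exact/differentiable_continuous/derivable1_diffP.
rewrite in_itv /= => /andP[c0 ct]; have := fmax _ ts.
have cr : c < r by lra.
have := rP c; rewrite (gtr0_norm c0) => /(_ cr).
rewrite add0r f10 subr0 ler_norml => /andP[H _] H1 H2.
have : 0 < f1 c * (t - 0) by rewrite mulr_gt0 ?subr0 //; nra.
by rewrite -H2; lra.
Qed.

Lemma is_derive_add (f g : R -> R) (x d e : R) : is_derive x (1 : R) f d ->
  is_derive x (1 : R) g e -> is_derive x (1 : R) (fun t => f t + g t) (d + e).
Proof. by move=> df dg; exact: is_deriveD. Qed.

Lemma is_derive_scale (f : R -> R) (x d c : R) : is_derive x (1 : R) f d ->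
  is_derive x (1 : R) (fun t => c * f t) (c * d).
Proof.
move=> /(is_derive_affine 0 c); congr is_derive.
by apply/funext => t; rewrite add0r.
Qed.

Lemma is_derive_sub (f g : R -> R) (x d e : R) : is_derive x (1 : R) f d ->
  is_derive x (1 : R) g e -> is_derive x (1 : R) (fun t => f t - g t) (d - e).
Proof. by move=> df dg; exact: is_deriveB. Qed.

Lemma is_derive_sqr_shift (k a b x : R) :
  is_derive x (1 : R) (fun t => k * ((a + t) ^+ 2 + b)) (2 * k * (a + x)).
Proof.
apply/rderP => e e0; have k0 : 0 < `|k| + 1 by rewrite ltr_wpDl.
exists (e / (`|k| + 1)); first by rewrite divr_gt0.
move=> h; rewrite ltr_pdivlMr // => hk.
rewrite (_ : _ - _ = k * h * h); last by ring.
by rewrite !normrM; have := normr_ge0 k; have := normr_ge0 h; nra.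
Qed.

Lemma is_derive_affine_id (k a x : R) : is_derive x (1 : R) (fun t => k * (a + t)) k.
Proof.
apply/rderP => e e0; exists 1 => // h _.
by rewrite (_ : _ - _ = 0) ?normr0 ?mulr_ge0 ?normr_ge0 // ?ltW //; ring.
Qed.

Lemma is_derive_line (g : C -> R) (z v : C) (t d : R) :
  is_derive (0 : R) (1 : R) (fun s => g (z + t%:C * v + s%:C * v)) d ->
  is_derive t (1 : R) (fun s => g (z + s%:C * v)) d.
Proof.
move=> H; apply: (is_derive0_shift (fun s : R => g (z + s%:C * v)) t d).1; move: H.
congr is_derive.
by apply/funext => s; rewrite rmorphD /= mulrDl addrA.
Qed.

Lemma C1_on_is_derive (D : set C) (g : C -> R) (z v : C) : C1_on D g -> D z ->
  v = 1 \/ v = 'i ->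
  is_derive (0 : R) (1 : R) (fun t => g (z + t%:C * v)) (partial v g z).
Proof.
move=> gD Dz vE; have [/derivableP H _] := gD v vE z Dz.
by rewrite /partial derive1E.
Qed.

(* Subharmonicity in the viscosity sense: contact from above with a strictly
   concave paraboloid is excluded. No second derivative is involved. *)
Definition no_contact (v : C -> R) (p : C) := forall (c : C) (d r : R), 0 < d -> 0 < r ->
  ~ (forall z, cmod (z - p) < r ->
       v z <= v p + ReC (c * (z - p)) - d * cmod (z - p) ^+ 2).

(** x and y come from the harmonic part, b from the difference quotient, which enters the two
    directions with opposite signs, and d / 2 from the quadratic perturbation. Adding the
    inequalities leaves d <= 0. *)
Lemma second_derivatives_absurd (x y b d : R) : x + b + d / 2 <= 0 ->
  y - b + d / 2 <= 0 -> 0 < d -> x + y = 0 -> False.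
Proof. lra. Qed.

(* Replace [Re f] by the difference quotient [Uh] of a local potential [U]. By
   the mean value theorem it is uniformly close to [Re f], and by the
   Cauchy-Riemann equations its second derivatives exist and cancel, so that the
   second derivative test applies at an interior maximum. *)
Lemma harmonic_no_contact (D : set C) (g : C -> R) (k : R) (f : C -> C) (p : C) :
  open D -> harmonic_on D g -> (forall z, D z -> {for z, continuous g}) ->
  (forall z, D z -> exists d, cder f z d) -> D p ->
  no_contact (fun z => k * g z + ReC (f z)) p.
Proof.
move=> oD [gD g1D giD lap] gc fD Dp c d r d0 r0 H.
have [e e0 eD] := (openC_P D).1 oD p Dp.
(* The linear term of the touching paraboloid is absorbed into the holomorphic function. *)
pose f1 z := f z - c * (z - p).
have f1D z : D z -> exists d, cder f1 z d.
  move=> /fD[d1 D1]; exists (d1 - c); apply: cderB => //.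
  have := cder_affine c (- c * p) z; apply: (cder_ext_near ltr01) => w _; ring.
have me : Num.min e r <= e by rewrite ge_min lexx.
have mr : Num.min e r <= r by rewrite ge_min lexx orbT.
have m0 : 0 < Num.min e r by rewrite lt_min e0.
pose s := Num.min e r / 8; have s0 : 0 < s by rewrite /s; lra.
have [|U UP] := @local_potential R f1 p s s0.
  by move=> z zs; apply: f1D; apply: eD; rewrite /s in zs; lra.
have UP1 z : cmod (z - p) < s ->
    is_derive (0 : R) (1 : R) (fun t => U (z + t%:C * 1)) (ReC (f1 z)).
  move=> /UP[_ + _]; suff -> : (fun t : R => U (z + t%:C * 1)) = (fun t => U (z + t%:C)) by [].
  by apply/funext => t; rewrite mulr1.
have De z : cmod (z - p) < s -> D z by move=> zs; apply: eD; rewrite /s in zs; lra.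
pose rho := s / 2; have rho0 : 0 < rho by rewrite /rho; lra.
(* On the circle of radius rho contact loses d rho^2, the quadratic term of [W] below returns d
   rho^2 / 4, and replacing Re f1 by [Uh] at two points costs less than 2 eta = d rho^2 / 4. Hence
   [W] is smaller there than at p and its maximum is interior. *)
pose eta := d * rho ^+ 2 / 8.
have rho20 : 0 < rho ^+ 2 by rewrite exprn_gt0.
have eta0 : 0 < eta by rewrite divr_gt0 // mulr_gt0.
have f1c z : D z -> {for z, continuous (fun z => ReC (f1 z))}.
  move=> /f1D[d1 /cder_cont/continuousC_C_P D1]; apply/continuousC_R_P => x x0.
  have [y y0 yP] := D1 _ x0; exists y => // w /yP.
  by apply: le_lt_trans; rewrite -cReN -cReD abs_Re_le.
have [|h1 h10 h1P] := uniform_shift (@compact_diskC R p rho) eta0 (u := fun z => ReC (f1 z)).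
  by move=> z /= zr; apply: f1c; apply: De; rewrite /rho in zr; lra.
pose h := Num.min h1 rho / 2.
have h0 : 0 < h by rewrite divr_gt0 // lt_min h10.
have hh1 : h < h1.
  have : Num.min h1 rho <= h1 by rewrite ge_min lexx.
  by rewrite /h; lra.
have hrho : h < rho.
  have : Num.min h1 rho <= rho by rewrite ge_min lexx orbT.
  by rewrite /h; lra.
pose Uh (z : C) := h^-1 * (U (z + h%:C) - U z).
have dist_shift (z : C) t : cmod (z + t%:C - p) <= cmod (z - p) + `|t|.
  rewrite -(cmod_real t) (_ : z + t%:C - p = z - p + t%:C) ?cmodD //; ring.
have UhE (z : C) : cmod (z - p) <= rho -> `|Uh z - ReC (f1 z)| < eta.
  move=> zr.
  have dU t : 0 <= t <= h -> is_derive t (1 : R) (fun t => U (z + t%:C)) (ReC (f1 (z + t%:C))).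
    move=> /andP[t0 th]; have [|_ + _] := UP (z + t%:C).
      apply: le_lt_trans (dist_shift _ _) _; rewrite ger0_norm // /rho in hrho zr *; lra.
    move=> E; apply: (is_derive0_shift (fun t : R => U (z + t%:C)) t _).1; move: E.
    congr is_derive.
    by apply/funext => x; rewrite rmorphD /= addrA.
  have [t| |x] := @MVT R (fun t => U (z + t%:C)) (fun t => ReC (f1 (z + t%:C))) 0 h h0.
  - by rewrite in_itv /= => /andP[? ?]; apply: dU; rewrite !ltW.
  - apply: continuous_in_subspaceT => t; rewrite inE /= in_itv /= => /dU [D' _].
    exact/differentiable_continuous/derivable1_diffP.
  rewrite in_itv /= => /andP[x0 xh]; rewrite subr0 addr0 => E.
  rewrite /Uh E mulrC mulfK ?gt_eqF //; apply: h1P => //.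
  by rewrite cmod_real gtr0_norm // (lt_trans xh).
(* The last term adds d / 2 to each of the two second derivatives and makes the final contradiction
   strict. *)
pose W (z : C) := k * g z + Uh z + d / 4 * cmod (z - p) ^+ 2.
have Wc (z : C) : cmod (z - p) <= rho -> {for z, continuous W}.
  move=> zr; have zs : cmod (z - p) < s by rewrite /rho in zr; lra.
  have c1 := gc _ (De _ zs).
  have [c2 _ _] := UP _ zs.
  have [|c3 _ _] := UP (z + h%:C).
    apply: le_lt_trans (dist_shift _ _) _; rewrite gtr0_norm // /rho in hrho zr *; lra.
  have c4 : {for z, continuous (fun z : C => U (z + h%:C))}.
    apply/continuousC_R_P => x x0; have [y y0 yP] := (continuousC_R_P U _).1 c3 _ x0.
    exists y => // w wy; apply: yP.
    by rewrite (_ : w + _ - _ = w - z) //; ring.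
  have c5 := @continuous_cmodB R p z.
  apply: (@continuousD _ _ _ (fun z : C => k * g z + Uh z) (fun z : C => d / 4 * cmod (z - p) ^+ 2)).
    apply: (@continuousD _ _ _ (fun z => k * g z) Uh).
      by apply: continuousM => //; exact: cst_continuous.
    apply: (@continuousM _ _ (fun=> h^-1) (fun z : C => U (z + h%:C) - U z)); first exact: cst_continuous.
    exact: continuousB.
  apply: (@continuousM _ _ (fun=> d / 4) (fun z : C => cmod (z - p) ^+ 2)); first exact: cst_continuous.
  exact: (continuousM c5 c5).
have [|q /= qr qmax] := EVT_maxC _ (@compact_diskC R p rho) Wc.
  by exists p; rewrite /= subrr cmod0 ltW.
have Wp : W p <= W q by apply: qmax; rewrite /= subrr cmod0 ltW.
have H1 z : cmod (z - p) < r -> k * g z + ReC (f1 z) <= k * g p + ReC (f1 p) - d * cmod (z - p) ^+ 2.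
  move=> /H; rewrite /f1 subrr mulr0 subr0 [ReC (f z - _)]cReD cReN; lra.
have {}qr : cmod (q - p) < rho.
  rewrite lt_neqAle qr andbT; apply/eqP => qE.
  have A := UhE q; rewrite qE lexx in A; have {}A := A isT.
  have B := UhE p; rewrite subrr cmod0 (ltW rho0) in B; have {}B := B isT.
  have := H1 q; rewrite qE => /(_ ltac:(rewrite /rho /s; lra)) E.
  move: Wp A B; rewrite /W qE subrr cmod0 expr0n mulr0 !ltr_norml /eta.
  move=> E2 /andP[? ?] /andP[? ?]; have := mulr_gt0 d0 rho20; lra.
pose s1 := rho - cmod (q - p); have s10 : 0 < s1 by rewrite /s1; lra.
have qs : cmod (q - p) < s by rewrite /rho in qr; lra.
have qhs t : `|t| <= h -> cmod (q + t%:C - p) < s.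
  by move=> th; apply: le_lt_trans (dist_shift _ _) _; rewrite /rho in qr hrho; lra.
have line_in v t : v = 1 \/ v = 'i -> `|t| < s1 -> cmod (q + t%:C * v - p) < rho.
  move=> vE ts; rewrite (_ : q + _ - p = q - p + t%:C * v); last by ring.
  apply: le_lt_trans (cmodD _ _) _; rewrite cmodM cmod_real.
  have -> : cmod v = 1.
    case: vE => ->; first exact: cmod1.
    by rewrite cmodE /= expr0n add0r expr1n sqrtr1.
  by rewrite mulr1; rewrite /s1 in ts; lra.
have [d1 D1] : exists d, cder f1 (q + h%:C) d.
  by apply: f1D; apply: De; apply: qhs; rewrite gtr0_norm.
have [d2 D2] : exists d, cder f1 q d by apply: f1D; exact: De.
have dg v t : v = 1 \/ v = 'i -> `|t| < s1 ->
    is_derive t (1 : R) (fun s => k * g (q + s%:C * v)) (k * partial v g (q + t%:C * v)).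
  move=> vE ts; apply: is_derive_scale; apply: is_derive_line.
  have Dt : D (q + t%:C * v) by apply: De; have := line_in v t vE ts; rewrite /rho; lra.
  exact: (C1_on_is_derive gD Dt vE).
have dgg v : v = 1 \/ v = 'i -> is_derive (0 : R) (1 : R) (fun s => k * partial v g (q + s%:C * v))
     (k * partial v (partial v g) q).
  move=> vE; apply: is_derive_scale.
  have g1 : C1_on D (partial v g) by case: (vE) => ->; [exact: g1D|exact: giD].
  exact: (C1_on_is_derive g1 (De q qs) vE).
have PX : k * partial 1 (partial 1 g) q + h^-1 * (ReC d1 - ReC d2) + d / 2 <= 0.
  apply: (@second_derivative_max (fun t => W (q + t%:C * 1))
    (fun t => k * partial 1 g (q + t%:C * 1) +
       h^-1 * (ReC (f1 (q + h%:C + t%:C * 1)) - ReC (f1 (q + t%:C * 1)))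
       + d / 2 * (ReC (q - p) + t)) s1) => //.
  - move=> t ts; apply: is_derive_add; first apply: is_derive_add; first by apply: dg => //; left.
    + apply: is_derive_scale; have tr := line_in 1 t (or_introl erefl) ts.
      apply: is_derive_sub; last first.
        apply: is_derive_line; apply: UP1.
        by rewrite /rho in tr; lra.
      have -> : (fun t : R => U (q + t%:C * 1 + h%:C)) = (fun t => U (q + h%:C + t%:C * 1)) :> (R -> R).
        by apply/funext => x; congr U; ring.
      apply: is_derive_line; apply: UP1.
        rewrite (_ : q + h%:C + t%:C * 1 = q + t%:C * 1 + h%:C); last by ring.
        apply: le_lt_trans (dist_shift _ _) _; rewrite gtr0_norm //.
        by rewrite /rho in hrho tr; lra.
    + have := is_derive_sqr_shift (d / 4) (ReC (q - p)) (ImC (q - p) ^+ 2) t.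
      congr is_derive; last by field.
      apply/funext => x; rewrite sqr_cmod; congr (_ * (_ ^+ 2 + _ ^+ 2));
        rewrite !ReImE /=; ring.
  - apply: is_derive_add; last exact: is_derive_affine_id.
    apply: is_derive_add; first by apply: dgg; left.
    apply: is_derive_scale; apply: is_derive_sub.
      have := @cder_is_derive R f1 (q + h%:C) 1 0 d1; rewrite mulr1; apply.
      by rewrite mul0r addr0.
    have := @cder_is_derive R f1 q 1 0 d2; rewrite mulr1; apply.
    by rewrite mul0r addr0.
  - move=> t ts; rewrite mul0r addr0; apply: qmax => /=; apply: ltW.
    by apply: line_in => //; left.
have PY : k * partial 'i (partial 'i g) q + h^-1 * (- ReC d1 + ReC d2) + d / 2 <= 0.
  apply: (@second_derivative_max (fun t => W (q + t%:C * 'i))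
    (fun t => k * partial 'i g (q + t%:C * 'i) +
       h^-1 * (- ImC (f1 (q + h%:C + t%:C * 'i)) - - ImC (f1 (q + t%:C * 'i)))
       + d / 2 * (ImC (q - p) + t)) s1) => //.
  - move=> t ts; apply: is_derive_add; first apply: is_derive_add; first by apply: dg => //; right.
    + apply: is_derive_scale; have tr := line_in 'i t (or_intror erefl) ts.
      apply: is_derive_sub; last first.
        apply: is_derive_line; have [|_ _ +] := UP (q + t%:C * 'i) => //.
        by rewrite /rho in tr; lra.
      have -> : (fun t : R => U (q + t%:C * 'i + h%:C)) = (fun t => U (q + h%:C + t%:C * 'i)) :> (R -> R).
        by apply/funext => x; congr U; ring.
      apply: is_derive_line; have [|_ _ +] := UP (q + h%:C + t%:C * 'i) => //.
      rewrite (_ : q + h%:C + t%:C * 'i = q + t%:C * 'i + h%:C); last by ring.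
        apply: le_lt_trans (dist_shift _ _) _; rewrite gtr0_norm //.
      by rewrite /rho in hrho tr; lra.
    + have := is_derive_sqr_shift (d / 4) (ImC (q - p)) (ReC (q - p) ^+ 2) t.
      congr is_derive; last by field.
      apply/funext => x; rewrite sqr_cmod addrC; congr (_ * (_ ^+ 2 + _ ^+ 2));
        rewrite !ReImE /=; ring.
  - have dIm z d3 : cder f1 z d3 -> is_derive (0 : R) (1 : R)
        (fun t => - ImC (f1 (z + t%:C * 'i))) (- ReC d3).
      move=> D3; have := @cder_is_derive R (fun w => 'i * f1 w) z 'i 0 ('i * d3).
      rewrite mul0r addr0 => /(_ (cderZ _ D3)); congr is_derive; last by rewrite !ReImE /=; ring.
      by apply/funext => t; rewrite !ReImE /=; ring.
    apply: is_derive_add; last exact: is_derive_affine_id.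
    apply: is_derive_add; first by apply: dgg; right.
    apply: is_derive_scale; rewrite -[ReC d2]opprK.
    by apply: is_derive_sub; exact: dIm.
  - move=> t ts; rewrite mul0r addr0; apply: qmax => /=; apply: ltW.
    by apply: line_in => //; right.
have := lap q (De q qs); move: PX PY; set A := h^-1 * _; set B := h^-1 * (_ + _).
have -> : B = - A by rewrite /A /B; ring.
move=> PX PY /(congr1 ( *%R k)); rewrite mulrDr mulr0.
by move: PX PY d0; exact: second_derivatives_absurd.
Qed.

(** The boundary of [K] is never mentioned: a point where v exceeds M is required to be interior,
    which amounts to v <= M on the boundary. *)
Lemma max_principle (K : set C) (v : C -> R) (M : R) : compact K ->
  (forall z, K z -> {for z, continuous v}) ->
  (forall p, K p -> M < v p -> nbhs p K /\ no_contact v p) ->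
  forall z, K z -> v z <= M.
Proof.
move=> cK vc H z0 Kz0; rewrite leNgt; apply/negP => vz0.
have [B B0 BP] := compactC_bounded cK.
have B20 : 0 < B ^+ 2 by rewrite exprn_gt0.
(* On [K] the perturbation d |z|^2 is at most half of the excess of v over M at z0, so the perturbed
   maximum is still attained where v > M. *)
pose d := (v z0 - M) / (2 * (B ^+ 2)).
have d0 : 0 < d by rewrite divr_gt0 ?subr_gt0 // mulr_gt0.
have dB : d * B ^+ 2 = (v z0 - M) / 2 by rewrite /d; field; rewrite gt_eqF.
have [||p Kp pmax] := EVT_maxC (v := fun z => v z + d * cmod z ^+ 2) _ cK; first by exists z0.
  move=> z /vc c1; apply: (@continuousD _ _ _ v (fun z : C => d * cmod z ^+ 2)) => //.
  have c2 : {for z, continuous (@cmod R)}.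
    by have := @continuous_cmodB R 0 z; under eq_fun do rewrite subr0.
  apply: (@continuousM _ _ (fun=> d) (fun z : C => cmod z ^+ 2)); first exact: cst_continuous.
  exact: (continuousM c2 c2).
have vp : M < v p.
  have := pmax _ Kz0; have := BP _ Kp; have := cmod_ge0 p.
  have : 0 <= d * cmod z0 ^+ 2 by rewrite mulr_ge0 ?sqr_ge0 // ltW.
  move=> a1 a2 a3 a4; have : cmod p ^+ 2 <= B ^+ 2 by rewrite lerXn2r // nnegrE // ltW.
  by rewrite -(ler_pM2l d0) dB; lra.
have [/nbhsC_P[r r0 rK] nc] := H p Kp vp.
(* Expanding |z|^2 about p turns maximality of v + d |z|^2 into contact with a paraboloid of slope -
   2 d times the conjugate of p. *)
apply: (nc (- (2 * d)%:C * p^*) d r d0 r0) => z /rK/pmax.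
rewrite !sqr_cmod !ReImE /=; lra.
Qed.

End MaxPrinciple.

(** * Uniqueness of the Green's function *)

Section GreenUnique.
Variable R : realType.
Local Notation C := (Cplx R).
Local Notation ReC := complex.Re.
Local Notation ImC := complex.Im.

Lemma hausdorffC : hausdorff_space C.
Proof. exact: norm_hausdorff. Qed.

Lemma closed_ge_continuous (v : C -> R) (k : R) : continuous v -> closed [set z | k <= v z].
Proof.
move=> cv; have := @preimage_closed C R v _ (fun z _ => cv z) => /(_ [set x | k <= x]).
by apply; exact: closed_ge.
Qed.

Lemma closed_le_continuous (v : C -> R) (k : R) : continuous v -> closed [set z | v z <= k].
Proof.
move=> cv; have := @preimage_closed C R v _ (fun z _ => cv z) => /(_ [set x | x <= k]).
by apply; exact: closed_le.
Qed.

Lemma gt_near (v : C -> R) (z : C) (k : R) : {for z, continuous v} -> k < v z ->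
  exists2 r : R, 0 < r & forall w, cmod (w - z) < r -> k < v w.
Proof.
move=> /continuousC_R_P cv kv; have [|r r0 rP] := cv (v z - k); first by rewrite subr_gt0.
by exists r => // w /rP; rewrite ltr_norml => /andP[? _]; lra.
Qed.

Lemma continuous_cmod : continuous (@cmod R).
Proof. by move=> z; have := @continuous_cmodB R 0 z; under eq_fun do rewrite subr0. Qed.

Lemma no_contact_ext_near (v w : C -> R) (p : C) (r : R) : 0 < r ->
  (forall z, cmod (z - p) < r -> v z = w z) -> no_contact v p -> no_contact w p.
Proof.
move=> r0 vw H c d s d0 s0 K; have ms0 : 0 < Num.min r s by rewrite lt_min r0.
apply: (H c d _ d0 ms0) => z; rewrite lt_min => /andP[zr zs].
rewrite vw // vw; first exact: K.
by rewrite subrr cmod0.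
Qed.

Lemma continuous_lincomb (g h : C -> R) (k e : R) (z : C) :
  {for z, continuous g} -> {for z, continuous h} ->
  {for z, continuous (fun z => k * g z + e * h z)}.
Proof.
move=> cg ch; apply: (@continuousD _ _ _ (fun z : C => k * g z) (fun z : C => e * h z)).
  exact: (@continuousM _ _ (fun=> k) g _ (@cst_continuous _ _ _ _) cg).
exact: (@continuousM _ _ (fun=> e) h _ (@cst_continuous _ _ _ _) ch).
Qed.

(** Local by necessity: around a center, ln |w - a_j| is the real part of no single-valued
    holomorphic function. *)
Definition locally_Re (U : set C) (h : C -> R) := forall p, U p ->
  exists (f : C -> C) (r : R), 0 < r /\ forall z, cmod (z - p) < r ->
    [/\ U z, h z = ReC (f z) & exists d, cder f z d].

Lemma locally_Re_continuous U h z : locally_Re U h -> U z -> {for z, continuous h}.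
Proof.
move=> H /H[f [r [r0 fP]]].
have [|_ hz [d /cder_cont D]] := fP z; first by rewrite subrr cmod0.
apply/continuousC_R_P => e e0; have [s s0 sP] := (continuousC_C_P f z).1 D _ e0.
exists (Num.min r s); first by rewrite lt_min r0.
move=> w; rewrite lt_min => /andP[/fP[_ -> _] /sP]; rewrite hz.
by apply: le_lt_trans; rewrite -cReN -cReD abs_Re_le.
Qed.

Lemma harmonic_on_sub (D D' : set C) (g : C -> R) : D' `<=` D ->
  harmonic_on D g -> harmonic_on D' g.
Proof.
move=> DD [h1 h2 h3 h4]; split.
- by move=> v vE z /DD; exact: h1.
- by move=> v vE z /DD; exact: h2.
- by move=> v vE z /DD; exact: h3.
- by move=> z /DD; exact: h4.
Qed.

Lemma open_diskC (p : C) (r : R) : open [set z : C | cmod (z - p) < r].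
Proof.
apply/openC_P => z /= zr; exists (r - cmod (z - p)); first by lra.
by move=> w wz; have := cmod_triangle z w p; lra.
Qed.

(** Both signs of [k] and [e] are needed: uniqueness uses g - (1 + e) h as well as (1 - e) h - g. *)
Lemma green_comparison_no_contact (K : set C) (g h : C -> R) (k e : R) (p : C) :
  is_green K g -> locally_Re (~` K) h -> ~ K p ->
  no_contact (fun z => k * g z + e * h z) p.
Proof.
move=> gK hloc Kp; have [f [r [r0 fP]]] := hloc _ Kp.
apply: (@no_contact_ext_near (fun z => k * g z + ReC (e%:C * f z)) _ _ r r0).
  by move=> z /fP[_ -> _]; rewrite cReM /= mul0r subr0.
apply: (@harmonic_no_contact R [set z | cmod (z - p) < r]).
- exact: open_diskC.
- by apply: harmonic_on_sub (green_harmonic gK) => z /fP[].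
- by move=> z _; exact: (green_cont gK).
- by move=> z /fP[_ _ [d D]]; exists (e%:C * d); exact: cderZ.
- by rewrite /= subrr cmod0.
Qed.

Lemma nbhs_slack (K : set C) (v w : C -> R) (p : C) (a b : R) :
  {for p, continuous v} -> {for p, continuous w} -> a < v p -> b < w p ->
  (forall z, a < v z -> b < w z -> K z) -> nbhs p K.
Proof.
move=> cv cw va wb H; have [r r0 rP] := gt_near cv va; have [s s0 sP] := gt_near cw wb.
apply/nbhsC_P; exists (Num.min r s); first by rewrite lt_min r0.
by move=> z; rewrite lt_min => /andP[/rP ? /sP ?]; exact: H.
Qed.

Lemma green_lnbound (K : set C) (g : C -> R) : is_green K g ->
  exists2 M, 0 <= M & exists2 B, 1 <= B & forall z, B < cmod z ->
    ln (cmod z) - M <= g z <= ln (cmod z) + M.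
Proof.
move=> [_ [M [r gP]] _ _]; exists `|M|; first by [].
exists (Num.max 1 r); first by rewrite le_max lexx.
move=> z; rewrite gt_max => /andP[_ /gP]; rewrite ler_norml.
by have := ler_norm M; move=> ? /andP[? ?]; apply/andP; split; lra.
Qed.

Lemma ln_gt_of_expR (M x : R) : expR M < x -> M < ln x.
Proof.
move=> Mx; have x0 : 0 < x := lt_trans (expR_gt0 M) Mx.
by rewrite -[M]expRK ltr_ln ?posrE ?expR_gt0.
Qed.

(** A set where g <= - eta < 0 is compact, because g grows at infinity, and misses [K], because g
    vanishes there. The maximum principle for - g on this set excludes negative values. *)
Lemma green_ge0 (K : set C) (g : C -> R) : compact K -> is_green K g -> forall z, 0 <= g z.
Proof.
move=> cK gK p; rewrite leNgt; apply/negP => gp.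
have [M M0 [B B1 gB]] := green_lnbound gK.
pose eta := - g p / 2; pose D := [set z | g z <= - eta].
have cg := green_cont gK.
have cD : compact D.
  apply: (@bounded_closed_compactC R D (Num.max B (expR M))).
    exact: closed_le_continuous.
  move=> z zD; rewrite leNgt; apply/negP; rewrite gt_max => /andP[/gB/andP[zB _] zM].
  by have := ln_gt_of_expR zM; move: zD; rewrite /D /eta /=; lra.
have h0 : locally_Re (~` K) (fun=> 0).
  move=> z Kz; have oK : open (~` K).
    by apply: closed_openC; exact: (compact_closed hausdorffC cK).
  have [r r0 rP] := (openC_P (~` K)).1 oK z Kz.
  exists (fun=> 0), r; split=> // w /rP Kw; split=> //.
  by exists 0; exact: cder_cst.
have H : - 1 * g p + 0 * (fun=> 0 : R) p <= eta.
  apply: (@max_principle R D (fun z => - 1 * g z + 0 * (fun=> 0 : R) z) eta cD); last by rewrite /D /eta /=; lra.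
    by move=> z _; apply: continuous_lincomb; [exact: cg|exact: cst_continuous].
  move=> q qD gq; have gq' : eta < - g q by move: gq; rewrite mulN1r mul0r addr0.
  split.
    have cNg : {for q, continuous (fun z => - g z)} by apply: continuousN; exact: cg.
    by apply: (nbhs_slack cNg cNg gq' gq') => z zD _; rewrite /D /=; lra.
  have Kq : ~ K q by move=> /(green_on gK); move: qD; rewrite /D /eta /=; lra.
  exact: (@green_comparison_no_contact K g (fun=> 0) (- 1) 0 q gK h0 Kq).
by move: H; rewrite mulN1r mul0r addr0 /eta; lra.
Qed.

(** The values of h on [K] are irrelevant. The closedness assumption says that h tends to 0 at [K],
    since otherwise some set {h >= eta} would accumulate there. *)
Lemma green_unique (K : set C) (g h : C -> R) : compact K -> is_green K g ->
  locally_Re (~` K) h -> (forall z, ~ K z -> 0 <= h z) ->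
  (forall eta, 0 < eta -> closed [set z | ~ K z /\ eta <= h z]) ->
  (exists M r : R, forall z, r < cmod z -> `|h z - ln (cmod z)| <= M) ->
  forall z, ~ K z -> h z = g z.
Proof.
move=> cK gK hloc h0 hcl [N [r hP]].
have [M M0 [B B1 gB]] := green_lnbound gK.
have g0 := green_ge0 cK gK; have cg := green_cont gK.
have ch z : ~ K z -> {for z, continuous h}.
  by move=> Kz; exact: (locally_Re_continuous hloc Kz).
have hB z : r < cmod z -> ln (cmod z) - N <= h z <= ln (cmod z) + N.
  by move=> /hP; rewrite ler_norml => /andP[? ?]; apply/andP; split; lra.
have cv (k e : R) z : ~ K z -> {for z, continuous (fun z => k * g z + e * h z)}.
  by move=> Kz; apply: continuous_lincomb; [exact: cg|exact: ch].
have le1 e p : 0 < e -> ~ K p -> g p <= (1 + e) * h p.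
  move=> e0 Kp; rewrite leNgt; apply/negP => gp.
  pose eta := g p - (1 + e) * h p; have eta0 : 0 < eta by rewrite subr_gt0.
  (* Beyond T the upper bound M + (1 + e) N - e ln |z| of g - (1 + e) h is negative. *)
  pose T := Num.max B (Num.max r (expR ((M + (1 + e) * N) / e))).
  have big z : T < cmod z -> g z - (1 + e) * h z <= 0.
    rewrite /T !gt_max => /andP[/gB/andP[_ g1] /andP[/hB/andP[h1 _] /ln_gt_of_expR]].
    rewrite ltr_pdivrMr // => l1.
    have : (1 + e) * (ln (cmod z) - N) <= (1 + e) * h z by rewrite ler_pM2l //; lra.
    lra.
  (* As h >= 0, a value of g - (1 + e) h above eta / 2 forces g > eta / 2. The radius T + 1 rather
     than T makes such points interior. *)
  pose D := [set z | eta / 2 <= g z] `&` [set z | cmod z <= T + 1].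
  have cD : compact D.
    apply: (@bounded_closed_compactC R D (T + 1)); last by move=> z [].
    by apply: closedI; [exact: closed_ge_continuous|apply: closed_le_continuous; exact: continuous_cmod].
  have DK z : D z -> ~ K z by move=> [/= z1 _] /(green_on gK); lra.
  have Dp : D p.
    split=> /=; first by have := mulr_ge0 (ltW (_ : 0 < 1 + e)) (h0 _ Kp); rewrite /eta; lra.
    rewrite leNgt; apply/negP => pT; have /big : T < cmod p by lra.
    by move: eta0; rewrite /eta; lra.
  have H : 1 * g p + - (1 + e) * h p <= eta / 2.
    apply: (@max_principle R D (fun z => 1 * g z + (- (1 + e)) * h z) (eta / 2) cD _ _ p Dp); first by move=> z /DK; exact: cv.
    move=> q Dq vq; have Kq := DK _ Dq; have hq := h0 _ Kq.
    have e1h : 0 <= (1 + e) * h q by rewrite mulr_ge0 //; lra.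
    have gq : eta / 2 < g q by lra.
    split; last exact: (@green_comparison_no_contact K g h 1 (- (1 + e)) q gK hloc Kq).
    have qT : - (T + 1) < - cmod q.
      rewrite ltrN2 ltNge; apply/negP => qT.
      have /big qb : T < cmod q by lra.
      by lra.
    have cN : {for q, continuous (fun z => - cmod z)} by apply: continuousN; exact: continuous_cmod.
    by apply: (nbhs_slack (cg q) cN gq qT) => z z1 z2; split=> /=; lra.
  by move: eta0 H; rewrite /eta; lra.
have le2 e p : 0 < e -> e < 1 -> ~ K p -> (1 - e) * h p <= g p.
  move=> e0 e1 Kp; rewrite leNgt; apply/negP => gp.
  pose eta := (1 - e) * h p - g p; have eta0 : 0 < eta by rewrite subr_gt0.
  pose T := Num.max B (Num.max r (expR ((M + (1 - e) * N) / e))).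
  have big z : T < cmod z -> (1 - e) * h z - g z <= 0.
    rewrite /T !gt_max => /andP[/gB/andP[g1 _] /andP[/hB/andP[_ h1] /ln_gt_of_expR]].
    rewrite ltr_pdivrMr // => l1.
    have : (1 - e) * h z <= (1 - e) * (ln (cmod z) + N) by rewrite ler_pM2l //; lra.
    lra.
  have hv z : ~ K z -> (1 - e) * h z - g z <= h z.
    by move=> Kz; have := g0 z; have := mulr_ge0 (ltW e0) (h0 _ Kz); lra.
  (* Now h cuts off a neighbourhood of [K], as (1 - e) h - g <= h; the closedness assumption makes
     this set compact. *)
  pose D := [set z | ~ K z /\ eta / 2 <= h z] `&` [set z | cmod z <= T + 1].
  have eta20 : 0 < eta / 2 by lra.
  have cD : compact D.
    apply: (@bounded_closed_compactC R D (T + 1)); last by move=> z [].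
    by apply: closedI; [exact: hcl|apply: closed_le_continuous; exact: continuous_cmod].
  have DK z : D z -> ~ K z by move=> [[]].
  have Dp : D p.
    split=> /=; first by split=> //; have := hv p Kp; rewrite /eta in eta0 *; lra.
    rewrite leNgt; apply/negP => pT; have /big : T < cmod p by lra.
    by move: eta0; rewrite /eta; lra.
  have H : - 1 * g p + (1 - e) * h p <= eta / 2.
    apply: (@max_principle R D (fun z => - 1 * g z + (1 - e) * h z) (eta / 2) cD _ _ p Dp); first by move=> z /DK; exact: cv.
    move=> q Dq vq; have Kq := DK _ Dq.
    have hq : eta / 2 < h q by have := hv q Kq; lra.
    split; last exact: (@green_comparison_no_contact K g h (- 1) (1 - e) q gK hloc Kq).
    have qT : - (T + 1) < - cmod q.
      rewrite ltrN2 ltNge; apply/negP => qT.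
      have /big qb : T < cmod q by lra.
      by lra.
    have cN : {for q, continuous (fun z => - cmod z)} by apply: continuousN; exact: continuous_cmod.
    have [s s0 sP] := gt_near (ch q Kq) hq; have [t t0 tP] := gt_near cN qT.
    have oK : open (~` K) by apply: closed_openC; exact: (compact_closed hausdorffC cK).
    have [u u0 uP] := (openC_P (~` K)).1 oK q Kq.
    apply/nbhsC_P; exists (Num.min u (Num.min s t)); first by rewrite !lt_min u0 s0.
    move=> z; rewrite !lt_min => /andP[/uP Kz /andP[/sP hz /tP zT]].
    by split=> /=; [split=> //; exact: ltW|lra].
  by move: eta0 H; rewrite /eta; lra.
move=> p Kp; have hp := h0 _ Kp; apply/eqP; rewrite eq_le; apply/andP; split.
  rewrite leNgt; apply/negP => gh; have gp := g0 p.
  (* The denominator keeps e h below half of h - g, so that (1 - e) h still exceeds g; the summand 1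
     covers h = 0. *)
  have e0 : 0 < (h p - g p) / (2 * (h p + 1)) by rewrite divr_gt0 //; lra.
  have e1 : (h p - g p) / (2 * (h p + 1)) < 1 by rewrite ltr_pdivrMr; lra.
  have := le2 _ p e0 e1 Kp; apply/negP; rewrite -ltNge mulrBl mul1r ltrBrDr -ltrBrDl.
  by rewrite mulrAC ltr_pdivrMr; nra.
rewrite leNgt; apply/negP => gh.
have e0 : 0 < (g p - h p) / (2 * (h p + 1)) by rewrite divr_gt0 //; lra.
have := le1 _ p e0 Kp; apply/negP; rewrite -ltNge mulrDl mul1r -ltrBrDl.
by rewrite mulrAC ltr_pdivrMr; nra.
Qed.

End GreenUnique.

(** * Principal logarithm *)

Section ComplexLog.
Variable R : realType.
Local Notation C := (Cplx R).
Local Notation ReC := complex.Re.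
Local Notation ImC := complex.Im.
Implicit Types (z w : C).

Definition slit z := ~ (ImC z = 0 /\ ReC z <= 0).

Lemma slit_neq0 z : slit z -> z != 0.
Proof. by move=> sz; apply/eqP => z0; apply: sz; rewrite z0. Qed.

Lemma cosine_ratio_bound z : -1 <= ReC z / cmod z <= 1.
Proof.
have [->|z0] := eqVneq z 0; first by rewrite mul0r; apply/andP; split; lra.
have c0 : 0 < cmod z by rewrite cmod_gt0.
have := abs_Re_le z; rewrite ler_norml => /andP[? ?].
by rewrite ler_pdivlMr // ler_pdivrMr // mulN1r mul1r; apply/andP.
Qed.

Lemma cos_Arg z : z != 0 -> cos (Arg z) = ReC z / cmod z.
Proof.
move=> z0; have b := cosine_ratio_bound z.
by rewrite /Arg; case: ifP => _; rewrite ?cosN acosK // in_itv.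
Qed.

Lemma sin_Arg z : z != 0 -> sin (Arg z) = ImC z / cmod z.
Proof.
move=> z0; have b := cosine_ratio_bound z; have c0 : 0 < cmod z by rewrite cmod_gt0.
have E : sin (acos (ReC z / cmod z)) = `|ImC z| / cmod z.
  rewrite sin_acos // -[RHS]ger0_norm ?divr_ge0 ?cmod_ge0 // -sqrtr_sqr.
  congr Num.sqrt; rewrite !expr_div_n real_normK ?num_real //.
  have -> : ImC z ^+ 2 = cmod z ^+ 2 - ReC z ^+ 2 by rewrite sqr_cmod; ring.
  by field; rewrite gt_eqF.
rewrite /Arg; case: ifP => z1; first by rewrite E ger0_norm.
by rewrite sinN E ltr0_norm ?mulNr ?opprK // ltNge z1.
Qed.

Lemma abs_Arg_lepi z : `|Arg z| <= pi.
Proof.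
have b := cosine_ratio_bound z.
by rewrite /Arg; case: ifP => _; rewrite ?normrN ger0_norm ?acos_ge0 ?acos_lepi.
Qed.

Lemma abs_Arg_ltpi z : slit z -> `|Arg z| < pi.
Proof.
move=> sz; have b := cosine_ratio_bound z; have z0 := slit_neq0 sz.
have c0 : 0 < cmod z by rewrite cmod_gt0.
have c1 : -1 < ReC z / cmod z <= 1.
  case/andP: b => b1 ->; rewrite andbT lt_neqAle b1 andbT; apply/eqP => E.
  have RE : ReC z = - cmod z.
    by rewrite -[ReC z](divfK (lt0r_neq0 c0)) -E mulN1r.
  apply: sz; split; last by rewrite RE; lra.
  have := sqr_cmod z; rewrite RE sqrrN => /eqP.
  by rewrite -subr_eq0 opprD addrA subrr sub0r oppr_eq0 sqrf_eq0 => /eqP.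
by rewrite /Arg; case: ifP => _; rewrite ?normrN ger0_norm ?acos_ge0 ?acos_ltpi.
Qed.

(** With t half the difference, cos (a - b) = 1 gives sin t = 0, and |t| < pi leaves only t = 0.
    Every identity between arguments below is reduced to this. *)
Lemma angle_unique (a b : R) : cos a = cos b -> sin a = sin b -> `|a - b| < pi *+ 2 -> a = b.
Proof.
move=> ec es; rewrite ltr_norml => /andP[h1 h2].
pose t := (a - b) / 2; have tE : a - b = t *+ 2 by rewrite /t; field.
have c1 : cos (a - b) = 1.
  by rewrite cosB ec es -!expr2 cos2Dsin2.
have s0 : sin t = 0.
  have := cosD t t; rewrite -mulr2n -tE c1 -!expr2; have := cos2Dsin2 t => e1 e2.
  by apply/eqP; rewrite -sqrf_eq0; apply/eqP; lra.
suff : t = 0 by lra.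
apply/eqP; rewrite -[_ == _]negbK; apply/negP => /eqP t0.
case: (ltgtP t 0) => // ht.
  have : 0 < sin (- t) by apply: sin_gt0_pi; apply/andP; split; lra.
  by rewrite sinN s0; lra.
have : 0 < sin t by apply: sin_gt0_pi; apply/andP; split; lra.
by rewrite s0; lra.
Qed.

Lemma Arg_atan z : 0 < ReC z -> Arg z = atan (ImC z / ReC z).
Proof.
move=> x0; have sz : slit z by case=> _; lra.
have z0 := slit_neq0 sz; have c0 : 0 < cmod z by rewrite cmod_gt0.
pose t := ImC z / ReC z.
have ct : cos (atan t) = ReC z / cmod z.
  rewrite cos_atan cmodE -[in RHS]invf_div; congr _^-1.
  rewrite -[LHS](mulfK (lt0r_neq0 x0)); congr (_ / _).
  rewrite -[X in _ * X](ger0_norm (ltW x0)) -sqrtr_sqr -sqrtrM; last by rewrite addr_ge0 ?sqr_ge0.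
  by congr Num.sqrt; rewrite /t; field; rewrite gt_eqF.
have st : sin (atan t) = ImC z / cmod z.
  have cn : cos (atan t) != 0 by rewrite ct gt_eqF // divr_gt0.
  rewrite -[LHS](divfK cn) -[_ / _]/(tan (atan t)) atanK ct /t.
  by field; rewrite !gt_eqF.
apply: angle_unique; rewrite ?cos_Arg ?sin_Arg ?ct ?st //.
have := abs_Arg_ltpi sz; have := atan_gtNpi2 t; have := atan_ltpi2 t.
have := pi_gt0 R; rewrite -/t !ltr_norml => ? ? ? /andP[? ?].
by apply/andP; split; lra.
Qed.

(** Only at 1 is [Log] differentiated by hand, through the real logarithm and arctangent;
    multiplicativity carries the result to the rest of the slit plane. *)
Lemma cder_Log1 : cder (@Log R) 1 1.
Proof.
move=> e e0.
have /rderP/(_ (e / 8))[|r r0 rP] := @is_derive1_ln R 1 ltr01; first by lra.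
have /rderP/(_ (e / 8))[|s s0 sP] := @is_derive1_atan R 0; first by lra.
(* With H = |h|, the arguments t and u of the two real expansions satisfy |t| <= 3 H and |u| <= 2 H,
   whence r / 4 and s / 4; the bounds 1 / 2 and e / 8 control the quadratic terms. *)
pose q := Num.min (Num.min (r / 4) (s / 4)) (Num.min (1 / 2) (e / 8)).
exists q; first by rewrite !lt_min; apply/andP; split; apply/andP; split; lra.
move=> h; rewrite !lt_min => /andP[/andP[h1 h2] /andP[h3 h4]].
have H0 := cmod_ge0 h; have := abs_Re_le h; have := abs_Im_le h.
set x := ReC h; set y := ImC h; set H := cmod h in H0 h1 h2 h3 h4 *.
move=> ay ax; have Hsq : H ^+ 2 = x ^+ 2 + y ^+ 2 by exact: sqr_cmod.
have [hx1 hx2] : - H <= x /\ x <= H by move: ax; rewrite ler_norml => /andP.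
have x1 : 0 < 1 + x by lra.
pose t := 2 * x + H ^+ 2.
have cE : cmod (1 + h) ^+ 2 = 1 + t.
  by rewrite sqr_cmod cReD cImD /= -/x -/y /t Hsq; ring.
have HH : H ^+ 2 <= H / 2 by rewrite expr2; nra.
have at_ : `|t| <= 3 * H.
  by rewrite /t ler_norml; move: (sqr_ge0 H) => ?; apply/andP; split; lra.
have c0 : 0 < cmod (1 + h).
  by rewrite cmod_gt0; apply/eqP => /(congr1 (@complex.Re R)); rewrite cReD /= -/x; lra.
have lE : ln (cmod (1 + h)) = ln (1 + t) / 2.
  by rewrite -cE lnXn //; field.
have tr : `|t| < r by lra.
have := rP t tr; rewrite ln1 invr1 mul1r subr0 => L1.
have A1 : `|ln (cmod (1 + h)) - x| <= e / 2 * H.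
  have E8 : e / 8 * `|t| <= e / 8 * (3 * H) by rewrite ler_pM2l //; lra.
  have HH2 : H ^+ 2 <= e / 8 * H by rewrite expr2 ler_wpM2r //; lra.
  move: L1; rewrite lE !ler_norml => /andP[? ?]; have := sqr_ge0 H => ?.
  have tE : t = 2 * x + H ^+ 2 by [].
  by apply/andP; split; nra.
have AE : Arg (1 + h) = atan (y / (1 + x)).
  by rewrite Arg_atan ?cReD ?cImD /= ?add0r.
pose u := y / (1 + x).
have uE : u * (1 + x) = y by rewrite /u divfK // gt_eqF.
have [hy1 hy2] : - H <= y /\ y <= H by move: ay; rewrite ler_norml => /andP.
have au : `|u| <= 2 * H.
  rewrite ler_norml; apply/andP; split; nra.
have us : `|u| < s by lra.
have := sP u us; rewrite atan0 expr0n /= !addr0 invr1 mul1r subr0 add0r => L2.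
have [hu1 hu2] : - (2 * H) <= u /\ u <= 2 * H by move: au; rewrite ler_norml => /andP.
have uy : `|u - y| <= e / 4 * H.
  have : `|u * x| <= 2 * H * H by rewrite normrM ler_pM.
  have -> : u - y = - (u * x) by rewrite -[in LHS]uE; ring.
  rewrite normrN => K; apply: le_trans K _; nra.
have A2 : `|Arg (1 + h) - y| <= e / 2 * H.
  have E8 : e / 8 * `|u| <= e / 8 * (2 * H) by rewrite ler_pM2l //; lra.
  rewrite AE -/u; move: L2 uy; rewrite !ler_norml => /andP[? ?] /andP[? ?].
  by apply/andP; split; lra.
apply: le_trans (cmod_le_ReIm _) _.
rewrite !ReImE /= -/x -/y.
have -> : ln (cmod (1 : C)) = 0 by rewrite cmod1 ln1.
have -> : Arg (1 : C) = 0 by rewrite Arg_atan /= ?mul0r ?atan0.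
by rewrite !subr0; lra.
Qed.

(** For u near 1 the argument of u is smaller than pi - |Arg z|, so the sum of the arguments stays
    within the principal range and no multiple of 2 pi appears. *)
Lemma Log_mul_near z : slit z -> exists2 r : R, 0 < r &
  forall u : C, cmod (u - 1) < r -> Log (z * u) = Log z + Log u.
Proof.
move=> sz; have [|r r0 rP] := (continuousC_C_P _ _).1 (cder_cont cder_Log1) (pi - `|Arg z|).
  by rewrite subr_gt0 abs_Arg_ltpi.
exists (Num.min 1 r); first by rewrite lt_min ltr01.
move=> u; rewrite lt_min => /andP[u1 /rP u2].
have ux : 0 < ReC u.
  by have := le_lt_trans (abs_Re_le _) u1; rewrite cReD cReN /= ltr_norml => /andP[? ?]; lra.
have u0 : u != 0 by apply: slit_neq0 => -[]; lra.
have z0 := slit_neq0 sz; have zu0 : z * u != 0 by rewrite mulf_neq0.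
have Arg1 : Arg (1 : C) = 0 by rewrite Arg_atan /= ?mul0r ?atan0.
have {}u2 : `|Arg u| < pi - `|Arg z|.
  by have := le_lt_trans (abs_Im_le _) u2; rewrite cImD cImN /= Arg1 subr0.
have cz : cmod z != 0 by rewrite cmod_eq0.
have cu : cmod u != 0 by rewrite cmod_eq0.
apply: complex_ext.
  by rewrite cReD /= cmodM lnM // posrE cmod_gt0.
rewrite cImD /=; apply: angle_unique.
- rewrite cosD !cos_Arg // !sin_Arg // cmodM cReM.
  by field; rewrite cz cu.
- rewrite sinD !cos_Arg // !sin_Arg // cmodM cImM.
  by field; rewrite cz cu.
- have := abs_Arg_lepi (z * u).
  have := ler_normB (Arg (z * u)) (Arg z + Arg u).
  have := ler_normD (Arg z) (Arg u); lra.
Qed.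

Lemma cder_Log z : slit z -> cder (@Log R) z z^-1.
Proof.
move=> sz; have z0 := slit_neq0 sz; have [r r0 rP] := Log_mul_near sz.
have cz : 0 < cmod z by rewrite cmod_gt0.
have H : cder (fun w => Log (z^-1 * w + 0)) z (1 * z^-1).
  by apply: (cder_comp (cder_affine _ _ _)); rewrite addr0 mulVf //; exact: cder_Log1.
have := cderD (cder_cst (Log z) z) H; rewrite add0r mul1r.
apply: (@cder_ext_near _ _ _ _ _ (r * cmod z)); first by rewrite mulr_gt0.
move=> w wz; rewrite addr0 -rP; first by rewrite mulrA divff // mul1r.
have -> : z^-1 * w - 1 = (w - z) * z^-1 by rewrite mulrBl divff // mulrC.
by rewrite cmodM cmodV ltr_pdivrMr.
Qed.

Lemma continuous_Arg z : slit z -> {for z, continuous (@Arg R)}.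
Proof.
move=> /cder_Log/cder_cont/continuousC_C_P H; apply/continuousC_R_P => e /H[d d0 dP].
exists d => // w /dP; apply: le_lt_trans.
by have := abs_Im_le (Log w - Log z); rewrite cImD cImN.
Qed.

Lemma Arg_pos_real z : ImC z = 0 -> 0 < ReC z -> Arg z = 0.
Proof. by move=> y0 x0; rewrite Arg_atan // y0 mul0r atan0. Qed.

Lemma Arg_conj z : slit z -> Arg (z^* : C) = - Arg z.
Proof.
move=> sz; have [y0|y0] := eqVneq (ImC z) 0.
  have x0 : 0 < ReC z by rewrite ltNge; apply/negP => x0; exact: sz.
  by rewrite !Arg_pos_real ?oppr0 ?cRe_conj ?cIm_conj ?y0 ?oppr0.
rewrite /Arg cmod_conj cRe_conj cIm_conj oppr_ge0; case: (ltgtP (ImC z) 0) => [|//|E].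
  by rewrite opprK.
by rewrite E eqxx in y0.
Qed.

(** This and its counterpart express the two one-sided values of [Arg] at the cut through
    [Arg (- z)], which is continuous there. *)
Lemma Arg_upper z : 0 < ImC z -> Arg z = pi + Arg (- z).
Proof.
move=> y0; have b := cosine_ratio_bound z.
have y1 : (ImC z <= 0) = false by rewrite leNgt y0.
by rewrite /Arg cmodN cReN cImN oppr_ge0 y1 (ltW y0) mulNr acosN //; ring.
Qed.

Lemma Arg_lower z : ImC z < 0 -> Arg z = Arg (- z) - pi.
Proof.
move=> y0; have b := cosine_ratio_bound z.
have y1 : (0 <= ImC z) = false by rewrite leNgt y0.
by rewrite /Arg cmodN cReN cImN oppr_ge0 y1 (ltW y0) mulNr acosN //; ring.
Qed.

End ComplexLog.

(** * Lemniscatic domains with arbitrary centers *)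

Section Lemniscate.
Variable R : realType.
Local Notation C := (Cplx R).
Local Notation ReC := complex.Re.
Local Notation ImC := complex.Im.

Lemma continuous_powR_cmod (a : C) (p : R) : 0 < p ->
  continuous (fun z : C => cmod (z - a) `^ p).
Proof.
move=> p0 z; have [->|za] := eqVneq z a.
  apply/continuousC_R_P => e e0; exists (e `^ p^-1); first exact: powR_gt0.
  move=> w wa; rewrite subrr cmod0 powR0 ?gt_eqF // subr0 ger0_norm ?powR_ge0 //.
  rewrite -[ltRHS]powRr1 ?ltW // -[1](mulVf (lt0r_neq0 p0)) powRrM.
  by rewrite gt0_ltr_powR // nnegrE ?cmod_ge0 // powR_ge0.
have c0 : 0 < cmod (z - a) by rewrite cmod_gt0 subr_eq0.
apply: (@continuous_comp _ _ _ (fun z : C => cmod (z - a)) (fun x : R => x `^ p)).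
  exact: continuous_cmodB.
apply: differentiable_continuous; apply/derivable1_diffP.
by apply: derivable_powR; rewrite in_itv /= c0.
Qed.

Lemma continuous_prod_nat (F : nat -> C -> R) (k n : nat) :
  (forall j, (k <= j < n)%N -> continuous (F j)) ->
  continuous (fun z => \prod_(k <= j < n) F j z).
Proof.
move=> H z.
have -> : (fun z => \prod_(k <= j < n) F j z) =
    (fun z => \prod_(j <- [seq j <- index_iota k n | (k <= j < n)%N]) F j z).
  by apply/funext => w; rewrite big_filter [LHS]big_nat_cond; apply: eq_bigl => j; rewrite andbT.
elim: (index_iota k n) => [|j s IH] /=.
  rewrite (_ : (fun _ => _) = fun=> 1); first exact: cst_continuous.
  by apply/funext => w; rewrite big_nil.
case: ifP => // /H Fj; rewrite (_ : (fun _ => _) = (fun w => F j w *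
    \prod_(i <- [seq i <- s | (k <= i < n)%N]) F i w)); last first.
  by apply/funext => w; rewrite big_cons.
exact: (continuousM (Fj z) IH).
Qed.

Lemma cder_sum_nat (F : nat -> C -> C) (d : nat -> C) (k n : nat) (z : C) :
  (forall j, (k <= j < n)%N -> cder (F j) z (d j)) ->
  cder (fun w => \sum_(k <= j < n) F j w) z (\sum_(k <= j < n) d j).
Proof.
move=> H; rewrite big_nat_cond.
have := @cder_sum R nat (index_iota k n) (fun j => (k <= j < n)%N && true) F d z.
have -> : (fun w => \sum_(j <- index_iota k n | (k <= j < n)%N && true) F j w) =
    (fun w => \sum_(k <= j < n) F j w).
  by apply/funext => w; rewrite [RHS]big_nat_cond.
by apply=> j /andP[/H].
Qed.

Lemma Re_sum (k n : nat) (F : nat -> C) :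
  ReC (\sum_(k <= j < n) F j) = \sum_(k <= j < n) ReC (F j).
Proof. by apply: (big_morph (@complex.Re R)) => // -[? ?] []. Qed.

Lemma Im_sum (k n : nat) (F : nat -> C) :
  ImC (\sum_(k <= j < n) F j) = \sum_(k <= j < n) ImC (F j).
Proof. by apply: (big_morph (@complex.Im R)) => // -[? ?] []. Qed.

Variables (l : nat) (a : nat -> C) (m : nat -> R) (r : R).
Hypothesis m_gt0 : forall j, (1 <= j < l.+1)%N -> 0 < m j.
Hypothesis m_sum : \sum_(1 <= j < l.+1) m j = 1.
Hypothesis r_gt0 : 0 < r.

Local Notation L := (lemniscatic_set l a m r).

Definition lemniscatic_prod (w : C) := \prod_(1 <= j < l.+1) cmod (w - a j) `^ m j.

Definition lemniscatic_green (w : C) :=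
  \sum_(1 <= j < l.+1) m j * ln (cmod (w - a j)) - ln r.

Local Notation P := lemniscatic_prod.
Local Notation g0 := lemniscatic_green.

Lemma continuous_lemniscatic_prod : continuous P.
Proof. by apply: continuous_prod_nat => j /m_gt0; exact: continuous_powR_cmod. Qed.

Lemma lemniscatic_center j : (1 <= j < l.+1)%N -> L (a j).
Proof.
move=> jl; rewrite /lemniscatic_set /=.
rewrite (bigD1_seq j) ?mem_index_iota ?iota_uniq //= subrr cmod0.
by rewrite powR0 ?gt_eqF ?m_gt0 // mul0r ltW.
Qed.

Lemma lemniscatic_neq j w : ~ L w -> (1 <= j < l.+1)%N -> w != a j.
Proof. by move=> Lw jl; apply/eqP => E; apply: Lw; rewrite E; exact: lemniscatic_center. Qed.

Lemma ln_lemniscatic_prod w : (forall j, (1 <= j < l.+1)%N -> w != a j) ->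
  0 < P w /\ ln (P w) = \sum_(1 <= j < l.+1) m j * ln (cmod (w - a j)).
Proof.
move=> H; rewrite /lemniscatic_prod big_nat_cond [in RHS]big_nat_cond.
elim: (index_iota 1 l.+1) => [|j s [IH1 IH2]]; first by rewrite !big_nil ln1.
rewrite !big_cons; case: ifP => // /andP[/H wj _].
have c0 : 0 < cmod (w - a j) by rewrite cmod_gt0 subr_eq0.
by rewrite mulr_gt0 ?powR_gt0 // lnM ?posrE ?powR_gt0 // ln_powR IH2.
Qed.

Lemma lemniscatic_green_prod w : ~ L w -> 0 < P w /\ g0 w = ln (P w) - ln r.
Proof.
move=> Lw; have [|P0 E] := @ln_lemniscatic_prod w; first by move=> j; exact: lemniscatic_neq.
by rewrite /lemniscatic_green E.
Qed.

Lemma lemniscatic_green_gt0 w : ~ L w -> 0 < g0 w.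
Proof.
move=> Lw; have [P0 ->] := lemniscatic_green_prod Lw.
by rewrite subr_gt0 ltr_ln ?posrE // ltNge; apply/negP.
Qed.

Lemma closed_lemniscatic_set : closed L.
Proof. exact: (@closed_le_continuous R P r continuous_lemniscatic_prod). Qed.

Lemma ln_sub_ge (eta p : R) : 0 < p -> (eta <= ln p - ln r) = (r * expR eta <= p).
Proof.
move=> p0; rewrite lerBrDl -[X in ln r + X]expRK -lnM ?posrE ?expR_gt0 //.
by rewrite ler_ln ?posrE ?mulr_gt0 ?expR_gt0.
Qed.

Lemma closed_lemniscatic_green eta : 0 < eta -> closed [set w | ~ L w /\ eta <= g0 w].
Proof.
move=> eta0.
have -> : [set w | ~ L w /\ eta <= g0 w] = [set w | r * expR eta <= P w].
  apply/seteqP; split=> w /=.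
    by move=> [Lw]; have [P0 ->] := lemniscatic_green_prod Lw; rewrite ln_sub_ge.
  move=> Pw; have Lw : ~ L w.
    rewrite /lemniscatic_set /= -/(P w) => Pr.
    have := le_trans Pw Pr; apply/negP; rewrite -ltNge.
    by rewrite -[X in X < _]mulr1 ltr_pM2l // expR_gt1.
  by split=> //; have [P0 ->] := lemniscatic_green_prod Lw; rewrite ln_sub_ge.
exact: (@closed_ge_continuous R P _ continuous_lemniscatic_prod).
Qed.

Lemma centers_bounded : exists2 A : R, 0 < A & forall j, (1 <= j < l.+1)%N -> cmod (a j) <= A.
Proof.
exists (1 + \sum_(1 <= j < l.+1) cmod (a j)).
  by apply: ltr_pwDl => //; apply: sumr_ge0 => j _; exact: cmod_ge0.
move=> j jl; rewrite (bigD1_seq j) ?mem_index_iota ?iota_uniq //=.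
by rewrite addrCA lerDl addr_ge0 // sumr_ge0 // => i _; exact: cmod_ge0.
Qed.

Lemma sum_weights (k : R) : \sum_(1 <= j < l.+1) m j * k = k.
Proof. by rewrite -mulr_suml m_sum mul1r. Qed.

(** The weights sum to 1, so ln |w| is distributed over the centers; for |w| > 2 A each |w - a_j|
    lies between |w| / 2 and 2 |w|. *)
Lemma lemniscatic_green_pole : exists M B : R, 0 < B /\
  forall w, B < cmod w -> `|g0 w - ln (cmod w)| <= M.
Proof.
have [A A0 AP] := centers_bounded.
exists (ln 2 + `|ln r|), (2 * A); split=> [|w wA]; first by rewrite mulr_gt0.
have w0 : 0 < cmod w by lra.
rewrite /lemniscatic_green -[X in _ - X]sum_weights addrAC -sumrB.
apply: le_trans (ler_normB _ _) _; rewrite lerD2r.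
rewrite -[X in _ <= X]sum_weights; apply: le_trans (ler_norm_sum _ _ _) _.
rewrite big_nat_cond [leRHS]big_nat_cond; apply: ler_sum => j /andP[jl _].
rewrite -mulrBr normrM (gtr0_norm (m_gt0 jl)) ler_pM2l ?m_gt0 //.
have ha := AP j jl; have h1 := cmodB_ge w (a j); have h2 := cmodB_le w (a j).
have wj : 0 < cmod (w - a j) by lra.
rewrite ler_norml lerBlDr lerBrDr; apply/andP; split.
  rewrite addrC lerBlDr addrC -lnM ?posrE // ler_ln ?posrE ?mulr_gt0 //; lra.
by rewrite -lnM ?posrE // ler_ln ?posrE ?mulr_gt0 //; lra.
Qed.

(** Beyond radius A + r every |w - a_j| exceeds r, and so does their weighted geometric mean. *)
Lemma compact_lemniscatic_set : compact L.
Proof.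
have [A A0 AP] := centers_bounded.
apply: (@bounded_closed_compactC R L (A + r)); first exact: closed_lemniscatic_set.
move=> w Lw; rewrite leNgt; apply/negP => wA.
have dj j : (1 <= j < l.+1)%N -> r < cmod (w - a j).
  by move=> jl; have := AP j jl; have := cmodB_ge w (a j); lra.
have [|P0 E] := @ln_lemniscatic_prod w.
  by move=> j /dj rj; rewrite -subr_eq0 -cmod_gt0; exact: lt_trans r_gt0 rj.
have : ln (P w) <= ln r by rewrite ler_ln ?posrE.
rewrite E -[X in _ <= X]sum_weights leNgt => /negP; apply.
rewrite big_nat_cond [ltRHS]big_nat_cond.
have [n0|n0] := posnP l.
  by exfalso; have := m_sum; rewrite n0 big_geq //; lra.
apply: ltr_sum; first by apply/hasP; exists 1%N; rewrite ?mem_index_iota /= ?ltnS ?n0.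
move=> j /andP[jl _]; rewrite ltr_pM2l ?m_gt0 // ltr_ln ?posrE ?dj //.
exact: lt_trans r_gt0 (dj j jl).
Qed.

(** A disc about p that avoids [L] avoids all centers, so (w - a_j) / (p - a_j) stays in the disc of
    radius 1 about 1, where the principal logarithm is holomorphic. *)
Lemma lemniscatic_green_locally_Re : locally_Re (~` L) g0.
Proof.
move=> p Lp; have oL : open (~` L) by apply: closed_openC; exact: closed_lemniscatic_set.
have [e e0 eP] := (openC_P (~` L)).1 oL p Lp.
have ea j : (1 <= j < l.+1)%N -> e <= cmod (p - a j).
  move=> jl; rewrite leNgt; apply/negP; rewrite cmodBC => /eP; apply.
  exact: lemniscatic_center.
pose f w := \sum_(1 <= j < l.+1) (m j)%:C * (Log ((p - a j)^-1 * w + - (p - a j)^-1 * a j)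
   + (ln (cmod (p - a j)))%:C) - (ln r)%:C.
exists f, e; split=> // z ze; have pj j : (1 <= j < l.+1)%N -> p - a j != 0.
  by move=> /ea; rewrite -cmod_gt0; exact: lt_le_trans.
have zE j : (p - a j)^-1 * z + - (p - a j)^-1 * a j = (z - a j) / (p - a j) by ring.
have Lz : ~ L z by exact: eP.
split=> //.
  rewrite /f cReD cReN /= Re_sum /lemniscatic_green; congr (_ - _).
  rewrite big_nat_cond [RHS]big_nat_cond; apply: eq_bigr => j /andP[jl _].
  rewrite cReM cReD /= mul0r subr0; congr (_ * _); rewrite zE cmodM cmodV.
  have z0 : 0 < cmod (z - a j) by rewrite cmod_gt0 subr_eq0 (lemniscatic_neq Lz).
  have p0 : 0 < cmod (p - a j) by rewrite cmod_gt0 pj.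
  by rewrite ln_div ?posrE // subrK.
eexists; apply: cderB; last exact: cder_cst.
apply: cder_sum_nat => j jl; apply: cderZ; apply: cderD; last exact: cder_cst.
apply: (cder_comp (cder_affine _ _ _)); apply: cder_Log.
rewrite zE => -[_]; apply/negP; rewrite -ltNge.
have : cmod ((z - a j) / (p - a j) - 1) < 1.
  have -> : (z - a j) / (p - a j) - 1 = (z - p) / (p - a j).
    by field; exact: pj.
  by rewrite cmodM cmodV ltr_pdivrMr ?mul1r ?cmod_gt0 ?pj // (lt_le_trans ze) // ea.
by move/(le_lt_trans (abs_Re_le _)); rewrite cReD cReN /= ltr_norml => /andP[? _]; lra.
Qed.

Hypothesis a_real : forall j, (1 <= j < l.+1)%N -> ImC (a j) = 0.

(** For real centers all distances |w - a_j| grow with |Im w|. Hence a vertical path leading away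
    from the real line never enters [L]. *)
Lemma lemniscatic_prod_mono w w' : ReC w = ReC w' -> `|ImC w| <= `|ImC w'| -> P w <= P w'.
Proof.
move=> rw iw; rewrite /lemniscatic_prod big_nat_cond [leRHS]big_nat_cond.
apply: ler_prod => j /andP[jl _]; rewrite powR_ge0 /=.
apply: ge0_ler_powR; rewrite ?nnegrE ?cmod_ge0 //; first by rewrite ltW ?m_gt0.
rewrite !cmodE ler_sqrt ?addr_ge0 ?sqr_ge0 // !ReImE rw lerD2l a_real // !subr0.
by rewrite -ler_sqrt ?sqr_ge0 // !sqrtr_sqr.
Qed.

Lemma lemniscatic_compl_mono w w' : ReC w = ReC w' -> `|ImC w| <= `|ImC w'| ->
  ~ L w -> ~ L w'.
Proof.
move=> rw iw Lw Lw'; apply: Lw; rewrite /lemniscatic_set /=.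
by apply: le_trans Lw'; exact: lemniscatic_prod_mono.
Qed.

Lemma lemniscatic_compl_conj w : ~ L w -> ~ L (w^* : C).
Proof.
by apply: lemniscatic_compl_mono; rewrite ?cRe_conj ?cIm_conj ?normrN.
Qed.

Lemma lemniscatic_green_conj w : g0 (w^* : C) = g0 w.
Proof.
rewrite /lemniscatic_green big_nat_cond [in RHS]big_nat_cond; congr (_ - _).
apply: eq_bigr => j /andP[jl _]; congr (_ * ln _).
by rewrite !cmodE !ReImE a_real // !subr0 sqrrN.
Qed.

End Lemniscate.

(** * Connected sets and conformal maps *)

Section Topology.
Variable R : realType.
Local Notation C := (Cplx R).
Local Notation ReC := complex.Re.
Local Notation ImC := complex.Im.

Definition convexC (A : set C) := forall z w (t : R), A z -> A w -> 0 <= t <= 1 ->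
  A (z + t%:C * (w - z)).

Lemma connected_union_centered (I : Type) (B : set I) (F : I -> set C) (p : C) :
  (forall i, B i -> F i p) -> (forall i, B i -> connected (F i)) ->
  connected (\bigcup_(i in B) F i).
Proof. by move=> Fp Fc; apply: bigcup_connected => //; exists p. Qed.

Lemma connected_segmentC (z w : C) :
  connected [set z + (t : R)%:C * (w - z) | t in `[0, 1]].
Proof.
apply: connected_continuous_connected; first exact: segment_connected.
apply: continuous_subspaceT => t; apply/cvgC_P => e e0.
have k0 : 0 < cmod (w - z) + 1 by rewrite ltr_wpDl ?cmod_ge0.
apply/nbhs_ballP; exists (e / (cmod (w - z) + 1)) => /=; first by rewrite divr_gt0.
move=> s /=; rewrite ltr_pdivlMr // => H.
rewrite (_ : _ - _ = (s - t)%:C * (w - z)); last by rewrite rmorphB /=; ring.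
rewrite cmodM cmod_real distrC; have := normr_ge0 (t - s).
by have := cmod_ge0 (w - z); nra.
Qed.

Lemma connected_star (A : set C) (p : C) : A p ->
  (forall w (t : R), A w -> 0 <= t <= 1 -> A (p + t%:C * (w - p))) -> connected A.
Proof.
move=> Ap H.
have -> : A = \bigcup_(w in A) [set p + (t : R)%:C * (w - p) | t in `[0, 1]].
  apply/seteqP; split=> [w Aw|_ [w Aw [t + <-]]]; last by rewrite /= in_itv /=; exact: H.
  exists w => //; exists 1; first by rewrite /= in_itv /= ler01 lexx.
  by rewrite mul1r; ring.
apply: (@connected_union_centered _ _ _ p) => w Aw; last exact: connected_segmentC.
by exists 0; rewrite /= ?in_itv /= ?lexx ?ler01 // mul0r addr0.
Qed.

Lemma convex_connected (A : set C) : convexC A -> connected A.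
Proof.
move=> cA; have [->|/set0P[p Ap]] := eqVneq A set0; first exact: connected0.
by apply: (connected_star Ap) => w t Aw; exact: cA.
Qed.

Lemma convex_half_plane (k : C) (rho : R) : convexC [set z | rho < ReC (k * z)].
Proof.
move=> z w t /= h1 h2 /andP[t0 t1].
have -> : ReC (k * (z + t%:C * (w - z))) = ReC (k * z) + t * (ReC (k * w) - ReC (k * z)).
  by rewrite !ReImE /=; ring.
move: h1 h2; set a := ReC (k * z); set b := ReC (k * w) => h1 h2.
have [->|tn0] := eqVneq t 0; first by lra.
have tp : 0 < t by rewrite lt_def tn0.
have p1 : 0 < t * (b - rho) by rewrite mulr_gt0 // subr_gt0.
have p2 : 0 <= (1 - t) * (a - rho) by rewrite mulr_ge0 // subr_ge0 // ltW.
by lra.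
Qed.

(** The exterior of a square is a union of four half-planes, which makes its connectedness a matter
    of convexity. *)
Definition square_exterior (rho : R) : set C :=
  [set z | rho < `|ReC z| \/ rho < `|ImC z|].

Lemma connected_square_exterior (rho : R) : 0 <= rho -> connected (square_exterior rho).
Proof.
move=> rho0; pose H (k : C) := [set z : C | rho < ReC (k * z)].
have cH k : connected (H k) by apply: convex_connected; exact: convex_half_plane.
have -> : square_exterior rho = ((H 1 `|` H (- 'i)) `|` H (- 1)) `|` H 'i.
  apply/seteqP; split=> z; rewrite /square_exterior /H /= !ReImE /=.
    rewrite !ltr_normr => -[/orP[h|h]|/orP[h|h]].
    - by left; left; left; lra.
    - by left; right; lra.
    - by left; left; right; lra.
    - by right; lra.
  rewrite !ltr_normr => -[[[h|h]|h]|h].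
  - by left; apply/orP; left; lra.
  - by right; apply/orP; left; lra.
  - by left; apply/orP; right; lra.
  - by right; apply/orP; right; lra.
apply: connectedU; last exact: cH.
  exists ((- (rho + 1)) +i* (- (rho + 1))); split; first right;
    rewrite /H /= ?ReImE /=; lra.
apply: connectedU; last exact: cH.
  exists ((- (rho + 1)) +i* (rho + 1)); split; first right;
    rewrite /H /= ?ReImE /=; lra.
apply: connectedU; [|exact: cH|exact: cH].
exists ((rho + 1) +i* (rho + 1)); split; rewrite /H /= ?ReImE /=; lra.
Qed.

Lemma connected_clopen (A S : set C) : connected A -> S `<=` A -> S !=set0 ->
  (forall z, S z -> exists2 e : R, 0 < e & forall w, cmod (w - z) < e -> A w -> S w) ->
  (forall z, A z -> ~ S z -> exists2 e : R, 0 < e & forall w, cmod (w - z) < e -> A w -> ~ S w) ->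
  forall z, A z -> S z.
Proof.
move=> cA SA S0 So Sc.
suff -> : A = S by [].
have H := cA S S0 _ _; rewrite H //.
  exists (\bigcup_(z in S) [set w | exists2 e : R, cmod (w - z) < e &
     forall u, cmod (u - z) < e -> A u -> S u]).
    apply: bigcup_open => z Sz; apply/openC_P => w [e we eP].
    exists (e - cmod (w - z)); first by lra.
    by move=> u uw; exists e => //; have := cmod_triangle w u z; lra.
  apply/seteqP; split=> [z Sz|z [Az [w Sw [e ze eP]]]]; last exact: eP.
  split; first exact: SA.
  by exists z => //; have [e e0 eP] := So z Sz; exists e => //; rewrite subrr cmod0.
exists (~` (\bigcup_(z in A `\` S) [set w | exists2 e : R, cmod (w - z) < e &
     forall u, cmod (u - z) < e -> A u -> ~ S u])).
  apply: open_closedC; apply: bigcup_open => z Sz; apply/openC_P => w [e we eP].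
  exists (e - cmod (w - z)); first by lra.
  by move=> u uw; exists e => //; have := cmod_triangle w u z; lra.
apply/seteqP; split=> [z Sz|z [Az H']].
  split; first exact: SA.
  by move=> [w [Aw Sw] [e ze eP]]; apply: (eP z) => //; exact: SA.
apply: contrapT => Sz; apply: H'; exists z => //.
by have [e e0 eP] := Sc z Az Sz; exists e => //; rewrite subrr cmod0.
Qed.

(* A holomorphic function with vanishing real part has derivative [d] with
   [Re d = Re ('i * d) = 0]. *)
Lemma Re0_locally_constant (f : C -> C) (p : C) (e : R) : 0 < e ->
  (forall z, cmod (z - p) < e -> (exists d, cder f z d) /\ ReC (f z) = 0) ->
  forall w, cmod (w - p) < e -> f w = f p.
Proof.
move=> e0 H.
have d0 z : cmod (z - p) < e -> cder f z 0.
  move=> ze; have [[d D] _] := H z ze.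
  have Z v : cmod v = 1 -> ReC (d * v) = 0.
    move=> v1; have := @cder_is_derive R f z v 0 d; rewrite mul0r addr0 => /(_ D) D1.
    have D2 : is_derive (0 : R) (1 : R) (fun s : R => ReC (f (z + s%:C * v))) 0.
      apply: (@rder_ext_near R (fun=> 0) _ _ _ (e - cmod (z - p))); first by lra.
      move=> t; rewrite subr0 => te; have [|_ ->//] := H (z + t%:C * v).
      rewrite (_ : z + _ - p = (z - p) + t%:C * v); last by ring.
      by have := cmodD (z - p) (t%:C * v); rewrite cmodM cmod_real v1 mulr1; lra.
    have [_ e1] := D1; have [_ e2] := D2; rewrite -e1; exact: e2.
  have dR : ReC d = 0 by have := Z 1 (cmod1 R); rewrite mulr1.
  have dI : ImC d = 0.
    have := Z 'i; rewrite cmodE /= expr0n add0r expr1n sqrtr1 => /(_ erefl).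
    by rewrite !ReImE /=; lra.
  by have <- : d = 0 by exact: complex_ext.
move=> w we.
(* With k = 1 and k = - 'i this covers the real and the imaginary part. *)
have key k : ReC (k * f w) = ReC (k * f p).
  have D (t : R) : 0 <= t <= 1 -> is_derive t (1 : R) (fun s : R => ReC (k * f (p + s%:C * (w - p)))) 0.
    move=> /andP[t0 t1].
    have zt : cmod (p + t%:C * (w - p) - p) < e.
      rewrite (_ : p + _ - p = t%:C * (w - p)); last by ring.
      by rewrite cmodM cmod_real ger0_norm //; have := cmod_ge0 (w - p); nra.
    have := @cder_is_derive R (fun z => k * f z) p (w - p) t (k * 0) (cderZ k (d0 _ zt)).
    by rewrite mulr0 mul0r.
  have [t| |c _] := @MVT R (fun s : R => ReC (k * f (p + s%:C * (w - p)))) (fun=> 0) 0 1 ltr01.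
  - by rewrite in_itv /= => /andP[? ?]; apply: D; rewrite !ltW.
  - apply: continuous_in_subspaceT => t; rewrite inE /= in_itv /= => /D[D' _].
    exact/differentiable_continuous/derivable1_diffP.
  rewrite mul0r !mul0r addr0 mul1r (_ : p + (w - p) = w); last by ring.
  by lra.
apply: complex_ext; first by have := key 1; rewrite !mul1r.
by have := key (- 'i); rewrite !ReImE /=; lra.
Qed.

Lemma Re0_constant (D : set C) (f : C -> C) : open D -> connected D ->
  (forall z, D z -> (exists d, cder f z d) /\ ReC (f z) = 0) ->
  forall z w, D z -> D w -> f z = f w.
Proof.
move=> oD cD H z w Dz Dw.
have loc p : D p -> exists2 e : R, 0 < e & forall u, cmod (u - p) < e -> f u = f p.
  move=> Dp; have [e e0 eP] := (openC_P D).1 oD p Dp.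
  by exists e => //; apply: Re0_locally_constant => // u /eP; exact: H.
apply: (@connected_clopen D [set z | D z /\ f z = f w] cD _ _ _ _ z Dz).2.
- by move=> u [].
- by exists w.
- move=> u [Du fu]; have [e e0 eP] := loc u Du; exists e => // v ve Dv.
  by split=> //; rewrite (eP v ve).
- move=> u Du fu; have [e e0 eP] := loc u Du; exists e => // v ve Dv [_ fv].
  by apply: fu; split=> //; rewrite -(eP v ve).
Qed.

End Topology.

(** * Conformal maps normalized at infinity *)

Section Conformal.
Variable R : realType.
Local Notation C := (Cplx R).
Local Notation ReC := complex.Re.
Local Notation ImC := complex.Im.

Variables (E L : set C) (Phi Psi : C -> C).
Hypothesis cE : compact E.
Hypothesis cL : compact L.
Hypothesis dPhi : forall z, ~ E z -> exists d, cder Phi z d.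
Hypothesis dPsi : forall w, ~ L w -> exists d, cder Psi w d.
Hypothesis PhiK : forall z, ~ E z -> ~ L (Phi z) /\ Psi (Phi z) = z.
Hypothesis PsiK : forall w, ~ L w -> ~ E (Psi w) /\ Phi (Psi w) = w.
Hypothesis Phi_norm : exists M r : R, forall z, r < cmod z ->
  cmod (Phi z - z) <= M / cmod z.

Lemma conformal_near_id e : 0 < e -> exists2 B : R, 0 < B &
  forall z, B < cmod z -> cmod (Phi z - z) <= e.
Proof.
move=> e0; have [M [r H]] := Phi_norm.
exists (Num.max 1 (Num.max r (`|M| / e))); first by rewrite lt_max ltr01.
move=> z; rewrite !gt_max => /andP[z1 /andP[zr zM]].
have z0 : 0 < cmod z by lra.
apply: le_trans (H z zr) _; rewrite ler_pdivrMr //.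
move: zM; rewrite ltr_pdivrMr // => zM; have := ler_norm M; lra.
Qed.

(* The set where [Psi] is large is open and closed in the exterior of a large
   square: [Phi] is close to the identity on the circle [|z| = b + 1]. *)
Lemma conformal_image_exterior (B : R) : exists rho : R, forall w, rho < cmod w ->
  ~ L w /\ B < cmod (Psi w).
Proof.
have [B1 B10 H1] := conformal_near_id ltr01.
have [rE rE0 EP] := compactC_bounded cE; have [rL rL0 LP] := compactC_bounded cL.
pose b := Num.max (Num.max 1 B) (Num.max B1 rE).
have [b1 [b2 [b3 b4]]] : 1 <= b /\ B <= b /\ B1 <= b /\ rE <= b.
  by rewrite /b !le_max !lexx !orbT.
pose rho := Num.max rL (b + 3).
have [h1 h2] : rL <= rho /\ b + 3 <= rho by rewrite /rho !le_max !lexx !orbT.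
have ext w : square_exterior rho w -> rho < cmod w.
  by move=> [|] /lt_le_trans; apply; [exact: abs_Re_le|exact: abs_Im_le].
have extL w : square_exterior rho w -> ~ L w by move=> /ext ? /LP; lra.
have key w : square_exterior rho w -> b + 1 < cmod (Psi w).
  move=> wx; pose S := [set w | square_exterior rho w /\ b + 1 < cmod (Psi w)].
  suff : S w by case.
  apply: (@connected_clopen R (square_exterior rho) S) => //.
  - by apply: connected_square_exterior; lra.
  - by move=> z [].
  (* [Phi] moves this real point by at most 1, so its image has real part at least 2 rho + 1 and
     lies outside the square. *)
  - exists (Phi ((2 * rho + 2)%:C)).
    have z0 : cmod ((2 * rho + 2)%:C : C) = 2 * rho + 2 by rewrite cmod_real ger0_norm //; lra.
    rewrite /S /=; have [_ ->] : ~ L (Phi (2 * rho + 2)%:C) /\ Psi (Phi (2 * rho + 2)%:C) = (2 * rho + 2)%:C.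
      by apply: PhiK => /EP; rewrite z0; lra.
    rewrite z0; split; last by lra.
    have z1 : B1 < 2 * rho + 2 by lra.
    left; have := H1 ((2 * rho + 2)%:C); rewrite z0 => /(_ z1).
    move/(le_trans (abs_Re_le _)); rewrite cReD cReN /= ler_norml => /andP[? _].
    by rewrite ltr_normr; apply/orP; left; lra.
  - move=> z [zx zb]; have [d D] := dPsi (extL z zx).
    have cc : {for z, continuous (fun w => cmod (Psi w))}.
      apply: (@continuous_comp _ _ _ Psi (@cmod R)); first exact: cder_cont D.
      exact: continuous_cmod.
    have [e e0 eP] := gt_near cc zb; by exists e => // u /eP ub xu; split.
  - move=> z zx; rewrite /= => nz.
    have {}nz : cmod (Psi z) <= b + 1.
      by rewrite leNgt; apply/negP => zb; apply: nz; split.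
    have [nE PE] := PsiK (extL z zx).
    have zb : - (b + 1) < - cmod (Psi z).
      (* If |Psi z| were b + 1, then z = Phi (Psi z) would have modulus at most b + 2 < rho. *)
      rewrite ltrN2 lt_neqAle nz andbT; apply/eqP => E1.
      have z1 : B1 < b + 1 by lra.
      have := H1 (Psi z); rewrite PE E1 => /(_ z1).
      have := cmodB_ge z (Psi z); have := ext z zx; rewrite E1; lra.
    have [d D] := dPsi (extL z zx).
    have cc : {for z, continuous (fun w => - cmod (Psi w))}.
      apply: continuousN; apply: (@continuous_comp _ _ _ Psi (@cmod R)); first exact: cder_cont D.
      exact: continuous_cmod.
    have [e e0 eP] := gt_near cc zb; exists e => // u /eP ub xu [_ ?]; lra.
exists (2 * rho + 1) => w wr.
have wx : square_exterior rho w.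
  rewrite /square_exterior /=; apply: contrapT => /not_orP[/negP w1 /negP w2].
  by move: w1 w2; rewrite -!leNgt; have := cmod_le_ReIm w; lra.
by split; [exact: extL|have := key w wx; lra].
Qed.

(** At a point z0 of [E], where [Phi] gives no information: points near z0 have bounded images,
    since [Psi] is large far out. Those with h >= eta therefore have images in a compact part of the
    complement of [L], and [Psi] maps this part onto a compact set at positive distance from z0. *)
Lemma conformal_pullback_closed (h : C -> R) eta :
  (forall w, ~ L w -> {for w, continuous h}) ->
  (forall eta, 0 < eta -> closed [set w | ~ L w /\ eta <= h w]) -> 0 < eta ->
  closed [set z | ~ E z /\ eta <= h (Phi z)].
Proof.
move=> ch hcl eta0; rewrite -openC; apply/openC_P => z0 /= nz0.
have oE : open (~` E) by apply: closed_openC; exact: (compact_closed (@hausdorffC R) cE).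
have [Ez0|Ez0] := pselect (E z0); last first.
  have hz : - eta < - h (Phi z0).
    by rewrite ltrN2 ltNge; apply/negP => hz; apply: nz0.
  have [d D] := dPhi Ez0.
  have cc : {for z0, continuous (fun w => - h (Phi w))}.
    apply: continuousN; apply: (@continuous_comp _ _ _ Phi h); first exact: cder_cont D.
    by apply: ch; case: (PhiK Ez0).
  have [e e0 eP] := gt_near cc hz; exists e => // w /eP hw [_ ?]; lra.
have [rho rhoP] := conformal_image_exterior (cmod z0 + 1).
pose A := [set w | ~ L w /\ eta <= h w] `&` [set w | cmod w <= rho].
have cA : compact A.
  apply: (@bounded_closed_compactC R A rho); last by move=> w [].
  by apply: closedI; [exact: hcl|apply: closed_le_continuous; exact: continuous_cmod].
have cPA : compact (Psi @` A).
  apply: continuous_compact cA; apply: continuous_in_subspaceT => w.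
  by rewrite inE => -[[/dPsi[d /cder_cont]]].
have oPA : open (~` (Psi @` A)).
  by apply: closed_openC; exact: (compact_closed (@hausdorffC R) cPA).
have [|e e0 eP] := (openC_P _).1 oPA z0.
  by move=> [w [[Lw _] _] Ew]; have [] := PsiK Lw; rewrite Ew.
exists (Num.min 1 e); first by rewrite lt_min ltr01.
move=> w; rewrite lt_min => /andP[w1 /eP we] [Ew hw]; apply: we.
have [LP PE] := PhiK Ew; exists (Phi w) => //; split=> //=.
rewrite leNgt; apply/negP => /rhoP[_]; rewrite PE.
by have := cmodB_ge w z0; lra.
Qed.

Lemma conformal_pullback_locally_Re (h : C -> R) : locally_Re (~` L) h ->
  locally_Re (~` E) (fun z => h (Phi z)).
Proof.
move=> hL p Ep; have [LP _] := PhiK Ep; have [f [r [r0 fP]]] := hL _ LP.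
have oE : open (~` E) by apply: closed_openC; exact: (compact_closed (@hausdorffC R) cE).
have [e e0 eP] := (openC_P (~` E)).1 oE p Ep.
have [d D] := dPhi Ep; have [s s0 sP] := (continuousC_C_P _ _).1 (cder_cont D) _ r0.
exists (fun z => f (Phi z)), (Num.min e s); split; first by rewrite lt_min e0.
move=> z; rewrite lt_min => /andP[/eP Ez /sP/fP[LPz -> [d2 D2]]]; split=> //.
by have [d1 D1] := dPhi Ez; exists (d2 * d1); exact: cder_comp D1 D2.
Qed.

Lemma conformal_pullback_pole (h : C -> R) :
  (exists M B : R, forall w, B < cmod w -> `|h w - ln (cmod w)| <= M) ->
  exists M B : R, forall z, B < cmod z -> `|h (Phi z) - ln (cmod z)| <= M.
Proof.
move=> [M [B H]]; have [B1 B10 H1] := conformal_near_id ltr01.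
exists (M + ln 2), (Num.max (Num.max 2 B1) (B + 1)) => z.
rewrite !gt_max => /andP[/andP[z2 /H1 zP] zB].
have p1 := cmodB_ge (Phi z) z; have p2 := cmodB_ge z (Phi z).
rewrite cmodBC in p2.
have := H (Phi z) ltac:(lra); have P0 : 0 < cmod (Phi z) by lra.
have z0 : 0 < cmod z by lra.
have l1 : ln (cmod (Phi z)) <= ln (cmod z) + ln 2.
  by rewrite -lnM ?posrE // ler_ln ?posrE ?mulr_gt0 //; lra.
have l2 : ln (cmod z) <= ln (cmod (Phi z)) + ln 2.
  by rewrite -lnM ?posrE // ler_ln ?posrE ?mulr_gt0 //; lra.
by rewrite !ler_norml => /andP[? ?]; apply/andP; split; lra.
Qed.

End Conformal.

(** * Logarithms on the upper half-plane *)

Section UpperLog.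
Variable R : realType.
Local Notation C := (Cplx R).
Local Notation ReC := complex.Re.
Local Notation ImC := complex.Im.

Lemma slit_Im (z : C) : ImC z != 0 -> slit z.
Proof. by move=> z0 [z1 _]; rewrite z1 eqxx in z0. Qed.

Lemma Arg_upper_range (z : C) : 0 < ImC z -> 0 <= Arg z <= pi.
Proof.
move=> y0; have b := cosine_ratio_bound z.
by rewrite /Arg (ltW y0) acos_ge0 ?acos_lepi.
Qed.

(** Both z and z u have arguments in [0, pi] and |Arg u| < pi, so the two sides differ by less than
    2 pi. In contrast to the local version, how close u must be to 1 does not depend on z. *)
Lemma Log_mul_upper (z u : C) : 0 < ImC z -> 0 < ImC (z * u) -> 0 < ReC u ->
  Log (z * u) = Log z + Log u.
Proof.
move=> y0 yu x0.
have sz : slit z by apply: slit_Im; rewrite gt_eqF.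
have su : slit u by move=> [_]; lra.
have szu : slit (z * u) by apply: slit_Im; rewrite gt_eqF.
have z0 := slit_neq0 sz; have u0 := slit_neq0 su; have zu0 := slit_neq0 szu.
have cz : cmod z != 0 by rewrite cmod_eq0.
have cu : cmod u != 0 by rewrite cmod_eq0.
apply: complex_ext.
  by rewrite cReD /= cmodM lnM // posrE cmod_gt0.
rewrite cImD /=; apply: angle_unique.
- rewrite cosD !cos_Arg // !sin_Arg // cmodM cReM.
  by field; rewrite cz cu.
- rewrite sinD !cos_Arg // !sin_Arg // cmodM cImM.
  by field; rewrite cz cu.
- have /andP[? ?] := Arg_upper_range y0; have /andP[? ?] := Arg_upper_range yu.
  have := abs_Arg_ltpi su; rewrite !ltr_norml => /andP[? ?]; apply/andP; split; lra.
Qed.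

Lemma continuous_comp_C (f : C -> C) (v : C -> R) z : {for z, continuous f} ->
  {for f z, continuous v} -> {for z, continuous (fun w => v (f w))}.
Proof. by move=> cf cv; apply: (@continuous_comp _ _ _ f v). Qed.

End UpperLog.

(** * Symmetry of Walsh's map *)

Section Symmetry.
Variable R : realType.
Local Notation C := (Cplx R).
Local Notation ReC := complex.Re.
Local Notation ImC := complex.Im.

Variables (l : nat) (a : nat -> C) (m : nat -> R) (r : R).
Hypothesis m_gt0 : forall j, (1 <= j < l.+1)%N -> 0 < m j.
Hypothesis m_sum : \sum_(1 <= j < l.+1) m j = 1.
Hypothesis r_gt0 : 0 < r.
Hypothesis a_real : forall j, (1 <= j < l.+1)%N -> ImC (a j) = 0.

Local Notation L := (lemniscatic_set l a m r).
Local Notation g0 := (lemniscatic_green l a m r).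

Definition upper_log (w : C) := \sum_(1 <= j < l.+1) (m j)%:C * Log (w - a j).
Local Notation F := upper_log.

Lemma Im_sub_center w j : (1 <= j < l.+1)%N -> ImC (w - a j) = ImC w.
Proof. by move=> jl; rewrite cImD cImN a_real // subr0. Qed.

Lemma cder_upper_log w : 0 < ImC w ->
  cder F w (\sum_(1 <= j < l.+1) (m j)%:C * (w - a j)^-1).
Proof.
move=> w0; apply: cder_sum_nat => j jl; apply: cderZ.
rewrite -[X in cder _ _ X]mulr1; apply: cder_comp.
  by have := cderB (cder_id w) (cder_cst (a j) w); rewrite subr0.
by apply: cder_Log; apply: slit_Im; rewrite Im_sub_center // gt_eqF.
Qed.

Lemma Re_upper_log w : ReC (F w) = g0 w + ln r.
Proof.
rewrite Re_sum /lemniscatic_green subrK; apply: eq_bigr => j _.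
by rewrite cReM /= mul0r subr0.
Qed.

Lemma exists_center : exists j, (1 <= j < l.+1)%N.
Proof.
have [l0|l0] := posnP l; last by exists 1%N; rewrite /= ltnS.
by have := m_sum; rewrite l0 big_geq //; lra.
Qed.

Lemma Im_upper_log_der w : 0 < ImC w ->
  ImC (\sum_(1 <= j < l.+1) (m j)%:C * (w - a j)^-1) < 0.
Proof.
move=> w0; rewrite Im_sum -oppr_gt0 -sumrN.
have H j : (1 <= j < l.+1)%N -> 0 < - ImC ((m j)%:C * (w - a j)^-1).
  move=> jl; rewrite cImM /= mul0r addr0 -mulrN mulr_gt0 ?m_gt0 //.
  have := Im_sub_center w jl; case: (w - a j) => x y /= ->.
  rewrite opprK divr_gt0 // ltr_wpDl ?sqr_ge0 //.
  by rewrite exprn_gt0.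
have [j jl] := exists_center.
rewrite (bigD1_seq j) /= ?mem_index_iota ?iota_uniq ?jl //.
apply: ltr_pwDl; first exact: H.
rewrite big_seq_cond; apply: sumr_ge0 => i /andP[].
by rewrite mem_index_iota => il _; exact: ltW (H i il).
Qed.

(* The derivative of [F] has negative imaginary part on the convex upper
   half-plane (Noshiro-Warschawski). *)
Lemma upper_log_inj w1 w2 : 0 < ImC w1 -> 0 < ImC w2 -> F w1 = F w2 -> w1 = w2.
Proof.
move=> h1 h2 E; apply/eqP; apply: contrapT => /negP; rewrite eq_sym -subr_eq0 => v0.
(* Along the segment k F has derivative 'i F', whose real part - Im F' is positive, while F takes
   equal values at the ends. *)
pose k := 'i / (w2 - w1).
pose D (w : C) := \sum_(1 <= j < l.+1) (m j)%:C * (w - a j)^-1.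
have up (t : R) : 0 <= t <= 1 -> 0 < ImC (w1 + t%:C * (w2 - w1)).
  move=> /andP[t0 t1]; rewrite !ReImE /=.
  have [->|tn0] := eqVneq t 0; first by lra.
  have tp : 0 < t by rewrite lt_def tn0.
  have : 0 < t * ImC w2 by rewrite mulr_gt0.
  have : 0 <= (1 - t) * ImC w1 by rewrite mulr_ge0 ?subr_ge0 // ltW.
  lra.
have dF (t : R) : 0 <= t <= 1 -> is_derive t (1 : R)
    (fun s : R => ReC (k * F (w1 + s%:C * (w2 - w1)))) (- ImC (D (w1 + t%:C * (w2 - w1)))).
  move=> /up /cder_upper_log/(cderZ k)/cder_is_derive; congr is_derive.
  rewrite /k -[_ * _ * (w2 - w1)]mulrAC divfK // -/(D _) !ReImE /=; ring.
have [t| |c] := @MVT R (fun s : R => ReC (k * F (w1 + s%:C * (w2 - w1))))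
   (fun t => - ImC (D (w1 + t%:C * (w2 - w1)))) 0 1 ltr01.
- by rewrite in_itv /= => /andP[? ?]; apply: dF; rewrite !ltW.
- apply: continuous_in_subspaceT => t; rewrite inE /= in_itv /= => /dF[D' _].
  exact/differentiable_continuous/derivable1_diffP.
rewrite in_itv /= => /andP[c0 c1].
rewrite mul0r addr0 mul1r (_ : w1 + (w2 - w1) = w2); last by ring.
rewrite E subrr subr0 mulr1 => /esym H.
have c01 : 0 <= c <= 1 by rewrite !ltW.
by have := Im_upper_log_der (up c c01); rewrite -/(D _); lra.
Qed.

Let cL : compact L.
Proof. exact: compact_lemniscatic_set. Qed.

(** Each point is joined by a vertical segment, which avoids [L], to the half-plane beyond all of
    [L]. The sign [s] treats both sides of the real line at once. *)
Lemma half_plane_compl_connected (s : R) : s = 1 \/ s = -1 ->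
  connected [set w : C | 0 < s * ImC w /\ ~ L w].
Proof.
move=> sE; have s2 : s * s = 1 by case: sE => ->; lra.
have [B B0 BP] := compactC_bounded cL.
pose H := [set w : C | B < ReC (((- s)%:C * 'i) * w)].
have HE w : H w = (B < s * ImC w).
  by rewrite /H /= !ReImE /=; congr (is_true (_ < _)); ring.
have cH : connected H by apply: convex_connected; exact: convex_half_plane.
have HA w : H w -> 0 < s * ImC w /\ ~ L w.
  rewrite HE => Bw; split; first exact: lt_trans Bw.
  move=> /BP; have := abs_Im_le w.
  have : s * ImC w <= `|ImC w|.
    by case: sE => ->; rewrite ?mul1r ?mulN1r ?ler_norm // -normrN ler_norm.
  by lra.
pose A := [set w : C | 0 < s * ImC w /\ ~ L w].
pose V (w : C) := [set w + (t : R)%:C * ((w + (s * (B + 1))%:C * 'i) - w) | t in `[0, 1]].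
pose q : C := (s * (B + 1))%:C * 'i.
have Iq : ImC q = s * (B + 1) by rewrite /q !ReImE /=; ring.
have Hq : H q by rewrite HE Iq mulrA s2 mul1r; lra.
have VA w : A w -> V w `<=` A.
  move=> [w0 Lw] _ [t /= + <-]; rewrite in_itv /= => /andP[t0 t1].
  have IE : ImC (w + t%:C * (w + (s * (B + 1))%:C * 'i - w)) = ImC w + s * (t * (B + 1)).
    by rewrite !ReImE /=; ring.
  have tB : 0 <= t * (B + 1) by rewrite mulr_ge0 //; lra.
  split; first by rewrite /= IE mulrDr mulrA s2 mul1r; lra.
  move: Lw; apply: (lemniscatic_compl_mono m_gt0 a_real).
    by rewrite !ReImE /=; ring.
  rewrite IE; move: w0; case: sE => ->; rewrite ?mul1r ?mulN1r => w0.
    by rewrite !ger0_norm //; lra.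
  by rewrite !ltr0_norm //; lra.
have -> : [set w : C | 0 < s * ImC w /\ ~ L w] = \bigcup_(w in A) (V w `|` H).
  apply/seteqP; split=> [w Aw|w [z Az [|/HA//]]]; last exact: VA.
  exists w => //; left; exists 0; first by rewrite /= in_itv /= lexx ler01.
  by rewrite mul0r addr0.
apply: (@connected_union_centered _ _ _ _ q) => w Aw; first by right.
apply: connectedU => //; last exact: connected_segmentC.
exists (w + (s * (B + 1))%:C * 'i); split.
  exists 1; first by rewrite /= in_itv /= lexx ler01.
  by rewrite mul1r; ring.
rewrite HE cImD -/q Iq mulrDr (mulrA s s) s2 mul1r.
by case: Aw; lra.
Qed.

Section Pullback.
Variables (E : set C) (Phi Psi : C -> C) (gE : C -> R).
Hypothesis cE : compact E.
Hypothesis dPhi : forall z, ~ E z -> exists d, cder Phi z d.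
Hypothesis dPsi : forall w, ~ L w -> exists d, cder Psi w d.
Hypothesis PhiK : forall z, ~ E z -> ~ L (Phi z) /\ Psi (Phi z) = z.
Hypothesis PsiK : forall w, ~ L w -> ~ E (Psi w) /\ Phi (Psi w) = w.
Hypothesis Phi_norm : exists M r : R, forall z, r < cmod z ->
  cmod (Phi z - z) <= M / cmod z.
Hypothesis gE_green : is_green E gE.

(** Kept general in the maps because it is applied to [Phi] and to its conjugate, with the same
    [gE]. *)
Lemma green_pullback z : ~ E z -> g0 (Phi z) = gE z.
Proof.
have hloc : locally_Re (~` L) g0 by exact: lemniscatic_green_locally_Re.
apply: (green_unique cE gE_green (h := fun z => g0 (Phi z))).
- exact: (conformal_pullback_locally_Re cE dPhi PhiK hloc).
- by move=> w /PhiK[Lw _]; apply: ltW; exact: (lemniscatic_green_gt0 m_gt0).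
- move=> eta eta0; apply: (conformal_pullback_closed cE cL dPhi dPsi PhiK PsiK Phi_norm) => //.
    by move=> w Lw; exact: (locally_Re_continuous hloc).
  by move=> e; exact: (closed_lemniscatic_green m_gt0).
- apply: (conformal_pullback_pole Phi_norm).
  have [M [B [B0 H]]] := lemniscatic_green_pole a r m_gt0 m_sum.
  by exists M, B.
Qed.

End Pullback.

Variables (E : set C) (Phi Psi : C -> C) (gE : C -> R).
Hypothesis cE : compact E.
Hypothesis E_conj : forall z : C, E z -> E (z^*).
Hypothesis dPhi : forall z, ~ E z -> exists d, cder Phi z d.
Hypothesis dPsi : forall w, ~ L w -> exists d, cder Psi w d.
Hypothesis PhiK : forall z, ~ E z -> ~ L (Phi z) /\ Psi (Phi z) = z.
Hypothesis PsiK : forall w, ~ L w -> ~ E (Psi w) /\ Phi (Psi w) = w.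
Hypothesis Phi_norm : exists M r : R, forall z, r < cmod z ->
  cmod (Phi z - z) <= M / cmod z.
Hypothesis gE_green : is_green E gE.

Let Phic (z : C) : C := (Phi (z^*))^*.
Let Psic (w : C) : C := (Psi (w^*))^*.
Let T (w : C) : C := Phic (Psi w).

Let Ecc z : ~ E z -> ~ E (z^*).
Proof. by move=> Ez /E_conj; rewrite conjcK. Qed.

Let Lcc w : ~ L w -> ~ L (w^*).
Proof. exact: (lemniscatic_compl_conj m_gt0 a_real). Qed.

Let dPhic z : ~ E z -> exists d, cder Phic z d.
Proof. by move=> /Ecc/dPhi[d D]; exists (d^*); exact: cder_conj. Qed.

Let dPsic w : ~ L w -> exists d, cder Psic w d.
Proof. by move=> /Lcc/dPsi[d D]; exists (d^*); exact: cder_conj. Qed.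

Let PhicK z : ~ E z -> ~ L (Phic z) /\ Psic (Phic z) = z.
Proof.
move=> /Ecc/PhiK[LP PE]; split; first exact: Lcc.
by rewrite /Psic /Phic conjcK PE conjcK.
Qed.

Let PsicK w : ~ L w -> ~ E (Psic w) /\ Phic (Psic w) = w.
Proof.
move=> /Lcc/PsiK[LP PE]; split; first exact: Ecc.
by rewrite /Psic /Phic conjcK PE conjcK.
Qed.

Let Phic_norm : exists M r : R, forall z, r < cmod z -> cmod (Phic z - z) <= M / cmod z.
Proof.
have [M [s H]] := Phi_norm; exists M, s => z zs.
have := H (z^*); rewrite cmod_conj => /(_ zs).
by rewrite -[X in X <= _]cmod_conj rmorphB /= conjcK.
Qed.

Let dT w : ~ L w -> exists d, cder T w d.
Proof.
move=> Lw; have [d1 D1] := dPsi Lw; have [Ew _] := PsiK Lw.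
by have [d2 D2] := dPhic Ew; exists (d2 * d1); exact: cder_comp.
Qed.

Let green_T w : ~ L w -> ~ L (T w) /\ g0 (T w) = g0 w.
Proof.
move=> Lw; have [Ew PE] := PsiK Lw; have [LP _] := PhicK Ew; split=> //.
rewrite /T (green_pullback cE dPhic dPsic PhicK PsicK Phic_norm gE_green Ew).
by rewrite -(green_pullback cE dPhi dPsi PhiK PsiK Phi_norm gE_green Ew) PE.
Qed.

Let T_near_id : exists2 B : R, 0 < B & forall w, B < cmod w -> ~ L w /\ cmod (T w - w) <= 1.
Proof.
have h2 : (0 : R) < 1 / 2 by lra.
have [B1 B10 H1] := conformal_near_id Phi_norm h2.
have [B2 B20 H2] := conformal_near_id Phic_norm h2.
have [rho rhoP] := conformal_image_exterior cE cL dPsi PhiK PsiK Phi_norm (Num.max B1 B2).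
exists (Num.max 1 rho); first by rewrite lt_max ltr01.
move=> w; rewrite gt_max => /andP[_ /rhoP[Lw]]; rewrite gt_max => /andP[/H1 h1' /H2 h2'].
split=> //; have [_ PE] := PsiK Lw; rewrite PE in h1'.
have := cmod_triangle (Psi w) (T w) w; rewrite -/(T w) in h2'.
by rewrite (cmodBC (Psi w) w); lra.
Qed.

(** [T] is not known to preserve the upper half-plane, so Im (T u) > 0 has to be assumed wherever F
    (T u) is differentiated. *)
Let F_T_locally_constant w e : 0 < e -> (forall u, cmod (u - w) < e ->
    [/\ 0 < ImC u, 0 < ImC (T u) & ~ L u]) ->
  forall u, cmod (u - w) < e -> F (T u) - F u = F (T w) - F w.
Proof.
move=> e0 H; apply: (@Re0_locally_constant R (fun u => F (T u) - F u) w e e0).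
move=> u /H[u0 Tu0 Lu]; split.
  have [d D] := dT Lu; eexists; apply: cderB; last exact: cder_upper_log.
  exact: (cder_comp D (cder_upper_log Tu0)).
by rewrite cReD cReN !Re_upper_log; have [_ ->] := green_T Lu; rewrite subrr.
Qed.

Let T_id_far : exists2 B : R, 0 < B & forall w, B < ImC w -> T w = w.
Proof.
have [B B0 BP] := T_near_id; have [A A0 AP] := centers_bounded l a.
exists (B + 1); first by lra.
have H w : B + 1 < ImC w -> [/\ 0 < ImC w, 0 < ImC (T w) & ~ L w].
  move=> wB; have [|Lw Tw] := BP w; first by have := abs_Im_le w; have := ler_norm (ImC w); lra.
  split=> //; first by lra.
  by have := le_trans (abs_Im_le _) Tw; rewrite cImD cImN ler_norml => /andP[? _]; lra.
pose D := [set w : C | B + 1 < ReC (- 'i * w)].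
have DE w : D w = (B + 1 < ImC w) by rewrite /D /= !ReImE /=; congr (is_true (_ < _)); ring.
have cD : connected D by apply: convex_connected; exact: convex_half_plane.
have oD : open D.
  apply/openC_P => w; rewrite DE => wB; exists (ImC w - (B + 1)); first by lra.
  move=> u uw; rewrite DE; have := le_lt_trans (abs_Im_le _) uw.
  by rewrite cImD cImN ltr_norml => /andP[? _]; lra.
have cst w1 w2 : D w1 -> D w2 -> F (T w1) - F w1 = F (T w2) - F w2.
  apply: (@Re0_constant R D (fun u => F (T u) - F u) oD cD) => u; rewrite DE => /H[u0 Tu0 Lu].
  split.
    have [d D'] := dT Lu; eexists; apply: cderB; last exact: cder_upper_log.
    exact: (cder_comp D' (cder_upper_log Tu0)).
  by rewrite cReD cReN !Re_upper_log; have [_ ->] := green_T Lu; rewrite subrr.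
(* The difference is constant on the half-plane, so it may be evaluated high up, where it is
   arbitrarily small. *)
have small w e : 0 < e -> D w -> cmod (F (T w) - F w) <= e.
  move=> e0 Dw.
  have [d d0 dP] := (continuousC_C_P _ _).1 (cder_cont (@cder_Log1 R)) _ e0.
  (* So high that u = (T z - a_j) / (z - a_j) satisfies |u - 1| <= 1 / |z - a_j|, which is less than
     both d and 1. *)
  pose y := B + 2 + A + 1 + 1 / d.
  have d1 : 0 < 1 / d by rewrite divr_gt0.
  have Dy : D (0 +i* y) by rewrite DE /= /y; lra.
  rewrite (cst w _ Dw Dy); set z := 0 +i* y.
  have [z0 Tz0 Lz] : [/\ 0 < ImC z, 0 < ImC (T z) & ~ L z] by apply: H; rewrite -DE.
  have [|_ Tz] := BP z; first by have := abs_Im_le z; have := ler_norm (ImC z); rewrite /z /= /y; lra.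
  have term j : (1 <= j < l.+1)%N -> cmod (Log (T z - a j) - Log (z - a j)) <= e.
    move=> jl; have zj : 1 + 1 / d < cmod (z - a j).
      have := abs_Im_le (z - a j); have := ler_norm (ImC (z - a j)).
      by rewrite Im_sub_center // /z /= /y; lra.
    have zj0 : 0 < cmod (z - a j) by lra.
    have zjn : z - a j != 0 by rewrite -cmod_gt0.
    pose u := (T z - a j) / (z - a j).
    have uE : T z - a j = (z - a j) * u by rewrite /u mulrC divfK.
    have u1 : u - 1 = (T z - z) / (z - a j) by rewrite /u; field.
    have us : cmod (u - 1) < d /\ cmod (u - 1) < 1.
      rewrite u1 cmodM cmodV !ltr_pdivrMr //.
      have : d * (1 + 1 / d) < d * cmod (z - a j) by rewrite ltr_pM2l.
      by rewrite mulrDr mulr1 mulrC divfK ?gt_eqF //; split; lra.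
    have ux : 0 < ReC u.
      have := le_lt_trans (abs_Re_le _) us.2.
      by rewrite cReD cReN /= ltr_norml => /andP[? _]; lra.
    have L1 : Log (1 : C) = 0.
      by apply: complex_ext; rewrite /= ?cmod1 ?ln1 // Arg_pos_real.
    rewrite uE Log_mul_upper //.
    - rewrite (_ : _ - _ = Log u - Log 1); last by rewrite L1; ring.
      exact/ltW/dP/us.1.
    - by rewrite Im_sub_center.
    - by rewrite -uE Im_sub_center.
  rewrite -(sum_weights m_sum e) /upper_log -sumrB.
  rewrite big_nat_cond [leRHS]big_nat_cond.
  elim: (index_iota 1 l.+1) => [|j s IH]; first by rewrite !big_nil cmod0.
  rewrite !big_cons; case: ifP => // /andP[jl _].
  apply: le_trans (cmodD _ _) _; apply: lerD IH.
  rewrite -mulrBr cmodM cmod_real (gtr0_norm (m_gt0 jl)) ler_pM2l ?m_gt0 //.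
  exact: term.
move=> w wB; have [w0 Tw0 _] := H w wB.
apply: upper_log_inj => //; apply/eqP; rewrite -subr_eq0 -cmod_eq0 eq_le cmod_ge0 andbT.
by apply/ler_addgt0Pr => e e0; rewrite add0r; apply: small => //; rewrite DE.
Qed.

Let T_id_upper w : 0 < ImC w -> ~ L w -> T w = w.
Proof.
move=> w0 Lw; pose A := [set w : C | 0 < 1 * ImC w /\ ~ L w].
have cA : connected A by apply: half_plane_compl_connected; left.
have AE u : A u = (0 < ImC u /\ ~ L u) by rewrite /A /= mul1r.
have oL : open (~` L) by apply: closed_openC; exact: closed_lemniscatic_set.
suff : [set u | A u /\ T u = u] w by case.
apply: (@connected_clopen R A) => //; last by rewrite AE.
- by move=> u [].
- have [B B0 BP] := T_id_far; have [B1 B10 B1P] := T_near_id.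
  pose z : C := 0 +i* (B + B1 + 1); exists z; split; last by apply: BP; rewrite /z /=; lra.
  rewrite AE; split; first by rewrite /z /=; lra.
  by apply: (B1P z _).1; have := abs_Im_le z; have := ler_norm (ImC z); rewrite /z /=; lra.
(* Openness: near a fixed point [T] stays in the upper half-plane by continuity, so F (T v) - F v
   keeps the value 0 and injectivity of F applies. *)
- move=> u []; rewrite AE => -[u0 Lu] Tu.
  have [d D] := dT Lu.
  have [e1 e10 e1P] := (openC_P (~` L)).1 oL u Lu.
  have [e2 e20 e2P] := (continuousC_C_P _ _).1 (cder_cont D) _ u0.
  pose e := Num.min (ImC u) (Num.min e1 e2).
  have e0 : 0 < e by rewrite !lt_min u0 e10.
  have good v : cmod (v - u) < e -> [/\ 0 < ImC v, 0 < ImC (T v) & ~ L v].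
    rewrite !lt_min => /andP[v0 /andP[/e1P Lv /e2P Tv]]; split=> //.
      have := le_lt_trans (abs_Im_le _) v0.
      by rewrite cImD cImN ltr_norml => /andP[? _]; lra.
    have := le_lt_trans (abs_Im_le _) Tv.
    by rewrite Tu cImD cImN ltr_norml => /andP[? _]; lra.
  exists e => // v ve Av; split=> //; have [v0 Tv0 Lv] := good v ve.
  apply: upper_log_inj => //; apply/eqP; rewrite -subr_eq0.
  by rewrite (F_T_locally_constant e0 good ve) Tu subrr.
(* Closedness is continuity of T v - v. *)
- move=> u; rewrite AE => -[u0 Lu] nTu.
  have Tu : 0 < cmod (T u - u) by rewrite cmod_gt0 subr_eq0; apply/eqP => E1; apply: nTu; split=> //; rewrite AE.
  have [d D] := dT Lu.
  have cTB := cder_cont (cderB D (cder_id u)).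
  have cc := continuous_comp_C cTB (@continuous_cmod R _).
  have [e e0 eP] := gt_near cc Tu; exists e => // v /eP + _ [_ Tv].
  by rewrite /= Tv subrr cmod0 ltxx.
Qed.

Let T_id w : ~ L w -> T w = w.
Proof.
move=> Lw; case: (ltgtP (ImC w) 0) => w0; last first.
(* A real point is approached from above: T u - u vanishes at u = w + t 'i and is continuous. *)
- apply: contrapT => Tw; have Tu : 0 < cmod (T w - w) by rewrite cmod_gt0 subr_eq0; apply/eqP.
  have [d D] := dT Lw; have cTB := cder_cont (cderB D (cder_id w)).
  have cc := continuous_comp_C cTB (@continuous_cmod R _).
  have [e e0 eP] := gt_near cc Tu.
  have oL : open (~` L) by apply: closed_openC; exact: closed_lemniscatic_set.
  have [s s0 sP] := (openC_P (~` L)).1 oL w Lw.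
  pose t := Num.min e s / 2.
  have m0 : 0 < Num.min e s by rewrite lt_min e0.
  have me : Num.min e s <= e by rewrite ge_min lexx.
  have ms : Num.min e s <= s by rewrite ge_min lexx orbT.
  pose u : C := w + t%:C * 'i.
  have uw : cmod (u - w) = t.
    rewrite (_ : u - w = t%:C * 'i); last by rewrite /u; ring.
    rewrite cmodM cmod_real cmodE /= expr0n add0r expr1n sqrtr1 mulr1.
    by rewrite ger0_norm // /t; lra.
  have := eP u; rewrite uw => /(_ ltac:(rewrite /t; lra)) /=.
  rewrite T_id_upper ?subrr ?cmod0 ?ltxx //.
    by rewrite /u !ReImE /= w0 /t; lra.
  by apply: sP; rewrite uw /t; lra.
- exact: T_id_upper.
(* Below the real line, conjugating the identity at the mirrored point shows that [Psi] commutes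
   with conjugation at w, and this gives T w = w. *)
- have w0' : 0 < ImC (w^*) by rewrite cIm_conj oppr_gt0.
  have := T_id_upper w0' (Lcc Lw); rewrite /T /Phic => /(congr1 (@conjc R)).
  rewrite !conjcK => H.
  have [Ew PE] := PsiK (Lcc Lw).
  have [_ E1] := PhiK (Ecc Ew); rewrite H in E1.
  by rewrite E1 conjcK PE conjcK.
Qed.

Lemma conformal_conj z : ~ E z -> Phi (z^*) = (Phi z)^*.
Proof.
move=> Ez; have [LP PE] := PhiK Ez; have := T_id LP.
by rewrite /T /Phic PE => <-; rewrite conjcK.
Qed.

End Symmetry.

(** * The slit lemniscatic domain *)

Section SlitDomain.
Variable R : realType.
Local Notation C := (Cplx R).
Local Notation ReC := complex.Re.
Local Notation ImC := complex.Im.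

Lemma lemniscatic_nonpos (l : nat) (a : nat -> C) (m : nat -> R) (r : R) (w : C) :
  r <= 0 -> lemniscatic_set l a m r w -> exists2 j, (1 <= j < l.+1)%N & w = a j.
Proof.
move=> r0; rewrite /lemniscatic_set /= => wr; apply: contrapT => H.
have H' j : (1 <= j < l.+1)%N -> w != a j.
  by move=> jl; apply/eqP => E; apply: H; exists j.
by have [] := ln_lemniscatic_prod m H'; rewrite /lemniscatic_prod; lra.
Qed.

Variables (l : nat) (a : nat -> C) (m : nat -> R) (r : R) (c : nat -> R).
Local Notation L := (lemniscatic_set l a m r).
Hypothesis l_gt0 : (1 <= l)%N.
Hypothesis lab : lemniscatic_labelling l L a c.

Lemma labelling_mono i j : (1 <= i)%N -> (i <= j)%N -> (j <= 2 * l)%N -> c i <= c j.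
Proof.
move=> i1; elim: j => [|j IH] ij jl; first by lia.
have [->//|ij'] := eqVneq i j.+1.
have /ltW := endpoints_lt lab (i := j) ltac:(lia).
by apply: le_trans; apply: IH; lia.
Qed.

Lemma center_gt j k : (1 <= j)%N -> (j <= k)%N -> (k <= l)%N -> c (2 * j - 1)%N < ReC (a k).
Proof.
move=> j1 jk kl; have /andP[h _] := centers_between lab (j := k) ltac:(lia).
by apply: le_lt_trans h; apply: labelling_mono; lia.
Qed.

Lemma center_lt j k : (1 <= j)%N -> (j <= k)%N -> (k <= l)%N -> ReC (a j) < c (2 * k)%N.
Proof.
move=> j1 jk kl; have /andP[_ h] := centers_between lab (j := j) ltac:(lia).
by apply: lt_le_trans h _; apply: labelling_mono; lia.
Qed.

Lemma first_endpoint_lt_center j : (1 <= j < l.+1)%N -> c 1%N < ReC (a j).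
Proof. by move=> jl; apply: (@center_gt 1 j) => //; lia. Qed.

Lemma lemniscatic_trace (x : R) : L x%:C <->
  exists2 j, (1 <= j <= l)%N & c (2 * j - 1)%N <= x <= c (2 * j)%N.
Proof.
split.
  rewrite {1}(components_cover lab) => -[j /= jl Lx]; exists j => //.
  have := components_trace lab jl; move/seteqP => [/(_ x Lx) + _].
  by rewrite /= in_itv.
move=> [j jl xj]; rewrite (components_cover lab); exists j => //.
have := components_trace lab jl; move/seteqP => [_ +]; apply.
by rewrite /= in_itv.
Qed.

Lemma lemniscatic_endpoint i : (1 <= i <= 2 * l)%N -> L (c i)%:C.
Proof.
move=> il; apply/lemniscatic_trace; have [oi|ei] := boolP (odd i).
  exists (i.+1)./2; first by lia.
  have -> : (2 * i.+1./2 - 1)%N = i by lia.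
  by rewrite lexx /=; apply: labelling_mono; lia.
exists (i./2); first by lia.
have iE : (2 * i./2)%N = i by lia.
by rewrite iE lexx andbT; apply: labelling_mono; lia.
Qed.

(** The point c_1 belongs to [L] but lies strictly to the left of every center. *)
Lemma labelling_level_gt0 : 0 < r.
Proof.
rewrite ltNge; apply/negP => r0.
have [|j jl E] := lemniscatic_nonpos r0 (@lemniscatic_endpoint 1 _); first by lia.
by have := first_endpoint_lt_center jl; rewrite -E /= ltxx.
Qed.

Lemma lemniscatic_left x : x < c 1%N -> ~ L x%:C.
Proof.
move=> xc /lemniscatic_trace[j jl /andP[h _]].
have : c 1%N <= c (2 * j - 1)%N by apply: labelling_mono; lia.
by lra.
Qed.

Hypothesis m_gt0 : forall j, (1 <= j < l.+1)%N -> 0 < m j.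
Hypothesis m_sum : \sum_(1 <= j < l.+1) m j = 1.

Let a_real j : (1 <= j < l.+1)%N -> ImC (a j) = 0.
Proof. by move=> jl; apply: (centers_real lab); lia. Qed.

Local Notation DL := (slit_domain L (c 1%N)).

Lemma slit_domainP (K : set C) (x0 : R) (w : C) :
  slit_domain K x0 w <-> ~ K w /\ ~ (ImC w = 0 /\ x0 <= ReC w).
Proof.
split.
  move=> /not_orP[Kw rw]; split=> // -[w0 wx]; apply: rw.
  exists (ReC w); first by rewrite /= in_itv /= wx.
  by apply: complex_ext.
move=> [Kw rw] [//|[x /= + xw]]; rewrite in_itv /= andbT => xx.
by apply: rw; rewrite -xw.
Qed.

Lemma open_slit_domain (K : set C) (x0 : R) : closed K -> open (slit_domain K x0).
Proof.
move=> cK; apply: closed_openC; apply: closedU => //.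
rewrite -openC; apply/openC_P => w nw.
have nw' : ~ (ImC w = 0 /\ x0 <= ReC w).
  have : slit_domain set0 x0 w by move=> [].
  by move/slit_domainP => [].
have near e : 0 < e -> (forall u, cmod (u - w) < e -> ~ (ImC u = 0 /\ x0 <= ReC u)) ->
    exists2 e : R, 0 < e & forall u, cmod (u - w) < e -> (~` real_ray x0) u.
  move=> e0 H; exists e => // u /H hu [x + xu]; rewrite /= in_itv /= andbT => xx.
  by apply: hu; rewrite -xu.
have [w0|w0] := eqVneq (ImC w) 0.
  have wx : ReC w < x0 by rewrite ltNge; apply/negP => wx; exact: nw'.
  apply: (near (x0 - ReC w)); first by lra.
  move=> u /(le_lt_trans (abs_Re_le _)); rewrite cReD cReN ltr_norml => /andP[_ ?] [_ ?]; lra.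
apply: (near `|ImC w|); first by rewrite normr_gt0.
move=> u /(le_lt_trans (abs_Im_le _)); rewrite cImD cImN => + [u0 _].
by rewrite u0 sub0r normrN ltxx.
Qed.

Lemma slit_domain_left (x t : R) : x < c 1%N -> DL (x%:C + t%:C * 'i).
Proof.
move=> xc; apply/slit_domainP; split.
  have := lemniscatic_left xc; apply: (lemniscatic_compl_mono m_gt0 a_real).
    by rewrite !ReImE /=; ring.
  by rewrite /= normr0.
by rewrite !ReImE /= => -[_]; lra.
Qed.

Lemma slit_center_sub w j : (1 <= j < l.+1)%N -> ~ (ImC w = 0 /\ c 1%N < ReC w) ->
  slit (a j - w).
Proof.
move=> jl H [h1 h2]; apply: H; have := first_endpoint_lt_center jl.
by move: h1 h2; rewrite cImD cReD cImN cReN a_real // => h1 h2 h3; split; lra.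
Qed.

Lemma slit_domain_center_sub w j : DL w -> (1 <= j < l.+1)%N -> slit (a j - w).
Proof.
move=> /slit_domainP[_ H] jl; apply: slit_center_sub => // -[h1 h2].
by apply: H; split=> //; exact: ltW.
Qed.

(** The parts of the complement of [L] above and below the real line are joined by vertical lines
    through real points left of c_1, which avoid [L]. All the pieces [B x] share the point c_1 - 1 +
    'i. *)
Lemma connected_slit_domain : connected DL.
Proof.
have r0 := labelling_level_gt0.
pose A (s : R) := [set w : C | 0 < s * ImC w /\ ~ L w].
have cA s : s = 1 \/ s = -1 -> connected (A s).
  by move=> sE; apply: half_plane_compl_connected.
have AD s : A s `<=` DL.
  move=> w [w0 Lw]; apply/slit_domainP; split=> // -[w1 _].
  by move: w0; rewrite w1 mulr0 ltxx.
pose V (x : R) : set C := [set x%:C + (t : R)%:C * 'i | t in [set: R]].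
have cV x : connected (V x).
  have cR : connected [set: R] by apply/connected_intervalP => ? ? ? ? ? ?.
  apply: (connected_continuous_connected cR).
  apply: continuous_subspaceT => t; apply/cvgC_P => e e0.
  apply/nbhs_ballP; exists e => // s H0; have {H0} H : `|s - t| < e by rewrite distrC.
  rewrite (_ : _ - _ = (s - t)%:C * 'i); last by rewrite rmorphB /=; ring.
  by rewrite cmodM cmod_real [cmod 'i]cmodE /= expr0n add0r expr1n sqrtr1 mulr1.
pose B (x : R) := (A 1 `|` V x) `|` A (-1).
have VA (x s : R) : s = 1 \/ s = -1 -> x < c 1%N -> A s (x%:C + s%:C * 'i).
  move=> sE xc; split; last by have /slit_domainP[] := @slit_domain_left x s xc.
  by rewrite !ReImE /=; case: sE => ->; lra.
have cB x : x < c 1%N -> connected (B x).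
  move=> xc; apply: connectedU; last by apply: cA; right.
    exists (x%:C + (-1)%:C * 'i); split; last by apply: VA => //; right.
    by right; exists (- 1).
  apply: connectedU; [|by apply: cA; left|exact: cV].
  exists (x%:C + (1)%:C * 'i); split; first by apply: VA => //; left.
  by exists 1.
have x0c : c 1%N - 1 < c 1%N by lra.
have -> : DL = \bigcup_(x in [set x | x < c 1%N]) B x.
  apply/seteqP; split=> [w|w [x /= xc [[|[t _ <-]]|]]]; [|exact: AD|exact: slit_domain_left|exact: AD].
  move=> /slit_domainP[Lw nw]; case: (ltgtP (ImC w) 0) => w0.
  - exists (c 1%N - 1) => //; right; split=> //; lra.
  - exists (c 1%N - 1) => //; left; left; split=> //; lra.
  - have xc : ReC w < c 1%N by rewrite ltNge; apply/negP => ?; apply: nw.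
    exists (ReC w) => //; left; right; exists 0 => //.
    by apply: complex_ext; rewrite !ReImE /= ?w0; ring.
apply: (@connected_union_centered _ _ _ _ ((c 1%N - 1)%:C + 1%:C * 'i)) => x xc; last exact: cB.
by left; left; apply: VA => //; left.
Qed.

(** Each component of [L] contains its left endpoint c_(2j-1), which lies on the ray; the ray
    together with infinity thus connects all of them. *)
Lemma sphere_compl_slit_domain_connected : connected (sphere_compl DL).
Proof.
pose S := (Some : C -> one_point_compactification C).
have cS (A : set C) : connected A -> connected (S @` A).
  move=> cA; apply: connected_continuous_connected => //.
  by apply: continuous_subspaceT; exact: one_point_compactification_some_continuous.
have cray : connected (real_ray (c 1%N)).
  apply: connected_continuous_connected.
    by apply/connected_intervalP; exact: interval_is_interval.
  apply: continuous_subspaceT => t; apply/cvgC_P => e e0.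
  apply/nbhs_ballP; exists e => // s H0; have {H0} H : `|s - t| < e by rewrite distrC.
  by rewrite -rmorphB /= cmod_real.
pose Z := S @` real_ray (c 1%N) `|` [set None].
(* Adding infinity to the ray is taking its closure in the sphere, which preserves connectedness. *)
have ZE : Z = closure (S @` real_ray (c 1%N)).
  apply/seteqP; split=> [z [zr|->]|[z|] zc]; first exact: subset_closure.
  - move=> U [W [cW _] WU]; have [B B0 BP] := compactC_bounded cW.
    pose x := Num.max (c 1%N) (B + 1).
    exists (S x%:C); split; first by exists x%:C => //; exists x => //=; rewrite in_itv /= /x le_max lexx.
    apply: WU; left; exists x%:C => //= /BP; rewrite cmod_real.
    have : B + 1 <= x by rewrite /x le_max lexx orbT.
    by have := ler_norm x; lra.
  - left; exists z => //; apply: contrapT => nz.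
    have oD : open (slit_domain (set0 : set C) (c 1%N)) by apply: open_slit_domain; exact: closed0.
    have Dz : slit_domain set0 (c 1%N) z by move=> [].
    have nb : nbhs z (slit_domain set0 (c 1%N)) by apply: open_nbhs_nbhs.
    have [_ [[u ru <-] [v Dv /Some_inj uv]]] := zc _ (one_point_compactification_some_nbhs _ _ nb).
    by apply: Dv; right; rewrite uv.
  - by right.
have cZ : connected Z by rewrite ZE; apply: connected_closure; exact: cS.
pose K j := S @` connected_component L (a j).
have -> : sphere_compl DL = \bigcup_(j in [set j | (1 <= j <= l)%N]) (K j `|` Z).
  apply/seteqP; split=> [[z|] Dz|z [j /= jl]].
  - have [zr|nzr] := pselect (real_ray (c 1%N) z).
      by exists 1%N; [rewrite /= l_gt0|right; left; exists z].
    have Lz : L z by apply: contrapT => Lz; apply: Dz; exists z => // -[].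
    move: Lz; rewrite {1}(components_cover lab) => -[j jl jz].
    by exists j => //; left; exists z.
  - by exists 1%N; [rewrite /= l_gt0|right; right].
  - move=> [[w Kw <-]|[[w rw <-]|->]] [u Du]; last by [].
      by move=> /Some_inj uw; apply: Du; left; rewrite uw; exact: connected_component_sub Kw.
    by move=> /Some_inj uw; apply: Du; right; rewrite uw.
apply: bigcup_connected; first by exists None => j _; right; right.
move=> j jl; apply: connectedU => //; last by apply: cS; exact: component_connected.
exists (S (c (2 * j - 1)%N)%:C); split.
  exists (c (2 * j - 1)%N)%:C => //.
  have /seteqP[_ +] := components_trace lab jl; apply.
  by rewrite /= in_itv /= lexx /=; apply: labelling_mono; move: jl => /=; lia.
left; exists (c (2 * j - 1)%N)%:C => //; exists (c (2 * j - 1)%N) => //=.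
by rewrite in_itv /= andbT; apply: labelling_mono; move: jl => /=; lia.
Qed.

Lemma slit_domain_simply_connected : simply_connected_domain DL.
Proof.
have r0 := labelling_level_gt0.
split.
- by exists ((c 1%N - 1)%:C + 0%:C * 'i); apply: slit_domain_left; lra.
- by apply: open_slit_domain; exact: closed_lemniscatic_set.
- exact: connected_slit_domain.
- exact: sphere_compl_slit_domain_connected.
Qed.

End SlitDomain.

(** * Boundary limits *)

Section Limits.
Variable R : realType.
Local Notation C := (Cplx R).
Local Notation ReC := complex.Re.
Local Notation ImC := complex.Im.

Definition tends_within (S : set C) (u : C) (q : C -> R) (q0 : R) := forall e : R, 0 < e ->
  exists2 d : R, 0 < d & forall w, S w -> cmod (w - u) < d -> `|q w - q0| < e.

Lemma continuous_tends_within (S : set C) (u : C) (q : C -> R) :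
  {for u, continuous q} -> tends_within S u q (q u).
Proof.
by move=> /continuousC_R_P H e /H[d d0 dP]; exists d => // w _; exact: dP.
Qed.

Lemma tends_within_ext (S : set C) (u : C) (q q' : C -> R) (q0 : R) :
  (forall w, S w -> q w = q' w) -> tends_within S u q q0 -> tends_within S u q' q0.
Proof.
by move=> E H e /H[d d0 dP]; exists d => // w Sw wu; rewrite -E //; exact: dP.
Qed.

Lemma tends_within_addr (S : set C) (u : C) (q : C -> R) (q0 k : R) :
  tends_within S u q q0 -> tends_within S u (fun w => q w + k) (q0 + k).
Proof.
move=> H e /H[d d0 dP]; exists d => // w Sw wu.
by rewrite (_ : _ - _ = q w - q0); [exact: dP|ring].
Qed.

Lemma tends_within_sum (S : set C) (u : C) (m : nat -> R) (q : nat -> C -> R)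
    (q0 : nat -> R) (i n : nat) :
  (forall j, (i <= j < n)%N -> tends_within S u (q j) (q0 j)) ->
  tends_within S u (fun w => \sum_(i <= j < n) m j * q j w) (\sum_(i <= j < n) m j * q0 j).
Proof.
move=> H; rewrite big_nat_cond.
apply: (@tends_within_ext _ _
    (fun w => \sum_(i <= j < n | (i <= j < n)%N && true) m j * q j w)).
  by move=> w _; rewrite [RHS]big_nat_cond.
elim: (index_iota i n) => [|j s IH].
  by move=> e e0; exists 1 => // w _ _; rewrite !big_nil subrr normr0.
have [jn|jn] := boolP ((i <= j < n)%N && true); last first.
  by move=> e /IH[d d0 dP]; exists d => // w Sw wu; rewrite !big_cons (negbTE jn); exact: dP.
move=> e e0; have m0 : 0 < `|m j| + 1 by rewrite ltr_wpDl.
have e2 : 0 < e / 2 by lra.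
have /andP[/H Hj _] := jn; have [d1 d10 d1P] := Hj _ (divr_gt0 e2 m0).
have [d2 d20 d2P] := IH _ e2; exists (Num.min d1 d2); first by rewrite lt_min d10.
move=> w Sw; rewrite lt_min => /andP[w1 w2]; rewrite !big_cons jn opprD addrACA -mulrBr.
have := d1P w Sw w1; rewrite ltr_pdivlMr // => h1; have h2 := d2P w Sw w2.
apply: le_lt_trans (ler_normD _ _) _; rewrite normrM.
by have := normr_ge0 (q j w - q0 j); have := normr_ge0 (m j); nra.
Qed.

(** Made for branches: the real part, a Green's function, is continuous in the whole plane, whereas
    the imaginary part may have a limit only from within [S]. *)
Lemma cvg_within_complex (S : set C) (u : C) (G : C -> C) (p q : C -> R) (q0 : R) :
  (forall w, S w -> G w = p w +i* q w) -> {for u, continuous p} ->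
  tends_within S u q q0 -> G @ within S (nbhs u) --> (p u +i* q0 : C).
Proof.
move=> GE cp tq; apply/cvgC_P => e e0; have e2 : 0 < e / 2 by lra.
have [d1 d10 d1P] := (continuousC_R_P p u).1 cp _ e2; have [d2 d20 d2P] := tq _ e2.
apply/nbhsC_P; exists (Num.min d1 d2); first by rewrite lt_min d10.
move=> w; rewrite lt_min => /andP[/d1P w1 w2] Sw; rewrite GE //.
apply: le_lt_trans (cmod_le_ReIm _) _ => /=; have := d2P w Sw w2; lra.
Qed.

Lemma cvg_within_dist (S : set C) (u v : C) (G : C -> C) (e : R) : 0 < e ->
  G @ within S (nbhs u) --> v ->
  exists2 d : R, 0 < d & forall w, cmod (w - u) < d -> S w -> cmod (G w - v) < e.
Proof. by move=> e0 /cvgC_P/(_ e e0)/nbhsC_P. Qed.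

Lemma Arg_sub_tends (S : set C) (u b : C) : slit (b - u) ->
  tends_within S u (fun w => Arg (b - w)) (Arg (b - u)).
Proof.
move=> sl; have cA := continuous_Arg sl.
apply: (@continuous_tends_within _ _ (fun w => Arg (b - w))).
apply: (@continuous_comp_C _ (fun w => b - w)) => //.
have := cderB (cder_cst b u) (cder_id u); exact: cder_cont.
Qed.

Lemma slit_sub_real (b : C) (u : R) : ImC b = 0 -> u < ReC b -> slit (b - u%:C).
Proof. by move=> b0 ub [_]; rewrite !ReImE /=; lra. Qed.

Lemma Arg_sub_real (b : C) (u : R) : ImC b = 0 -> u < ReC b -> Arg (b - u%:C) = 0.
Proof. by move=> b0 ub; apply: Arg_pos_real; rewrite !ReImE /= ?b0 ?subrr //; lra. Qed.

(** The point b - u lies on the cut of [Arg], its opposite on the positive half-line. *)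
Lemma Arg_flip_tends (S : set C) (u : R) (b : C) : ImC b = 0 -> ReC b < u ->
  tends_within S u%:C (fun w => Arg (- (b - w))) 0.
Proof.
move=> b0 bu.
have E : - (b - u%:C) = (- b) - ((- u)%:C : C) by rewrite rmorphN /=; ring.
have bu' : - u < ReC (- b) by rewrite cReN; lra.
have b0' : ImC (- b) = 0 by rewrite cImN b0 oppr0.
have A0 : Arg (- (b - u%:C)) = 0 by rewrite E Arg_sub_real.
rewrite -A0; apply: (@continuous_tends_within _ _ (fun w => Arg (- (b - w)))).
apply: (@continuous_comp_C _ (fun w => - (b - w))).
  by have := cderN (cderB (cder_cst b u%:C) (cder_id u%:C)); exact: cder_cont.
by apply: continuous_Arg; rewrite E; exact: slit_sub_real.
Qed.

(** For w above the real line b - w lies below it, hence the value - pi. *)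
Lemma Arg_sub_tends_upper (u : R) (b : C) (S : set C) : ImC b = 0 -> ReC b < u ->
  (forall w, S w -> 0 < ImC w) -> tends_within S u%:C (fun w => Arg (b - w)) (- pi).
Proof.
move=> b0 bu Sup; have := tends_within_addr (- pi) (@Arg_flip_tends S u b b0 bu).
rewrite add0r; apply: tends_within_ext => w /Sup w0.
by rewrite [RHS]Arg_lower // !ReImE b0; lra.
Qed.

Lemma Arg_sub_tends_lower (u : R) (b : C) (S : set C) : ImC b = 0 -> ReC b < u ->
  (forall w, S w -> ImC w < 0) -> tends_within S u%:C (fun w => Arg (b - w)) pi.
Proof.
move=> b0 bu Sup; have := tends_within_addr pi (@Arg_flip_tends S u b b0 bu).
rewrite add0r; apply: tends_within_ext => w /Sup w0.
have y : 0 < ImC (b - w) by rewrite !ReImE b0; lra.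
by rewrite (Arg_upper y) addrC.
Qed.

Lemma branch_difference_constant (g : C -> R) (D : set C) (G1 G2 : C -> C) :
  open D -> connected D -> green_branch g D G1 -> green_branch g D G2 ->
  forall z w, D z -> D w -> G1 z - G2 z = G1 w - G2 w.
Proof.
move=> oD cD [h1 r1] [h2 r2]; apply: (@Re0_constant R D (fun z => G1 z - G2 z)) => // z Dz.
split; last by rewrite cReD cReN r1 // r2 // subrr.
have [d1 D1] := (derivableC_P _ _).1 (h1 z Dz); have [d2 D2] := (derivableC_P _ _).1 (h2 z Dz).
by exists (d1 - d2); exact: cderB.
Qed.

End Limits.

(** * The conformal map on the real line left of b_1 *)

Section RealLine.
Variable R : realType.
Local Notation C := (Cplx R).
Local Notation ReC := complex.Re.
Local Notation ImC := complex.Im.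

Lemma continuous_real_line (f : C -> C) (t : R) : {for (t%:C : C), continuous f} ->
  {for t, continuous (fun s : R => ReC (f s%:C))}.
Proof.
move=> /continuousC_C_P cf; apply/cvgrPdist_lt => e e0; have [d d0 dP] := cf e e0.
apply/nbhs_ballP; exists d => // s H0; have {H0} H : `|s - t| < d by rewrite distrC.
rewrite /= -cReN -cReD; apply: le_lt_trans (abs_Re_le _) _.
by rewrite cmodBC; apply: dP; rewrite -rmorphB /= cmod_real.
Qed.

Lemma real_IVT (f : C -> C) (s t v : R) : s <= t ->
  (forall x, s <= x <= t -> {for (x%:C : C), continuous f}) ->
  ReC (f s%:C) <= v <= ReC (f t%:C) -> exists2 x, s <= x <= t & ReC (f x%:C) = v.
Proof.
move=> st cf /andP[v1 v2].
have [| |x xst xv] := @IVT R (fun x => ReC (f x%:C)) s t v st.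
- apply: continuous_in_subspaceT => x; rewrite inE /= in_itv /= => /cf.
  exact: continuous_real_line.
- by rewrite ge_min v1 le_max v2 orbT.
by exists x => //; move: xst; rewrite in_itv.
Qed.

Variables (E L : set C) (Phi Psi : C -> C) (b1 c1 : R).
Hypothesis E_conj : forall z : C, E z -> E (z^*).
Hypothesis dPhi : forall z, ~ E z -> exists d, cder Phi z d.
Hypothesis dPsi : forall w, ~ L w -> exists d, cder Psi w d.
Hypothesis PhiK : forall z, ~ E z -> ~ L (Phi z) /\ Psi (Phi z) = z.
Hypothesis PsiK : forall w, ~ L w -> ~ E (Psi w) /\ Phi (Psi w) = w.
Hypothesis Phi_norm : exists M r : R, forall z, r < cmod z ->
  cmod (Phi z - z) <= M / cmod z.
Hypothesis Phi_conj : forall z, ~ E z -> Phi (z^*) = (Phi z)^*.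
Hypothesis E_b1 : E b1%:C.
Hypothesis E_left : forall x, x < b1 -> ~ E x%:C.
Hypothesis L_c1 : L c1%:C.
Hypothesis L_left : forall x, x < c1 -> ~ L x%:C.

Lemma real_complex_Re (z : C) : ImC z = 0 -> (ReC z)%:C = z.
Proof. by move=> z0; apply: complex_ext => //=. Qed.

Lemma conformal_real z : ~ E z -> ImC z = 0 -> ImC (Phi z) = 0.
Proof.
move=> Ez z0; have := Phi_conj Ez.
have -> : z^* = z by apply: complex_ext; rewrite ?cRe_conj ?cIm_conj ?z0 ?oppr0.
by move=> /(congr1 (@complex.Im R)); rewrite cIm_conj; lra.
Qed.

Lemma conformal_inv_real w : ~ L w -> ImC w = 0 -> ImC (Psi w) = 0.
Proof.
move=> Lw w0; have [Ew PE] := PsiK Lw; have := Phi_conj Ew; rewrite PE.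
have -> : w^* = w by apply: complex_ext; rewrite ?cRe_conj ?cIm_conj ?w0 ?oppr0.
move=> H; have Ew' : ~ E ((Psi w)^*) by move=> /E_conj; rewrite conjcK.
have [_] := PhiK Ew'; rewrite H => /(congr1 (@complex.Im R)); rewrite cIm_conj; lra.
Qed.

(** [Phi] is real on the half-line and close to the identity far to the left. If it reached c_1 or
    more, it would take the value c_1, a point of [L], at some real t < b_1. *)
Lemma conformal_left x : x < b1 -> ReC (Phi x%:C) < c1.
Proof.
move=> xb; rewrite ltNge; apply/negP => xc.
have [B B0 BP] := conformal_near_id Phi_norm ltr01.
pose x' := Num.min x (Num.min (c1 - 1) (- B)) - 1.
have [h1 [h2 h3]] : x' < x /\ x' < c1 - 1 /\ x' < - B.
  have t1 : Num.min x (Num.min (c1 - 1) (- B)) <= x by rewrite ge_min lexx.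
  have t2 : Num.min x (Num.min (c1 - 1) (- B)) <= c1 - 1 by rewrite !ge_min lexx orbT.
  have t3 : Num.min x (Num.min (c1 - 1) (- B)) <= - B by rewrite !ge_min lexx !orbT.
  by rewrite /x'; split; [|split]; lra.
have Bx : B < cmod (x'%:C : C) by rewrite cmod_real ltr0_norm; lra.
have := le_trans (abs_Re_le _) (BP _ Bx); rewrite cReD cReN /= ler_norml => /andP[_ h4].
have h5 : ReC (Phi x'%:C) <= c1 <= ReC (Phi x%:C) by apply/andP; split=> //; lra.
have [t /andP[t1 t2]|t /andP[t1 t2] tc] := real_IVT (ltW h1) _ h5.
  have Et : ~ E t%:C by apply: E_left; lra.
  by have [d /cder_cont] := dPhi Et.
have Et : ~ E t%:C by apply: E_left; lra.
have [Lt _] := PhiK Et; apply: Lt; rewrite -(real_complex_Re (conformal_real Et _)) ?tc //.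
Qed.

Lemma conformal_inv_left w : w < c1 -> ReC (Psi w%:C) < b1.
Proof.
move=> wc; rewrite ltNge; apply/negP => wb.
have [B B0 BP] := conformal_near_id Phi_norm ltr01.
pose x := Num.min b1 (Num.min (w - 1) (- B)) - 1.
have [h1 [h2 h3]] : x < b1 /\ x < w - 1 /\ x < - B.
  have t1 : Num.min b1 (Num.min (w - 1) (- B)) <= b1 by rewrite ge_min lexx.
  have t2 : Num.min b1 (Num.min (w - 1) (- B)) <= w - 1 by rewrite !ge_min lexx orbT.
  have t3 : Num.min b1 (Num.min (w - 1) (- B)) <= - B by rewrite !ge_min lexx !orbT.
  by rewrite /x; split; [|split]; lra.
have Bx : B < cmod (x%:C : C) by rewrite cmod_real ltr0_norm; lra.
have := le_trans (abs_Re_le _) (BP _ Bx); rewrite cReD cReN /= ler_norml => /andP[_ h4].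
(* The normalization concerns [Phi], not [Psi], so the starting point far to the left in the w-plane
   is taken as w' = Phi x, where [Psi] has the value x < b_1. *)
have Ex := E_left h1; have [_ Px] := PhiK Ex.
have Pr := real_complex_Re (conformal_real Ex (erefl _)).
set w' := ReC (Phi x%:C) in h4 Pr.
have ww : w' <= w by lra.
have h5 : ReC (Psi w'%:C) <= b1 <= ReC (Psi w%:C).
  by rewrite Pr Px /=; apply/andP; split=> //; exact: ltW.
have [t /andP[t1 t2]|t /andP[t1 t2] tb] := real_IVT ww _ h5.
  have Lt : ~ L t%:C by apply: L_left; lra.
  by have [d /cder_cont] := dPsi Lt.
have Lt : ~ L t%:C by apply: L_left; lra.
have [Et _] := PsiK Lt; apply: Et; rewrite -(real_complex_Re (conformal_inv_real Lt _)) ?tb //.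
Qed.

Lemma conformal_slit_domain z : slit_domain E b1 z -> slit_domain L c1 (Phi z).
Proof.
move=> /slit_domainP[Ez nz]; apply/slit_domainP; have [LP PE] := PhiK Ez; split=> // -[p0 pc].
have z0 : ImC z = 0 by rewrite -PE; exact: conformal_inv_real.
apply: nz; split=> //; rewrite leNgt; apply/negP => /conformal_left.
by rewrite real_complex_Re //; lra.
Qed.

Lemma conformal_inv_slit_domain w : slit_domain L c1 w -> slit_domain E b1 (Psi w).
Proof.
move=> /slit_domainP[Lw nw]; apply/slit_domainP; have [EP PE] := PsiK Lw; split=> // -[p0 pc].
have w0 : ImC w = 0 by rewrite -PE; exact: conformal_real.
apply: nw; split=> //; rewrite leNgt; apply/negP => /conformal_inv_left.
by rewrite real_complex_Re //; lra.
Qed.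

(** The set [E] admits no direct argument by vertical lines; connectedness is transported from the
    lemniscatic side. *)
Lemma conformal_slit_domain_connected : connected (slit_domain L c1) ->
  connected (slit_domain E b1).
Proof.
move=> cD; have -> : slit_domain E b1 = Psi @` slit_domain L c1.
  apply/seteqP; split=> [z Dz|_ [w Dw <-]]; last exact: conformal_inv_slit_domain.
  exists (Phi z); first exact: conformal_slit_domain.
  by have /slit_domainP[/PhiK[]] := Dz.
apply: connected_continuous_connected => //; apply: continuous_in_subspaceT => w.
by rewrite inE => /slit_domainP[/dPsi[d /cder_cont]].
Qed.

End RealLine.

(** * The branch of the complex Green's function *)

Section Branch.
Variable R : realType.
Local Notation C := (Cplx R).
Local Notation ReC := complex.Re.
Local Notation ImC := complex.Im.

Variables (l : nat) (a : nat -> C) (m : nat -> R) (r : R) (c : nat -> R) (gL : C -> R).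
Local Notation L := (lemniscatic_set l a m r).
Local Notation DL := (slit_domain L (c 1%N)).
Local Notation g0 := (lemniscatic_green l a m r).
Hypothesis l_gt0 : (1 <= l)%N.
Hypothesis lab : lemniscatic_labelling l L a c.
Hypothesis m_gt0 : forall j, (1 <= j < l.+1)%N -> 0 < m j.
Hypothesis m_sum : \sum_(1 <= j < l.+1) m j = 1.
Hypothesis gL_green : is_green L gL.

Let r_gt0 : 0 < r := labelling_level_gt0 l_gt0 lab.

Let a_real j : (1 <= j < l.+1)%N -> ImC (a j) = 0.
Proof. by move=> jl; apply: (centers_real lab); lia. Qed.

Lemma lemniscatic_green_eq w : ~ L w -> g0 w = gL w.
Proof.
have cL : compact L by exact: compact_lemniscatic_set.
apply: (green_unique cL gL_green (h := g0)).
- exact: lemniscatic_green_locally_Re.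
- by move=> z Lz; apply: ltW; exact: (lemniscatic_green_gt0 m_gt0).
- by move=> e; exact: closed_lemniscatic_green.
- by have [M [B [_ H]]] := lemniscatic_green_pole a r m_gt0 m_sum; exists M, B.
Qed.

(** Writing a_j - w puts the cut of the j-th logarithm on the real ray to the right of a_j, which is
    contained in the ray from c_1 on. *)
Definition lemniscatic_branch (w : C) : C :=
  \sum_(1 <= j < l.+1) (m j)%:C * Log (a j - w) - (ln r)%:C.

Lemma lemniscatic_branchE w : ~ L w ->
  lemniscatic_branch w = gL w +i* \sum_(1 <= j < l.+1) m j * Arg (a j - w).
Proof.
move=> Lw; rewrite -lemniscatic_green_eq //; apply: complex_ext.
  rewrite /lemniscatic_branch cReD cReN Re_sum [RHS]/= /lemniscatic_green; congr (_ - _); apply: eq_bigr => j _.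
  by rewrite cReM /= mul0r subr0 cmodBC.
rewrite /lemniscatic_branch cImD cImN Im_sum [RHS]/= subr0; apply: eq_bigr => j _.
by rewrite cImM /= mul0r addr0.
Qed.

Lemma lemniscatic_branch_cder w : DL w -> exists d, cder lemniscatic_branch w d.
Proof.
move=> Dw; eexists; apply: cderB; last exact: cder_cst.
apply: cder_sum_nat => j jl; apply: cderZ; apply: cder_comp.
  by have := cderB (cder_cst (a j) w) (cder_id w); exact.
by apply: cder_Log; exact: (slit_domain_center_sub l_gt0 lab Dw).
Qed.

Lemma lemniscatic_branch_green : green_branch gL DL lemniscatic_branch.
Proof.
split=> [w Dw|w /slit_domainP[Lw _]]; last by rewrite lemniscatic_branchE.
by apply/derivableC_P; exact: lemniscatic_branch_cder.
Qed.

Let gL_cont := green_cont gL_green.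

Lemma lemniscatic_branch_cvg w : L w -> ~ (ImC w = 0 /\ c 1%N < ReC w) ->
  lemniscatic_branch @ within DL (nbhs w) -->
    (0 +i* \sum_(1 <= j < l.+1) m j * Arg (a j - w) : C).
Proof.
move=> Lw nw; rewrite -[X in X +i* _](green_on gL_green Lw).
apply: (@cvg_within_complex _ _ _ _ gL (fun w => \sum_(1 <= j < l.+1) m j * Arg (a j - w))).
- by move=> z /slit_domainP[Lz _]; exact: lemniscatic_branchE.
- exact: gL_cont.
- apply: (@tends_within_sum _ _ _ _ (fun j w => Arg (a j - w)) (fun j => Arg (a j - w))) => j jl.
  by apply: Arg_sub_tends; exact: (slit_center_sub l_gt0 lab jl).
Qed.

Let first_sum0 : \sum_(1 <= j < l.+1) m j * Arg (a j - (c 1%N)%:C) = 0.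
Proof.
rewrite big_nat_cond big1 // => j /andP[jl _].
by rewrite Arg_sub_real ?mulr0 ?a_real // (first_endpoint_lt_center l_gt0 lab).
Qed.

Lemma lemniscatic_branch_cvg0 :
  lemniscatic_branch @ within DL (nbhs ((c 1%N)%:C : C)) --> (0 : C).
Proof.
have := @lemniscatic_branch_cvg (c 1%N)%:C; rewrite first_sum0; apply.
  by apply: (lemniscatic_endpoint l_gt0 lab); lia.
by move=> [_] /=; rewrite ltxx.
Qed.

Lemma slit_domain_real x : x < c 1%N -> DL x%:C.
Proof.
move=> xc; have := slit_domain_left l_gt0 lab m_gt0 (t := 0) xc.
by rewrite mul0r addr0.
Qed.

Lemma lemniscatic_branch_unique G : green_branch gL DL G ->
  G @ within DL (nbhs ((c 1%N)%:C : C)) --> (0 : C) ->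
  forall w, DL w -> G w = lemniscatic_branch w.
Proof.
move=> bG limG w Dw.
have oD : open DL by apply: open_slit_domain; exact: closed_lemniscatic_set.
have cD : connected DL := connected_slit_domain l_gt0 lab m_gt0 m_sum.
apply/eqP; rewrite -subr_eq0 -cmod_eq0 eq_le cmod_ge0 andbT.
apply/ler_addgt0Pr => e e0; rewrite add0r; have e2 : 0 < e / 2 by lra.
have [d1 d10 d1P] := cvg_within_dist e2 limG.
have [d2 d20 d2P] := cvg_within_dist e2 lemniscatic_branch_cvg0.
pose t := Num.min d1 d2 / 2.
have m0 : 0 < Num.min d1 d2 by rewrite lt_min d10.
have m1 : Num.min d1 d2 <= d1 by rewrite ge_min lexx.
have m2 : Num.min d1 d2 <= d2 by rewrite ge_min lexx orbT.
have [t0 [t1 t2]] : 0 < t /\ t < d1 /\ t < d2 by rewrite /t; split; [|split]; lra.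
(* At this point of the slit domain both branches are within e / 2 of 0, and their difference is the
   same everywhere. *)
pose x := c 1%N - t; have xc : x < c 1%N by rewrite /x; lra.
have Dx := slit_domain_real xc.
have xd : cmod ((x%:C : C) - (c 1%N)%:C) = t.
  have xt : x - c 1%N = - t by rewrite /x; ring.
  by rewrite -rmorphB /= cmod_real xt normrN gtr0_norm.
rewrite (branch_difference_constant oD cD bG lemniscatic_branch_green Dw Dx).
have := d1P x%:C; have := d2P x%:C; rewrite xd !subr0 => /(_ t2 Dx) h2 /(_ t1 Dx) h1.
by apply: le_trans (cmodB_le _ _) _; lra.
Qed.

Lemma lemniscatic_branch_real x : x < c 1%N -> ImC (lemniscatic_branch x%:C) = 0.
Proof.
move=> xc; have /slit_domainP[Lx _] := slit_domain_real xc.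
rewrite lemniscatic_branchE //= big_nat_cond big1 // => j /andP[jl _].
have := first_endpoint_lt_center l_gt0 lab jl => ca.
by rewrite Arg_sub_real ?mulr0 ?a_real //; lra.
Qed.

Lemma slit_domain_conj w : DL w -> DL (w^*).
Proof.
move=> /slit_domainP[Lw nw]; apply/slit_domainP; split.
  exact: (lemniscatic_compl_conj m_gt0 a_real).
by rewrite cRe_conj cIm_conj => -[w0 wc]; apply: nw; split=> //; lra.
Qed.

Lemma lemniscatic_branch_conj w : DL w ->
  lemniscatic_branch w = (lemniscatic_branch (w^*))^*.
Proof.
move=> Dw; have /slit_domainP[Lw _] := Dw.
have /slit_domainP[Lw' _] := slit_domain_conj Dw.
rewrite !lemniscatic_branchE //; apply: complex_ext => /=.
  by rewrite -!lemniscatic_green_eq // (lemniscatic_green_conj _ _ a_real).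
rewrite -sumrN big_nat_cond [RHS]big_nat_cond; apply: eq_bigr => j /andP[jl _].
have -> : a j - w^* = (a j - w)^*.
  by apply: complex_ext; rewrite !ReImE ?a_real //; ring.
by rewrite Arg_conj ?mulrN ?opprK //; exact: (slit_domain_center_sub l_gt0 lab Dw).
Qed.

Lemma closure_gap j u : (j <= l)%N -> closure (gap l c j) u ->
  ((1 <= j)%N -> c (2 * j)%N <= u) /\ ((j < l)%N -> u <= c (2 * j + 1)%N).
Proof.
have sub (A B : set R) : A `<=` B -> closed B -> closure A `<=` B.
  by move=> AB /closure_id ->; exact: closureS.
rewrite /gap => jl; have [->|j0] := eqVneq j 0%N.
  move=> H; split=> // _; have := sub _ [set x | x <= c 1%N] _ (@closed_le _ _) u H.
  by apply; move=> x /=; rewrite in_itv /= => /ltW.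
have [->|jnl] := eqVneq j l.
  move=> H; split=> [_|]; last by rewrite ltnn.
  have := sub _ [set x | c (2 * l)%N <= x] _ (@closed_ge _ _) u H.
  by apply; move=> x /=; rewrite in_itv /= andbT => /ltW.
move=> H; split=> _.
  have := sub _ [set x | c (2 * j)%N <= x] _ (@closed_ge _ _) u H.
  by apply; move=> x /=; rewrite in_itv /= => /andP[/ltW].
have := sub _ [set x | x <= c (2 * j + 1)%N] _ (@closed_le _ _) u H.
by apply; move=> x /=; rewrite in_itv /= => /andP[_ /ltW].
Qed.

Lemma sum_partial (k : R) j : (j <= l)%N ->
  \sum_(1 <= i < l.+1) m i * (if (i <= j)%N then k else 0) =
  k * \sum_(1 <= i < j.+1) m i.
Proof.
move=> jl; rewrite (@big_cat_nat _ _ _ j.+1) //= mulr_sumr.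
rewrite [X in _ + X]big_nat_cond [X in _ + X]big1 ?addr0; last first.
  by move=> i /andP[/andP[ij _] _]; rewrite leqNgt ij mulr0.
rewrite big_nat_cond [RHS]big_nat_cond; apply: eq_bigr => i /andP[/andP[_ ij] _].
by rewrite -ltnS ij mulrC.
Qed.

(** The limit [k] of the arguments on the cut is - pi from above and pi from below; keeping [S] and
    [k] abstract covers both sides. *)
Lemma lemniscatic_branch_gap (S : set C) (k : R) j u : (j <= l)%N -> closure (gap l c j) u ->
  (forall w, S w -> ~ L w) ->
  (forall b : C, ImC b = 0 -> ReC b < u -> tends_within S u%:C (fun w => Arg (b - w)) k) ->
  lemniscatic_branch @ within S (nbhs (u%:C : C)) -->
    (gL u%:C +i* (k * \sum_(1 <= i < j.+1) m i) : C).
Proof.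
move=> jl /(closure_gap jl)[ju uj] SL Hk; rewrite -(sum_partial k jl).
apply: (@cvg_within_complex _ _ _ _ gL (fun w => \sum_(1 <= j < l.+1) m j * Arg (a j - w))).
- by move=> z /SL; exact: lemniscatic_branchE.
- exact: gL_cont.
apply: (@tends_within_sum _ _ _ _ (fun j w => Arg (a j - w))) => i il.
(* Centers with index at most j lie to the left of u and contribute [k]; the others lie to the
   right, where the argument tends to 0. *)
case: ifP => ij.
  apply: Hk; first exact: a_real.
  have j1 : (1 <= j)%N by lia.
  have ci : ReC (a i) < c (2 * j)%N by apply: (center_lt l_gt0 lab); lia.
  by have := ju j1; lra.
have ui : u < ReC (a i).
  have jl' : (j < l)%N by lia.
  have ci : c (2 * j.+1 - 1)%N < ReC (a i) by apply: (center_gt l_gt0 lab); lia.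
  have E : (2 * j.+1 - 1)%N = (2 * j + 1)%N by lia.
  by rewrite E in ci; have := uj jl'; lra.
rewrite -(Arg_sub_real (a_real il) ui).
by apply: Arg_sub_tends; exact: (slit_sub_real (a_real il) ui).
Qed.

Lemma endpoint_closure_gap_left j : (1 <= j <= l)%N -> closure (gap l c j) (c (2 * j)%N).
Proof.
move=> /andP[j1 jl] A /nbhs_ballP[e /= e0 eA].
have [d [d0 de gd]] : exists d, [/\ 0 < d, d < e & gap l c j (c (2 * j)%N + d)].
  rewrite /gap; have -> : (j == 0)%N = false by lia.
  case: eqVneq => [->|jnl].
    by exists (e / 2); split; rewrite /= ?in_itv /=; lra.
  have cc : c (2 * j)%N < c (2 * j + 1)%N.
    by rewrite addn1; apply: (endpoints_lt lab); lia.
  pose q := Num.min e (c (2 * j + 1)%N - c (2 * j)%N).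
  have q0 : 0 < q by rewrite lt_min e0 subr_gt0.
  have q1 : q <= e by rewrite ge_min lexx.
  have q2 : q <= c (2 * j + 1)%N - c (2 * j)%N by rewrite ge_min lexx orbT.
  by exists (q / 2); split; rewrite /= ?in_itv /=; lra.
exists (c (2 * j)%N + d); split=> //; apply: eA.
by rewrite -ball_normE /= opprD addrA subrr sub0r normrN gtr0_norm.
Qed.

Lemma endpoint_closure_gap_right j : (1 <= j <= l.-1)%N -> closure (gap l c j) (c (2 * j + 1)%N).
Proof.
move=> /andP[j1 jl] A /nbhs_ballP[e /= e0 eA].
have cc : c (2 * j)%N < c (2 * j + 1)%N.
  by rewrite addn1; apply: (endpoints_lt lab); lia.
pose q := Num.min e (c (2 * j + 1)%N - c (2 * j)%N).
have q0 : 0 < q by rewrite lt_min e0 subr_gt0.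
have q1 : q <= e by rewrite ge_min lexx.
have q2 : q <= c (2 * j + 1)%N - c (2 * j)%N by rewrite ge_min lexx orbT.
exists (c (2 * j + 1)%N - q / 2); split.
  rewrite /gap; have -> : (j == 0)%N = false by lia.
  have -> : (j == l) = false by lia.
  by rewrite /= in_itv /=; lra.
by apply: eA; rewrite -ball_normE /= opprB addrCA subrr addr0 gtr0_norm; lra.
Qed.

End Branch.

(** * The branch for L, its pullback to E and its boundary values *)

Lemma compact_union_upto (R : realType) (l : nat) (E : nat -> set (Cplx R)) :
  (forall j, (1 <= j <= l)%N -> compact (E j)) -> compact (union_upto l E).
Proof.
elim: l => [|l IH] H.
  have -> : union_upto 0 E = set0; last exact: compact0.
  by apply/seteqP; split=> // z [j /= jl]; lia.
have -> : union_upto l.+1 E = union_upto l E `|` E l.+1.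
  apply/seteqP; split=> [z [j /= jl Ez]|z [[j /= jl Ez]|Ez]].
  - have [jE|jE] := eqVneq j l.+1; first by right; rewrite -jE.
    by left; exists j => //=; lia.
  - by exists j => //=; lia.
  - by exists l.+1 => //=; lia.
by apply: compactU; [apply: IH => j jl|]; apply: H; lia.
Qed.

Theorem theorem3p3 (R : realType) (l : nat) (Ej : nat -> set (Cplx R))
    (a : nat -> Cplx R) (m b c : nat -> R) (Phi : Cplx R -> Cplx R)
    (gE gL : Cplx R -> R) :
  let E := union_upto l Ej in
  let L := lemniscatic_set l a m (capacity E) in
  let DE := slit_domain E (b 1%N) in
  let DL := slit_domain L (c 1%N) in
  symmetric_family l Ej ->
  real_labelling l Ej b ->
  walsh_map l E a m Phi ->
  lemniscatic_labelling l L a c ->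
  is_green E gE ->
  is_green L gL ->
  simply_connected_domain DL /\
  (exists G : Cplx R -> Cplx R,
     green_branch gL DL G /\
     G @ within DL (nbhs ((c 1%N)%:C : Cplx R)) --> (0 : Cplx R)) /\
  forall G : Cplx R -> Cplx R,
    green_branch gL DL G ->
    G @ within DL (nbhs ((c 1%N)%:C : Cplx R)) --> (0 : Cplx R) ->
    (* (i) *)
    [/\ forall w, DL w ->
          G w = \sum_(1 <= j < l.+1) (m j)%:C * Log (a j - w)
                - (ln (capacity E))%:C,
        forall w, DL w ->
          G w = gL w +i* \sum_(1 <= j < l.+1) m j * Arg (a j - w),
        forall x : R, x < c 1%N -> complex.Im (G x%:C) = 0
      & forall w, DL w -> G w = (G (w^*))^*]
    /\
    (* (ii) *)
    [/\ forall z, DE z -> DL (Phi z),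
        exists GE : Cplx R -> Cplx R,
          green_branch gE DE GE /\
          GE x%:C @[x --> (b 1%N)^'-] --> (0 : Cplx R)
      & forall GE : Cplx R -> Cplx R,
          green_branch gE DE GE ->
          GE x%:C @[x --> (b 1%N)^'-] --> (0 : Cplx R) ->
          forall z, DE z -> G (Phi z) = GE z]
    /\
    (* (iii) *)
    let Gp (u : R) (v : Cplx R) :=
      G @ within (@upper_half_plane R `\` L) (nbhs (u%:C : Cplx R)) --> v in
    let Gm (u : R) (v : Cplx R) :=
      G @ within (@lower_half_plane R `\` L) (nbhs (u%:C : Cplx R)) --> v in
    [/\ forall w : Cplx R,
          ((closure L `\` L°) `\` open_real_ray (c 1%N)) w ->
          G @ within DL (nbhs w) -->
            ((0 +i* \sum_(1 <= j < l.+1) m j * Arg (a j - w)) : Cplx R),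
        forall (j : nat) (u : R), (j <= l)%N -> closure (gap l c j) u ->
          Gp u (gL u%:C +i* (- (pi * \sum_(1 <= k < j.+1) m k))) /\
          Gm u (gL u%:C +i* (pi * \sum_(1 <= k < j.+1) m k)),
        forall j : nat, (1 <= j <= l.-1)%N ->
          [/\ Gp (c (2 * j)%N) (0 +i* (- (pi * \sum_(1 <= k < j.+1) m k))),
              Gp (c (2 * j + 1)%N) (0 +i* (- (pi * \sum_(1 <= k < j.+1) m k))),
              Gm (c (2 * j)%N) (0 +i* (pi * \sum_(1 <= k < j.+1) m k))
            & Gm (c (2 * j + 1)%N) (0 +i* (pi * \sum_(1 <= k < j.+1) m k))]
      & [/\ G @ within DL (nbhs ((c 1%N)%:C : Cplx R)) --> (0 : Cplx R),
            Gp (c (2 * l)%N) (0 +i* (- pi)) & Gm (c (2 * l)%N) (0 +i* pi)]].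
Proof.
move=> E L DE DL family blab walsh lab gEg gLg.
have l0 : (1 <= l)%N := family_nonempty family.
have m0 j : (1 <= j < l.+1)%N -> 0 < m j by exact: (walsh_exponents_gt0 walsh).
have m1 := walsh_exponents_sum walsh.
have a0 j : (1 <= j < l.+1)%N -> complex.Im (a j) = 0 by exact: (centers_real lab).
have r0 : 0 < capacity E := labelling_level_gt0 l0 lab.
have cE : compact E.
  by apply: compact_union_upto => j /(family_simply_connected family)[].
have E_conj (z : Cplx R) : E z -> E (z^*).
  move=> [j jl Ez]; exists j => //; rewrite -(family_symmetric family jl).
  by exists z.
have b_le j : (1 <= j <= l)%N -> b 1%N <= b (2 * j - 1)%N.
  elim: j => [//|j IH] jl; have [->//|j1] := eqVneq j 0%N.
  have h1 := IH ltac:(lia); have h2 := labelling_le blab (j := j) ltac:(lia).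
  have h3 := labelling_lt blab (j := j) ltac:(lia).
  have -> : (2 * j.+1 - 1)%N = (2 * j + 1)%N by lia.
  by apply: le_trans h1 (le_trans h2 (ltW h3)).
have E_b1 : E (b 1%N)%:C.
  have jl : (1 <= 1 <= l)%N by rewrite l0.
  exists 1%N => //; have /seteqP[_ +] := labelling_trace blab jl; apply.
  by rewrite /= in_itv /= lexx; exact: (labelling_le blab jl).
have E_left x : x < b 1%N -> ~ E x%:C.
  move=> xb [j jl Ex]; have /seteqP[/(_ x Ex) + _] := labelling_trace blab jl.
  by rewrite /= in_itv /= => /andP[bx _]; have := b_le j jl; lra.
have L_c i : (1 <= i <= 2 * l)%N -> L (c i)%:C by exact: lemniscatic_endpoint.
have L_c1 : L (c 1%N)%:C by apply: L_c; lia.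
have L_left x : x < c 1%N -> ~ L x%:C by exact: lemniscatic_left.
have gL0 i : (1 <= i <= 2 * l)%N -> gL (c i)%:C = 0.
  by move=> /L_c; exact: (green_on gLg).
have [Psi [dPhi0 dPsi0 PhiK PsiK]] := walsh_conformal walsh.
have dPhi z : ~ E z -> exists d, cder Phi z d by move=> /dPhi0/derivableC_P.
have dPsi w : ~ L w -> exists d, cder Psi w d by move=> /dPsi0/derivableC_P.
have norm := walsh_normalized walsh.
have Phi_conj := conformal_conj m0 m1 r0 a0 cE E_conj dPhi dPsi PhiK PsiK norm gEg.
have oDL : open DL by apply: open_slit_domain; exact: closed_lemniscatic_set.
have cDL : connected DL := connected_slit_domain l0 lab m0 m1.
have oDE : open DE.
  by apply: open_slit_domain; exact: (compact_closed (@hausdorffC R) cE).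
have cDE : connected DE.
  exact: (conformal_slit_domain_connected E_conj dPhi dPsi PhiK PsiK norm Phi_conj E_b1
    E_left L_c1 L_left cDL).
have PhiD z : DE z -> DL (Phi z).
  exact: (conformal_slit_domain E_conj dPhi PhiK PsiK norm Phi_conj E_left L_c1).
pose G0 := lemniscatic_branch l a m (capacity E).
have G0_green : green_branch gL DL G0 by exact: lemniscatic_branch_green.
have G0_lim : G0 @ within DL (nbhs ((c 1%N)%:C : Cplx R)) --> (0 : Cplx R).
  exact: (lemniscatic_branch_cvg0 l0 lab m0 m1 gLg).
have G0E w : ~ L w -> G0 w = gL w +i* \sum_(1 <= j < l.+1) m j * Arg (a j - w).
  exact: (lemniscatic_branchE l0 lab m0 m1 gLg).
have G0_cvg (u : Cplx R) (S : set (Cplx R)) (G : Cplx R -> Cplx R) (v : Cplx R) : S `<=` DL ->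
    (forall w, DL w -> G w = G0 w) ->
    G0 @ within S (nbhs u) --> (v : Cplx R) -> G @ within S (nbhs u) --> v.
  move=> SD GE H; apply/cvgC_P => e e0; have [d d0 dP] := cvg_within_dist e0 H.
  by apply/nbhsC_P; exists d => // w wu Sw; rewrite GE; [exact: dP|exact: SD].
have gE_Phi z : ~ E z -> gL (Phi z) = gE z.
  move=> Ez; have [LP _] := PhiK _ Ez.
  rewrite -(lemniscatic_green_eq l0 lab m0 m1 gLg LP).
  exact: (green_pullback m0 m1 r0 cE dPhi dPsi PhiK PsiK norm gEg Ez).
have DE_left x : x < b 1%N -> DE x%:C.
  move=> xb; apply/slit_domainP; split; first exact: E_left.
  by move=> [_ /=]; lra.
(* Since [Phi] maps this half-line to the left of c_1, where the branch is real, the pullback is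
   just gE there and tends to 0 at b_1 by continuity of gE. *)
have Phi_left x : x < b 1%N -> G0 (Phi x%:C) = (gE x%:C)%:C.
  move=> xb; have Ex := E_left x xb; have [LP _] := PhiK _ Ex.
  have Pr := conformal_real Phi_conj Ex (erefl _).
  have Pl := conformal_left dPhi PhiK norm Phi_conj E_left L_c1 xb.
  rewrite -[X in G0 X](real_complex_Re Pr).
  apply: complex_ext; last exact: (lemniscatic_branch_real l0 lab m0 m1 gLg Pl).
  by rewrite (real_complex_Re Pr) G0E //= gE_Phi.
have GE_lim : G0 (Phi x%:C) @[x --> (b 1%N)^'-] --> (0 : Cplx R).
  apply/cvgC_P => e e0.
  have cg : {for ((b 1%N)%:C : Cplx R), continuous gE} by exact: (green_cont gEg).
  have [d d0 dP] := (continuousC_R_P gE (b 1%N)%:C).1 cg e e0.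
  have bd : b 1%N - d < b 1%N by lra.
  have [h1 h2] := (nbhs_left_gt bd, nbhs_left_lt (b 1%N)).
  apply: filterS (filterI h1 h2) => x [xd xb].
  rewrite Phi_left // subr0 cmod_real.
  have := dP x%:C; rewrite -rmorphB /= cmod_real (green_on gEg E_b1) subr0.
  by apply; rewrite ltr0_norm; lra.
have GE_green : green_branch gE DE (G0 \o Phi).
  split=> [z Dz|z Dz]; have /slit_domainP[Ez _] := Dz.
    have [d1 D1] := dPhi z Ez.
    have [d2 D2] := lemniscatic_branch_cder l0 lab (PhiD z Dz).
    by apply/derivableC_P; exists (d2 * d1); exact: (cder_comp D1 D2).
  have [LP _] := PhiK _ Ez; rewrite /= G0E //=; exact: gE_Phi.
split; first exact: slit_domain_simply_connected.
split; first by exists G0.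
move=> G Gg Glim.
have GE w : DL w -> G w = G0 w.
  exact: (lemniscatic_branch_unique l0 lab m0 m1 gLg Gg Glim).
have upper_sub : @upper_half_plane R `\` L `<=` DL.
  by move=> w [w0 Lw]; apply/slit_domainP; split=> // -[w1 _]; move: w0; rewrite /= /upper_half_plane /= w1 ltxx.
have lower_sub : @lower_half_plane R `\` L `<=` DL.
  by move=> w [w0 Lw]; apply/slit_domainP; split=> // -[w1 _]; move: w0; rewrite /= /lower_half_plane /= w1 ltxx.
have gap_p j u : (j <= l)%N -> closure (gap l c j) u ->
    G @ within (@upper_half_plane R `\` L) (nbhs (u%:C : Cplx R)) -->
      (gL u%:C +i* (- (pi * \sum_(1 <= k < j.+1) m k)) : Cplx R).
  move=> jl uj; apply: (G0_cvg _ _ _ _ upper_sub GE); rewrite -mulNr.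
  apply: (lemniscatic_branch_gap l0 lab m0 m1 gLg jl uj) => [w []//|x x0 xu].
  by apply: Arg_sub_tends_upper => // w [].
have gap_m j u : (j <= l)%N -> closure (gap l c j) u ->
    G @ within (@lower_half_plane R `\` L) (nbhs (u%:C : Cplx R)) -->
      (gL u%:C +i* (pi * \sum_(1 <= k < j.+1) m k) : Cplx R).
  move=> jl uj; apply: (G0_cvg _ _ _ _ lower_sub GE).
  apply: (lemniscatic_branch_gap l0 lab m0 m1 gLg jl uj) => [w []//|x x0 xu].
  by apply: Arg_sub_tends_lower => // w [].
have left_end j : (1 <= j <= l)%N -> closure (gap l c j) (c (2 * j)%N).
  exact: (endpoint_closure_gap_left l0 lab).
have right_end j : (1 <= j <= l.-1)%N -> closure (gap l c j) (c (2 * j + 1)%N).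
  exact: (endpoint_closure_gap_right l0 lab).
split; first split.
- by move=> w /GE.
- by move=> w Dw; rewrite GE // G0E //; have /slit_domainP[] := Dw.
- move=> x xc; rewrite GE; first exact: (lemniscatic_branch_real l0 lab m0 m1 gLg xc).
  exact: (slit_domain_real l0 lab m0 xc).
- move=> w Dw; have Dw' := slit_domain_conj l0 lab m0 Dw.
  by rewrite !GE //; exact: (lemniscatic_branch_conj l0 lab m0 m1 gLg Dw).
split; first split.
- exact: PhiD.
- by exists (G0 \o Phi).
(* Two branches on the connected slit domain differ by a constant, which is read off at a real point
   close to b_1. *)
- move=> H Hg Hlim z Dz; rewrite GE; last exact: PhiD.
  apply/eqP; rewrite -subr_eq0 -cmod_eq0 eq_le cmod_ge0 andbT.
  apply/ler_addgt0Pr => e e0; rewrite add0r; have e2 : 0 < e / 2 by lra.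
  have h1 := (cvgC_P _ _).1 GE_lim _ e2; have h2 := (cvgC_P _ _).1 Hlim _ e2.
  have [x [[x1 x2] xb]] := filter_ex (filterI (filterI (h1 _) (h2 _)) (nbhs_left_lt (b 1%N))).
  have := branch_difference_constant oDE cDE GE_green Hg Dz (DE_left x xb).
  move=> /= ->; rewrite !subr0 in x1 x2.
  by apply: le_trans (cmodB_le _ _) _; lra.
move=> Gp Gm; split.
- move=> w [[wL _] wr].
  have Lw : L w.
    by move: wL; rewrite -(closure_id L).1 //; exact: closed_lemniscatic_set.
  apply: (G0_cvg _ _ _ _ (@subset_refl _ DL) GE).
  apply: (lemniscatic_branch_cvg l0 lab m0 m1 gLg Lw) => -[w0 wc]; apply: wr.
  by exists (complex.Re w); [rewrite /= in_itv /= wc|exact: real_complex_Re].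
- by move=> j u jl uj; split; [exact: gap_p|exact: gap_m].
- move=> j jl; have jl1 : (j <= l)%N by lia.
  have jl2 : (1 <= j <= l)%N by lia.
  have hl := left_end j jl2; have hr := right_end j jl.
  have e1 := gL0 (2 * j)%N ltac:(lia); have e2 := gL0 (2 * j + 1)%N ltac:(lia).
  split.
  + by have := gap_p j _ jl1 hl; rewrite e1.
  + by have := gap_p j _ jl1 hr; rewrite e2.
  + by have := gap_m j _ jl1 hl; rewrite e1.
  + by have := gap_m j _ jl1 hr; rewrite e2.
- have ll : (1 <= l <= l)%N by rewrite l0 leqnn.
  have e1 := gL0 (2 * l)%N ltac:(lia).
  split; first exact: Glim.
  + by have := gap_p l _ (leqnn l) (left_end l ll); rewrite e1 m1 mulr1.
  + by have := gap_m l _ (leqnn l) (left_end l ll); rewrite e1 m1 mulr1.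
Qed.
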